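(* $\mathsf{RCA}_0^\omega$ proves $\mathsf{Korg}_2\to\mathsf{cocode}_1$ and $\mathsf{cocode}_0\leftrightarrow[\mathsf{Korg}_2+\mathsf{CB}\mathbb N]$.
   Context: Framework: Kohlenbach's higher-order arithmetic; $\mathsf{RCA}_0^\omega$ is the base theory (ordered semiring axioms, combinators/$\lambda$-abstraction, primitive recursion $\mathbf R_0$, extensionality at all finite types, quantifier-free induction, $\mathsf{QF\text{-}AC}^{1,0}$). Reals are fast-converging Cauchy sequences of rationals with equality $=_{\mathbb R}$. A set $A\subseteq\mathbb R$ is an arbitrary function $A:\mathbb R\to\mathbb R$ with $x\in A$ meaning $A(x)>0$; countable if there is $Y:\mathbb R\to\mathbb N$ with $(\forall x,y\in A)(Y(x)=Y(y)\to x=_{\mathbb R}y)$, strongly countable if moreover $(\forall n)(\exists x\in A)(Y(x)=n)$; finite if there are $n\in\mathbb N$ and an injection $Y:A\to\{0,1,\dots,n\}$. $\mathsf{Korg}_2$ (K\''onig's infinity lemma for sets): given a sequence $E_0,E_1,\dots$ of finite non-empty subsets of $\mathbb R$ and a binary relation $R$ such that for every $x\in E_{n+1}$ there is $y\in E_n$ with $yRx$, there is a sequence $(x_n)$ with $x_n\in E_n$ and $x_nRx_{n+1}$ for all $n$. $\mathsf{cocode}_0$: every non-empty countable $A\subseteq[0,1]$ has a sequence $(x_n)$ in $A$ with $(\forall x)(x\in A\leftrightarrow(\exists n)(x_n=_{\mathbb R}x))$; $\mathsf{cocode}_1$: same for strongly countable $A$. $\mathsf{CB}\mathbb N$: a countable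 $A\subseteq\mathbb R$ is strongly countable if there is a sequence of pairwise distinct reals all in $A$.
   Formalization: In Korg_2 the sequence of finite sets E_n is assumed to come with sequences of bounds k_n and injections Y_n from E_n to {0,...,k_n}; with finiteness required only separately for each n, cocode_0 does not prove Korg_2 in RCA_0^omega. *)

(* Defs.v *)
From Stdlib Require Import List.
Import ListNotations.

Set Implicit Arguments.
Unset Strict Implicit.
Unset Printing Implicit Defensive.

Inductive ty : Set :=
| N : ty
| Arr : ty -> ty -> ty.

Declare Scope ty_scope.
Delimit Scope ty_scope with ty.
Bind Scope ty_scope with ty.
Notation "s ⇒ t" := (Arr s t) (at level 60, right associativity) : ty_scope.
Open Scope ty_scope.

Definition T1 : ty := N ⇒ N.

Definition ctx := list ty.

(* Terms and formulas are intrinsically typed, with typed de Bruijn variables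
   drawn from a context. *)
Inductive var : ctx -> ty -> Set :=
| vz : forall G s, var (s :: G) s
| vs : forall G s t, var G t -> var (s :: G) t.
Arguments vz {G s}.
Arguments vs {G s t} _.

Inductive tm (G : ctx) : ty -> Set :=
| TVar : forall s, var G s -> tm G s
| TApp : forall s t, tm G (s ⇒ t) -> tm G s -> tm G t
| TZero : tm G N
| TOne : tm G N
| TPlus : tm G (N ⇒ N ⇒ N)
| TMult : tm G (N ⇒ N ⇒ N)
| TPi : forall s t, tm G (s ⇒ t ⇒ s)
| TSigma : forall r s t, tm G ((r ⇒ s ⇒ t) ⇒ (r ⇒ s) ⇒ r ⇒ t)
| TRec : tm G ((N ⇒ N ⇒ N) ⇒ N ⇒ N ⇒ N).
Arguments TVar {G s} _.
Arguments TApp {G s t} _ _.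
Arguments TZero {G}.
Arguments TOne {G}.
Arguments TPlus {G}.
Arguments TMult {G}.
Arguments TPi {G s t}.
Arguments TSigma {G r s t}.
Arguments TRec {G}.

Inductive fm (G : ctx) : Set :=
| Eq : tm G N -> tm G N -> fm G
| Lt : tm G N -> tm G N -> fm G
| Bot : fm G
| Imp : fm G -> fm G -> fm G
| And : fm G -> fm G -> fm G
| Or : fm G -> fm G -> fm G
| All : forall s, fm (s :: G) -> fm G
| Ex : forall s, fm (s :: G) -> fm G.
Arguments Bot {G}.

Definition Not {G} (f : fm G) : fm G := Imp f Bot.
Definition Iff {G} (f g : fm G) : fm G := And (Imp f g) (Imp g f).

Fixpoint qfree {G} (f : fm G) : Prop :=
  match f with
  | Eq _ _ | Lt _ _ | Bot => True
  | Imp a b | And a b | Or a b => qfree a /\ qfree b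
  | All _ | Ex _ => False
  end.

Definition ren (G D : ctx) : Set := forall s, var G s -> var D s.
Definition sub (G D : ctx) : Set := forall s, var G s -> tm D s.

Definition vcase {G : ctx} {s : ty} (P : ty -> Set) (p0 : P s)
  (pS : forall t, var G t -> P t) {t : ty} (x : var (s :: G) t) : P t :=
  match x in var G' t' return
    match G' with
    | [] => unit
    | s' :: G'' => P s' -> (forall t0, var G'' t0 -> P t0) -> P t'
    end
  with
  | vz => fun p _ => p
  | vs y => fun _ q => q _ y
  end p0 pS.

Definition rlift {G D} (s : ty) (r : ren G D) : ren (s :: G) (s :: D) :=
  fun t x => vcase (P := var (s :: D)) vz (fun _ y => vs (r _ y)) x.

Fixpoint tren {G D} (r : ren G D) {s} (a : tm G s) : tm D s :=
  match a with
  | TVar x => TVar (r _ x)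
  | TApp b c => TApp (tren r b) (tren r c)
  | TZero => TZero
  | TOne => TOne
  | TPlus => TPlus
  | TMult => TMult
  | TPi => TPi
  | TSigma => TSigma
  | TRec => TRec
  end.

Fixpoint fren {G D} (r : ren G D) (f : fm G) : fm D :=
  match f with
  | Eq a b => Eq (tren r a) (tren r b)
  | Lt a b => Lt (tren r a) (tren r b)
  | Bot => Bot
  | Imp a b => Imp (fren r a) (fren r b)
  | And a b => And (fren r a) (fren r b)
  | Or a b => Or (fren r a) (fren r b)
  | All a => All (fren (rlift r) a)
  | Ex a => Ex (fren (rlift r) a)
  end.

Definition scons {G D s} (a : tm D s) (f : sub G D) : sub (s :: G) D :=
  fun t x => vcase (P := tm D) a f x.

Definition slift {G D} (s : ty) (f : sub G D) : sub (s :: G) (s :: D) :=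
  scons (TVar vz) (fun t x => tren (fun _ y => vs y) (f t x)).

Fixpoint tsub {G D} (f : sub G D) {s} (a : tm G s) : tm D s :=
  match a with
  | TVar x => f _ x
  | TApp b c => TApp (tsub f b) (tsub f c)
  | TZero => TZero
  | TOne => TOne
  | TPlus => TPlus
  | TMult => TMult
  | TPi => TPi
  | TSigma => TSigma
  | TRec => TRec
  end.

Fixpoint fsub {G D} (f : sub G D) (a : fm G) : fm D :=
  match a with
  | Eq b c => Eq (tsub f b) (tsub f c)
  | Lt b c => Lt (tsub f b) (tsub f c)
  | Bot => Bot
  | Imp b c => Imp (fsub f b) (fsub f c)
  | And b c => And (fsub f b) (fsub f c)
  | Or b c => Or (fsub f b) (fsub f c)
  | All b => All (fsub (slift f) b)
  | Ex b => Ex (fsub (slift f) b)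
  end.

Definition inst {G s} (f : fm (s :: G)) (a : tm G s) : fm G :=
  fsub (scons a (fun _ x => TVar x)) f.

Definition fshift {G s} (f : fm G) : fm (s :: G) := fren (fun _ x => vs x) f.

(* [↑ a] moves a term into an extension of its context; the extension is
   found by instance search. *)
Class Ext (G D : ctx) : Set := ext : ren G D.
#[export] Instance ext_refl (G : ctx) : Ext G G | 0 := fun _ x => x.
#[export] Instance ext_skip (G D : ctx) (s : ty) (e : Ext G D) :
  Ext G (s :: D) | 1 := fun _ x => vs (e _ x).

Definition wk {G D s} {e : Ext G D} (a : tm G s) : tm D s := tren e a.

Definition all_ {G} (s : ty) (f : tm (s :: G) s -> fm (s :: G)) : fm G :=
  All (f (TVar vz)).
Definition ex_ {G} (s : ty) (f : tm (s :: G) s -> fm (s :: G)) : fm G :=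
  Ex (f (TVar vz)).
Arguments all_ {G} s f.
Arguments ex_ {G} s f.

Declare Scope fm_scope.
Delimit Scope fm_scope with fm.
Bind Scope fm_scope with fm.
Declare Scope tm_scope.
Delimit Scope tm_scope with tm.
Bind Scope tm_scope with tm.
Open Scope fm_scope.
Open Scope tm_scope.

Notation "↑ a" := (wk a) (at level 9, a at level 8, right associativity)
  : tm_scope.
Notation "f · a" := (TApp f a) (at level 39, left associativity) : tm_scope.
Notation "a +' b" := (TApp (TApp TPlus a) b)
  (at level 50, left associativity) : tm_scope.
Notation "a *' b" := (TApp (TApp TMult a) b)
  (at level 40, left associativity) : tm_scope.

Notation "a ≐ b" := (Eq a b) (at level 70, no associativity) : fm_scope.
Notation "a ≺ b" := (Lt a b) (at level 70, no associativity) : fm_scope.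
Notation "¬' f" := (Not f) (at level 75, right associativity) : fm_scope.
Notation "f ∧' g" := (And f g) (at level 80, right associativity) : fm_scope.
Notation "f ∨' g" := (Or f g) (at level 85, right associativity) : fm_scope.
Notation "f ⊃ g" := (Imp f g) (at level 90, right associativity) : fm_scope.
Notation "f ≡ g" := (Iff f g) (at level 95, no associativity) : fm_scope.
Notation "'∀' x : s , f" := (all_ s (fun x => f))
  (at level 200, x name, s at level 69, f at level 200) : fm_scope.
Notation "'∃' x : s , f" := (ex_ s (fun x => f))
  (at level 200, x name, s at level 69, f at level 200) : fm_scope.

(* Equality at higher type is not primitive: it is pointwise equality. *)
Fixpoint eqT {s : ty} : forall {G}, tm G s -> tm G s -> fm G :=
  match s with
  | N => fun G a b => a ≐ b
  | Arr r t => fun G a b => ∀ z : r, eqT (↑a · z) (↑b · z)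
  end.

(* Axioms are stated for arbitrary terms, which amounts to their universal
   closures. *)
Inductive RCAw (G : ctx) : fm G -> Prop :=
| ax_refl (a : tm G N) : RCAw (a ≐ a)
| ax_sym (a b : tm G N) : RCAw (a ≐ b ⊃ b ≐ a)
| ax_trans (a b c : tm G N) : RCAw (a ≐ b ⊃ b ≐ c ⊃ a ≐ c)
| ax_lt_eq (a b c d : tm G N) : RCAw (a ≐ b ⊃ c ≐ d ⊃ a ≺ c ⊃ b ≺ d)
| ax_addA (a b c : tm G N) : RCAw (a +' (b +' c) ≐ (a +' b) +' c)
| ax_addC (a b : tm G N) : RCAw (a +' b ≐ b +' a)
| ax_add0 (a : tm G N) : RCAw (a +' TZero ≐ a)
| ax_mulA (a b c : tm G N) : RCAw (a *' (b *' c) ≐ (a *' b) *' c)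
| ax_mulC (a b : tm G N) : RCAw (a *' b ≐ b *' a)
| ax_mul1 (a : tm G N) : RCAw (a *' TOne ≐ a)
| ax_mul0 (a : tm G N) : RCAw (a *' TZero ≐ TZero)
| ax_mulDr (a b c : tm G N) : RCAw (a *' (b +' c) ≐ a *' b +' a *' c)
| ax_lt_irr (a : tm G N) : RCAw (¬' (a ≺ a))
| ax_lt_trans (a b c : tm G N) : RCAw (a ≺ b ⊃ b ≺ c ⊃ a ≺ c)
| ax_lt_total (a b : tm G N) : RCAw (a ≺ b ∨' a ≐ b ∨' b ≺ a)
| ax_lt_add (a b c : tm G N) : RCAw (a ≺ b ⊃ a +' c ≺ b +' c)
| ax_lt_mul (a b c : tm G N) : RCAw (TZero ≺ c ⊃ a ≺ b ⊃ a *' c ≺ b *' c)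
| ax_lt_01 : RCAw (TZero ≺ TOne)
(* ax_lt_0 and ax_lt_S are derivable from the other axioms *)
| ax_lt_0 (a : tm G N) : RCAw (¬' (a ≺ TZero))
| ax_lt_S (a b : tm G N) : RCAw (a ≺ b +' TOne ≡ (a ≺ b ∨' a ≐ b))
| ax_Pi (s t : ty) (x : tm G s) (y : tm G t) : RCAw (eqT (TPi · x · y) x)
| ax_Sigma (r s t : ty) (x : tm G (r ⇒ s ⇒ t)) (y : tm G (r ⇒ s)) (z : tm G r) :
    RCAw (eqT (TSigma · x · y · z) (x · z · (y · z)))
| ax_Rec0 (f : tm G (N ⇒ N ⇒ N)) (m : tm G N) :
    RCAw (TRec · f · m · TZero ≐ m)
| ax_RecS (f : tm G (N ⇒ N ⇒ N)) (m n : tm G N) :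
    RCAw (TRec · f · m · (n +' TOne) ≐ f · n · (TRec · f · m · n))
| ax_ext (s t : ty) (x y : tm G s) (f : tm G (s ⇒ t)) :
    RCAw (eqT x y ⊃ eqT (f · x) (f · y))
| ax_ind (A : fm (N :: G)) :
    qfree A ->
    RCAw (inst A TZero
          ⊃ All (A ⊃ fsub (scons (TVar vz +' TOne) (fun _ x => TVar (vs x))) A)
          ⊃ All A)
(* QF-AC^{1,0}; in A, variable 0 is the number and variable 1 is x *)
| ax_qfac (A : fm (N :: T1 :: G)) :
    qfree A ->
    RCAw (All (Ex A)
          ⊃ Ex (All (fsub (scons (TVar (vs vz) · TVar vz)
                            (scons (TVar vz) (fun _ x => TVar (vs (vs x))))
                            : sub (N :: T1 :: G) (T1 :: (T1 ⇒ N) :: G)) A))).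

Inductive prv (Ax : forall G, fm G -> Prop) :
  forall G : ctx, list (fm G) -> fm G -> Prop :=
| p_ax G (H : list (fm G)) f : Ax G f -> prv Ax H f
| p_hyp G (H : list (fm G)) f : In f H -> prv Ax H f
| p_impI G (H : list (fm G)) f g : prv Ax (f :: H) g -> prv Ax H (f ⊃ g)
| p_impE G (H : list (fm G)) f g :
    prv Ax H (f ⊃ g) -> prv Ax H f -> prv Ax H g
| p_andI G (H : list (fm G)) f g :
    prv Ax H f -> prv Ax H g -> prv Ax H (f ∧' g)
| p_andE1 G (H : list (fm G)) f g : prv Ax H (f ∧' g) -> prv Ax H f
| p_andE2 G (H : list (fm G)) f g : prv Ax H (f ∧' g) -> prv Ax H g
| p_orI1 G (H : list (fm G)) f g : prv Ax H f -> prv Ax H (f ∨' g)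
| p_orI2 G (H : list (fm G)) f g : prv Ax H g -> prv Ax H (f ∨' g)
| p_orE G (H : list (fm G)) f g h :
    prv Ax H (f ∨' g) -> prv Ax (f :: H) h -> prv Ax (g :: H) h -> prv Ax H h
| p_raa G (H : list (fm G)) f : prv Ax ((¬' f) :: H) Bot -> prv Ax H f
| p_allI G (H : list (fm G)) s (f : fm (s :: G)) :
    prv Ax (map fshift H) f -> prv Ax H (All f)
| p_allE G (H : list (fm G)) s (f : fm (s :: G)) (a : tm G s) :
    prv Ax H (All f) -> prv Ax H (inst f a)
| p_exI G (H : list (fm G)) s (f : fm (s :: G)) (a : tm G s) :
    prv Ax H (inst f a) -> prv Ax H (Ex f)
| p_exE G (H : list (fm G)) s (f : fm (s :: G)) (h : fm G) :
    prv Ax H (Ex f) -> prv Ax (f :: map fshift H) (fshift h) -> prv Ax H h.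

Definition RCAw_proves (f : fm []) : Prop := prv RCAw [] f.

Definition two {G} : tm G N := TOne +' TOne.

(* 2^n, by recursion with step fun _ r => r + r *)
Definition pow2 {G} (n : tm G N) : tm G N :=
  TRec · (TPi · (TSigma · TPlus · (TSigma · TPi · (TPi (t := N))))) · TOne · n.

(* the injective pairing (a + b)^2 + a *)
Definition pair {G} (a b : tm G N) : tm G N := (a +' b) *' (a +' b) +' a.

(* the code of the rational (a - b) / (c + 1) *)
Definition rat {G} (a b c : tm G N) : tm G N := pair (pair a b) c.

(* p and q code rationals and p + u/v < q + w/v (for v > 0) *)
Definition qlt {G} (p u q w v : tm G N) : fm G :=
  ∃ a : N, ∃ b : N, ∃ c : N, ∃ a' : N, ∃ b' : N, ∃ c' : N,
    ↑p ≐ rat ↑a ↑b ↑c ∧' ↑q ≐ rat ↑a' ↑b' ↑c'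
    ∧' ↑v *' (↑a *' (↑c' +' TOne) +' ↑b' *' (↑c +' TOne))
         +' ↑u *' ((↑c +' TOne) *' (↑c' +' TOne))
       ≺ ↑v *' (↑b *' (↑c' +' TOne) +' ↑a' *' (↑c +' TOne))
         +' ↑w *' ((↑c +' TOne) *' (↑c' +' TOne)).

(* |x_n - x_{n+i}| < 1/2^n for all n, i *)
Definition isReal {G} (x : tm G T1) : fm G :=
  ∀ n : N, ∀ i : N,
    qlt (↑x · ↑n) TZero (↑x · (↑n +' ↑i)) TOne (pow2 ↑n)
    ∧' qlt (↑x · (↑n +' ↑i)) TZero (↑x · ↑n) TOne (pow2 ↑n).

(* |x_n - y_n| <= 2/2^n for all n *)
Definition req {G} (x y : tm G T1) : fm G :=
  ∀ n : N,
    ¬' qlt (↑y · ↑n) two (↑x · ↑n) TZero (pow2 ↑n)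
    ∧' ¬' qlt (↑x · ↑n) two (↑y · ↑n) TZero (pow2 ↑n).

(* x_n + 2/2^n < y_n for some n *)
Definition rlt {G} (x y : tm G T1) : fm G :=
  ∃ n : N, qlt (↑x · ↑n) two (↑y · ↑n) TZero (pow2 ↑n).

Definition rle {G} (x y : tm G T1) : fm G := ¬' rlt y x.

Definition rzero {G} : tm G T1 := TPi · rat TZero TZero TZero.
Definition rone {G} : tm G T1 := TPi · rat TOne TZero TZero.

Notation "'∀ᴿ' x , f" := (all_ T1 (fun x => isReal x ⊃ f))
  (at level 200, x name, f at level 200) : fm_scope.
Notation "'∃ᴿ' x , f" := (ex_ T1 (fun x => isReal x ∧' f))
  (at level 200, x name, f at level 200) : fm_scope.

Definition isFunRR {G} (F : tm G (T1 ⇒ T1)) : fm G :=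
  (∀ᴿ x, isReal (↑F · ↑x))
  ∧' (∀ᴿ x, ∀ᴿ y, req ↑x ↑y ⊃ req (↑F · ↑x) (↑F · ↑y)).

Definition isFunRN {G} (Y : tm G (T1 ⇒ N)) : fm G :=
  ∀ᴿ x, ∀ᴿ y, req ↑x ↑y ⊃ ↑Y · ↑x ≐ ↑Y · ↑y.

Definition isSet {G} (A : tm G (T1 ⇒ T1)) : fm G := isFunRR A.

Definition mem {G} (x : tm G T1) (A : tm G (T1 ⇒ T1)) : fm G :=
  rlt rzero (A · x).

Definition injOn {G} (Y : tm G (T1 ⇒ N)) (A : tm G (T1 ⇒ T1)) : fm G :=
  ∀ᴿ x, ∀ᴿ y, mem ↑x ↑A ⊃ mem ↑y ↑A ⊃ ↑Y · ↑x ≐ ↑Y · ↑y ⊃ req ↑x ↑y.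

Definition countable {G} (A : tm G (T1 ⇒ T1)) : fm G :=
  ∃ Y : T1 ⇒ N, isFunRN ↑Y ∧' injOn ↑Y ↑A.

Definition strongly_countable {G} (A : tm G (T1 ⇒ T1)) : fm G :=
  ∃ Y : T1 ⇒ N, isFunRN ↑Y ∧' injOn ↑Y ↑A
    ∧' ∀ n : N, ∃ᴿ x, mem ↑x ↑A ∧' ↑Y · ↑x ≐ ↑n.

Definition nonempty {G} (A : tm G (T1 ⇒ T1)) : fm G := ∃ᴿ x, mem ↑x ↑A.

Definition sub01 {G} (A : tm G (T1 ⇒ T1)) : fm G :=
  ∀ᴿ x, mem ↑x ↑A ⊃ rle rzero ↑x ∧' rle ↑x rone.

(* Y is an injection A -> {0, ..., k}; only its values on A matter *)
Definition fin_inj {G} (Y : tm G (T1 ⇒ N)) (A : tm G (T1 ⇒ T1)) (k : tm G N)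
  : fm G :=
  (∀ᴿ x, ∀ᴿ y, mem ↑x ↑A ⊃ mem ↑y ↑A ⊃ req ↑x ↑y ⊃ ↑Y · ↑x ≐ ↑Y · ↑y)
  ∧' (∀ᴿ x, mem ↑x ↑A ⊃ ↑Y · ↑x ≺ ↑k +' TOne)
  ∧' injOn ↑Y ↑A.

(* A sequence of finite sets is given together with a sequence of witnesses of
   their finiteness: such a sequence of witnesses cannot in general be recovered
   from finiteness of each E_n, as choice is limited to QF-AC^{1,0}. *)
Definition seq_of_finite_sets {G} (E : tm G (N ⇒ T1 ⇒ T1)) : fm G :=
  (∀ n : N, isSet (↑E · ↑n))
  ∧' ∃ k : N ⇒ N, ∃ Y : N ⇒ T1 ⇒ N,
       ∀ n : N, fin_inj (↑Y · ↑n) (↑E · ↑n) (↑k · ↑n).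

(* A binary relation on R is given, like a set, by a function R x R -> R,
   with x R y meaning R(x,y) > 0. *)
Definition isRel {G} (R : tm G (T1 ⇒ T1 ⇒ T1)) : fm G :=
  (∀ᴿ x, ∀ᴿ y, isReal (↑R · ↑x · ↑y))
  ∧' (∀ᴿ x, ∀ᴿ x', ∀ᴿ y, ∀ᴿ y',
        req ↑x ↑x' ⊃ req ↑y ↑y' ⊃ req (↑R · ↑x · ↑y) (↑R · ↑x' · ↑y')).

Definition rel {G} (R : tm G (T1 ⇒ T1 ⇒ T1)) (x y : tm G T1) : fm G :=
  rlt rzero (R · x · y).

Definition Korg2 : fm [] :=
  ∀ E : N ⇒ T1 ⇒ T1, ∀ R : T1 ⇒ T1 ⇒ T1,
    seq_of_finite_sets ↑E
    ⊃ (∀ n : N, nonempty (↑E · ↑n))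
    ⊃ isRel ↑R
    ⊃ (∀ n : N, ∀ᴿ x, mem ↑x (↑E · (↑n +' TOne))
         ⊃ ∃ᴿ y, mem ↑y (↑E · ↑n) ∧' rel ↑R ↑y ↑x)
    ⊃ ∃ x : N ⇒ T1, ∀ n : N,
        isReal (↑x · ↑n) ∧' mem (↑x · ↑n) (↑E · ↑n)
        ∧' rel ↑R (↑x · ↑n) (↑x · (↑n +' TOne)).

Definition enumerated {G} (A : tm G (T1 ⇒ T1)) : fm G :=
  ∃ x : N ⇒ T1,
    (∀ n : N, isReal (↑x · ↑n) ∧' mem (↑x · ↑n) ↑A)
    ∧' ∀ᴿ y, mem ↑y ↑A ≡ ∃ n : N, req (↑x · ↑n) ↑y.

Definition cocode0 : fm [] :=
  ∀ A : T1 ⇒ T1,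
    isSet ↑A ⊃ sub01 ↑A ⊃ nonempty ↑A ⊃ countable ↑A ⊃ enumerated ↑A.

Definition cocode1 : fm [] :=
  ∀ A : T1 ⇒ T1,
    isSet ↑A ⊃ sub01 ↑A ⊃ nonempty ↑A ⊃ strongly_countable ↑A ⊃ enumerated ↑A.

Definition CBN : fm [] :=
  ∀ A : T1 ⇒ T1,
    isSet ↑A ⊃ countable ↑A
    ⊃ (∃ x : N ⇒ T1,
         (∀ n : N, isReal (↑x · ↑n) ∧' mem (↑x · ↑n) ↑A)
         ∧' ∀ n : N, ∀ m : N, ¬' (↑n ≐ ↑m) ⊃ ¬' req (↑x · ↑n) (↑x · ↑m))
    ⊃ strongly_countable ↑A.

(* Main.v *)
(** The calculus is complete, so it suffices to prove the implications in every
    extensional model of RCA_0^omega, where they become ordinary mathematical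
    statements about the (possibly nonstandard) numbers of the model.

    For strongly countable [A] with bijection [Y], Koenig's lemma applied to
    the singletons [E_n = {x in A : Y x = n}] enumerates [A].  A nonempty
    countable set makes equality with one of its elements decidable, hence
    yields Kleene's functional E2, after which all arithmetical predicates are
    decidable.  With E2, [Korg_2] and [CBN] enumerate a countable [A]: its union
    with the natural numbers is strongly countable.  Conversely, a sequence of
    countable sets is coded affinely into a single countable subset of [0,1],
    which [cocode_0] enumerates; Koenig's lemma then becomes the usual
    arithmetical argument on a finitely branching tree, and [CBN] follows by
    counting the first occurrences in an enumeration. *)

From HB Require Import structures.
From mathcomp Require Import all_boot all_order all_algebra boolp ring lra.
From Stdlib Require Import Cantor List Eqdep_dec.
Require Import Defs.
Import ListNotations.

Set Implicit Arguments.
Unset Strict Implicit.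
Unset Printing Implicit Defensive.

(** * Substitution *)

(** The numbers of a model may be nonstandard, and induction and choice hold only for
    quantifier-free formulas. This shapes everything after completeness: a function may be iterated
    or chosen only if an element of the model computes it ([rep]), and a predicate may enter an
    induction, a choice or a case distinction in a definition only if it is the zero set of such a
    function ([dec]). Only E2 closes [dec] under number quantifiers, and so under equality and order
    of reals.

    E2 comes from a discontinuity: to [f] is attached a real that follows a fixed element [a] while
    [f] vanishes and jumps away at the first nonzero value. Deciding whether this real equals [a]
    decides whether [f] vanishes.

    [cocode0] speaks of one subset of [0,1], whereas the sets in [Korg2] and [CBN] lie anywhere on
    the line and come in sequences or singly. The affine coding places bounded pieces of them in
    disjoint dyadic intervals; the interval of a code records the index of its set and the size
    bound, so one enumeration serves all sets and remembers where each real belongs. *)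

Lemma var_case G s (P : forall t, var (s :: G) t -> Prop) :
  P s vz -> (forall t y, P t (vs y)) -> forall t x, P t x.
Proof.
move=> p0 pS t x; move: P p0 pS.
refine (match x in var G' t' return
  match G' return var G' t' -> Prop with
  | nil => fun _ => True
  | s' :: G'' => fun x => forall P : forall t, var (s' :: G'') t -> Prop,
     P s' vz -> (forall t y, P t (vs y)) -> P t' x
  end x with vz _ _ => _ | vs _ _ _ y => _ end) => P p0 pS //.
Qed.

Ltac var_cases :=
  let t := fresh "t" in let x := fresh "x" in
  intros t x; pattern t, x; apply var_case; clear t x; cbv beta.

Definition ids {G} : sub G G := fun _ x => TVar x.
Definition wks {G s} : ren G (s :: G) := fun _ x => vs x.

Lemma sub_ext G D (f g : sub G D) : (forall s x, f s x = g s x) -> f = g.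
Proof. move=> h; refine (functional_extensionality_dep (fun s => _));
by refine (functional_extensionality_dep (fun x => _)); apply: h. Qed.

Lemma tsub_ext G D (f g : sub G D) s (a : tm G s) :
  (forall s x, f s x = g s x) -> tsub f a = tsub g a.
Proof. by move/sub_ext=> ->. Qed.

Lemma fsub_ext G D (f g : sub G D) (a : fm G) :
  (forall s x, f s x = g s x) -> fsub f a = fsub g a.
Proof. by move/sub_ext=> ->. Qed.

Lemma tren_tsub G D (r : ren G D) s (a : tm G s) :
  tren r a = tsub (fun _ x => TVar (r _ x)) a.
Proof. by elim: a => //= s' t f -> a ->. Qed.

Lemma slift_ren G D s (r : ren G D) :
  slift (s := s) (fun _ x => TVar (r _ x)) = (fun _ x => TVar (rlift r x)).
Proof. by apply: sub_ext; var_cases. Qed.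

Lemma fren_fsub G D (r : ren G D) (f : fm G) :
  fren r f = fsub (fun _ x => TVar (r _ x)) f.
Proof.
elim: f D r => //=;
  try (by move=> *; rewrite !tren_tsub); try (by move=> {}G a IHa b IHb D r; rewrite IHa IHb).
- by move=> {}G s f IH D r; rewrite slift_ren IH.
- by move=> {}G s f IH D r; rewrite slift_ren IH.
Qed.

Lemma tsub_comp G D K (f : sub D K) (g : sub G D) s (a : tm G s) :
  tsub f (tsub g a) = tsub (fun _ x => tsub f (g _ x)) a.
Proof. by elim: a => //= s' t b -> c ->. Qed.

Lemma slift_comp G D K s (f : sub D K) (g : sub G D) :
  (fun _ x => tsub (slift f) (slift (s := s) g x))
  = slift (fun _ x => tsub f (g _ x)).
Proof.
apply: sub_ext; var_cases => //= t y.
by rewrite /slift /scons /= !tren_tsub !tsub_comp; apply: tsub_ext => u z /=; rewrite ?tren_tsub.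
Qed.

Lemma fsub_comp G D K (f : sub D K) (g : sub G D) (a : fm G) :
  fsub f (fsub g a) = fsub (fun _ x => tsub f (g _ x)) a.
Proof.
elim: a D K f g => //=;
  try (by move=> *; rewrite !tsub_comp); try (by move=> {}G a IHa b IHb D K f g; rewrite IHa IHb).
- by move=> {}G s a IH D K f g; rewrite IH slift_comp.
- by move=> {}G s a IH D K f g; rewrite IH slift_comp.
Qed.

Lemma slift_ids G s : slift (s := s) (@ids G) = ids.
Proof. by apply: sub_ext; var_cases. Qed.

Lemma tsub_id G s (a : tm G s) : tsub ids a = a.
Proof. by elim: a => //= s' t b -> c ->. Qed.

Lemma fsub_id G (a : fm G) : fsub ids a = a.
Proof.
elim: a => //=; try (by move=> *; rewrite !tsub_id);
  try (by move=> {}G a IHa b IHb; rewrite IHa IHb);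
  by move=> {}G s a IH; rewrite slift_ids IH.
Qed.

Lemma fsub_shift G D s (f : sub G D) (a : fm G) :
  fsub (slift (s := s) f) (fshift a) = fshift (fsub f a).
Proof.
by rewrite /fshift !fren_fsub !fsub_comp; apply: fsub_ext => t x /=; rewrite ?tren_tsub.
Qed.

Lemma tsub_scons_wk G D s t (b : tm D s) (f : sub G D) (a : tm G t) :
  tsub (scons b f) (tren wks a) = tsub f a.
Proof. by rewrite tren_tsub tsub_comp; apply: tsub_ext. Qed.

Lemma tsub_slift_wk G D s t (f : sub G D) (a : tm G t) :
  tsub (slift (s := s) f) (tren wks a) = tren wks (tsub f a).
Proof.
by rewrite !tren_tsub !tsub_comp; apply: tsub_ext => u x /=; rewrite ?tren_tsub.
Qed.

Lemma scons_slift G D s (b : tm D s) (f : sub G D) :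
  (fun _ x => tsub (scons b ids) (slift (s := s) f x)) = scons b f.
Proof.
apply: sub_ext; var_cases => //= t y.
by rewrite /slift /= tsub_scons_wk tsub_id.
Qed.

Lemma inst_slift G D s (b : tm D s) (f : sub G D) (a : fm (s :: G)) :
  inst (fsub (slift f) a) b = fsub (scons b f) a.
Proof. by rewrite /inst fsub_comp scons_slift. Qed.

Lemma fsub_inst G D s (b : tm G s) (f : sub G D) (a : fm (s :: G)) :
  fsub f (inst a b) = inst (fsub (slift f) a) (tsub f b).
Proof.
by rewrite inst_slift /inst fsub_comp; apply: fsub_ext; var_cases.
Qed.

Lemma fsub_eqT s G D (f : sub G D) (a b : tm G s) :
  fsub f (eqT a b) = eqT (tsub f a) (tsub f b).
Proof.
elim: s G D f a b => // s IHs t IHt G D f a b.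
have E u (c : tm G u) : tsub (slift (s := s) f) (↑c) = ↑(tsub f c).
  exact: tsub_slift_wk.
by rewrite /= /all_ /= IHt /= !E.
Qed.

Lemma qfree_sub G D (f : sub G D) (a : fm G) : qfree a -> qfree (fsub f a).
Proof.
by elim: a D f => //= {}G a IHa b IHb D f [ha hb]; split; auto.
Qed.

(** Only the two schemes need work: their own internal substitutions have to be commuted with the
    lifted [f]. *)
Lemma RCAw_sub G D (f : sub G D) (a : fm G) : RCAw a -> RCAw (fsub f a).
Proof.
case: a /; try by move=> *; rewrite /= ?fsub_eqT; constructor.
- move=> A qA; rewrite /= fsub_inst /=.
  have -> : fsub (slift f) (fsub (scons (TVar vz +' TOne) (fun s x => TVar (vs x))) A)
    = fsub (scons (TVar vz +' TOne) (fun s x => TVar (vs x))) (fsub (slift f) A).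
    rewrite !fsub_comp; apply: fsub_ext; var_cases => //= t y.
    by rewrite /slift /= !tren_tsub tsub_comp.
  exact/ax_ind/qfree_sub.
- move=> A qA.
  suff E : fsub (slift (slift f)) (fsub (scons (TVar (vs vz) · TVar vz)
        (scons (TVar vz) (fun s (x : var G s) => TVar (vs (vs x))))) A)
     = fsub (scons (TVar (vs vz) · TVar vz)
        (scons (TVar vz) (fun s (x : var D s) => TVar (vs (vs x)))))
        (fsub (slift (slift f)) A).
    by rewrite /= E; apply: (ax_qfac (A := fsub (slift (slift f)) A)); apply: qfree_sub.
  rewrite !fsub_comp; apply: fsub_ext; var_cases => //=; var_cases => //= t y.
  by rewrite /slift /= !tren_tsub !tsub_comp.
Qed.

(** * Derivations *)

Notation "H ⊢ f" := (prv RCAw H f) (at level 98, no associativity).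

Lemma map_fsub_shift G D s (f : sub G D) (H : list (fm G)) :
  List.map (fsub (slift (s := s) f)) (List.map fshift H)
  = List.map fshift (List.map (fsub f) H).
Proof. by rewrite !List.map_map; apply: List.map_ext => a; apply: fsub_shift. Qed.

Lemma prv_sub G (H : list (fm G)) a D (f : sub G D) :
  (H ⊢ a) -> (List.map (fsub f) H ⊢ fsub f a).
Proof.
move=> p; elim: p D f => {G H a}.
- by move=> G H a ax D f; apply/p_ax/RCAw_sub.
- by move=> G H a hin D f; apply/p_hyp/List.in_map.
- by move=> G H a b _ IH D f; apply/p_impI/IH.
- by move=> G H a b _ IH1 _ IH2 D f; apply: p_impE (IH1 D f) (IH2 D f).
- by move=> G H a b _ IH1 _ IH2 D f; apply: p_andI.
- by move=> G H a b _ IH D f; apply: p_andE1 (IH D f).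
- by move=> G H a b _ IH D f; apply: p_andE2 (IH D f).
- by move=> G H a b _ IH D f; apply/p_orI1/IH.
- by move=> G H a b _ IH D f; apply/p_orI2/IH.
- by move=> G H a b c _ IH1 _ IH2 _ IH3 D f; apply: p_orE (IH1 D f) (IH2 D f) (IH3 D f).
- by move=> G H a _ IH D f; apply/p_raa/IH.
- move=> G H s a _ IH D f; apply: p_allI; rewrite -map_fsub_shift; exact: IH.
- move=> G H s a b _ IH D f; rewrite fsub_inst; apply: p_allE; exact: IH.
- move=> G H s a b _ IH D f; apply: (p_exI (a := tsub f b)); rewrite -fsub_inst; exact: IH.
- move=> G H s a h _ IH1 _ IH2 D f; apply: p_exE (IH1 D f) _.
  by rewrite -map_fsub_shift -fsub_shift; apply: IH2.
Qed.

Lemma prv_weaken G (H K : list (fm G)) a : List.incl H K -> (H ⊢ a) -> (K ⊢ a).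
Proof.
move=> hk p; elim: p K hk => {G H a}.
- by move=> G H a ax K hk; apply: p_ax.
- by move=> G H a hin K hk; apply/p_hyp/hk.
- by move=> G H a b _ IH K hk; apply/p_impI/IH/List.incl_cons; [left | apply: List.incl_tl].
- by move=> G H a b _ IH1 _ IH2 K hk; apply: p_impE (IH1 K hk) (IH2 K hk).
- by move=> G H a b _ IH1 _ IH2 K hk; apply: p_andI; [apply: IH1 | apply: IH2].
- by move=> G H a b _ IH K hk; apply: p_andE1 (IH K hk).
- by move=> G H a b _ IH K hk; apply: p_andE2 (IH K hk).
- by move=> G H a b _ IH K hk; apply/p_orI1/IH.
- by move=> G H a b _ IH K hk; apply/p_orI2/IH.
- move=> G H a b c _ IH1 _ IH2 _ IH3 K hk; apply: p_orE (IH1 K hk) (IH2 _ _) (IH3 _ _);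
  by apply/List.incl_cons; [left | apply: List.incl_tl].
- by move=> G H a _ IH K hk; apply/p_raa/IH/List.incl_cons; [left | apply: List.incl_tl].
- by move=> G H s a _ IH K hk; apply/p_allI/IH/List.incl_map.
- by move=> G H s a b _ IH K hk; apply/p_allE/IH.
- by move=> G H s a b _ IH K hk; apply: p_exI (IH K hk).
- move=> G H s a h _ IH1 _ IH2 K hk; apply: p_exE (IH1 K hk) (IH2 _ _).
  by apply/List.incl_cons; [left | apply/List.incl_tl/List.incl_map].
Qed.

Lemma prv_shift G (H : list (fm G)) s (a : fm G) :
  (H ⊢ a) -> (List.map (fshift (s := s)) H ⊢ fshift a).
Proof.
have -> : fshift (s := s) = fsub (fun _ (x : var G _) => TVar (vs x)).
  by apply: funext => b; apply: fren_fsub.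
exact: prv_sub.
Qed.

Lemma prv_botE G (H : list (fm G)) a : (H ⊢ Bot) -> (H ⊢ a).
Proof. by move=> h; apply: p_raa; apply: prv_weaken h; apply: List.incl_tl. Qed.

Lemma eqT_app s t G (H : list (fm G)) (f g : tm G (s ⇒ t)) c :
  (H ⊢ eqT f g) -> (H ⊢ eqT (f · c) (g · c)).
Proof.
have E (b : tm G (s ⇒ t)) : tsub (scons c (@ids G)) (↑b) = b.
  by rewrite -[RHS](tsub_id b); exact: tsub_scons_wk.
by move=> h; have := p_allE c h; rewrite /inst fsub_eqT /= !E.
Qed.

Lemma eqT_shift s r G (H : list (fm G)) (f g : tm G s) :
  (H ⊢ eqT f g) -> (List.map (fshift (s := r)) H ⊢ eqT (tren wks f) (tren wks g)).
Proof.
move=> h; move: (prv_shift r h); rewrite /fshift fren_fsub fsub_eqT.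
by rewrite !tren_tsub.
Qed.

Lemma eqT_refl s G (H : list (fm G)) (f : tm G s) : H ⊢ eqT f f.
Proof. by elim: s G H f => [|s _ t IH] G H f; [apply/p_ax/ax_refl | apply/p_allI/IH]. Qed.

Lemma eqT_sym s G (H : list (fm G)) (f g : tm G s) : (H ⊢ eqT f g) -> (H ⊢ eqT g f).
Proof.
elim: s G H f g => [|s _ t IH] G H f g h; first exact/p_impE/h/p_ax/ax_sym.
by apply/p_allI/IH/eqT_app/eqT_shift.
Qed.

Lemma eqT_trans s G (H : list (fm G)) (f g h : tm G s) :
  (H ⊢ eqT f g) -> (H ⊢ eqT g h) -> (H ⊢ eqT f h).
Proof.
elim: s G H f g h => [|s _ t IH] G H f g h h1 h2.
  by apply: p_impE h2; apply: p_impE h1; apply/p_ax/ax_trans.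
by apply: p_allI; apply: IH (eqT_app _ (eqT_shift s h1)) (eqT_app _ (eqT_shift s h2)).
Qed.

(** Changing the function is the definition of equality at an arrow type; changing the argument is
    the extensionality axiom. This is what lets application pass to the quotient of the term
    model. *)
Lemma eqT_cong s t G (H : list (fm G)) (f g : tm G (s ⇒ t)) a b :
  (H ⊢ eqT f g) -> (H ⊢ eqT a b) -> (H ⊢ eqT (f · a) (g · b)).
Proof.
move=> h1 h2; apply: (eqT_trans (eqT_app a h1)).
by apply: p_impE h2; apply/p_ax/ax_ext.
Qed.

(** * Models *)

(** The domains are arbitrary types with an application, not function spaces, because in the term
    model an arrow type is interpreted by classes of terms. *)
Record model := Model {
  dom : ty -> Type;
  ap : forall s t, dom (s ⇒ t) -> dom s -> dom t;
  m0 : dom N;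
  m1 : dom N;
  mplus : dom (N ⇒ N ⇒ N);
  mmult : dom (N ⇒ N ⇒ N);
  mpi : forall s t, dom (s ⇒ t ⇒ s);
  msigma : forall r s t, dom ((r ⇒ s ⇒ t) ⇒ (r ⇒ s) ⇒ r ⇒ t);
  mrec : dom ((N ⇒ N ⇒ N) ⇒ N ⇒ N ⇒ N);
  mlt : dom N -> dom N -> Prop }.
Arguments ap {m s t} _ _.
Arguments m0 {m}.
Arguments m1 {m}.
Arguments mplus {m}.
Arguments mmult {m}.
Arguments mpi {m s t}.
Arguments msigma {m r s t}.
Arguments mrec {m}.
Arguments mlt {m} _ _.

Definition env (M : ty -> Type) (G : ctx) := forall s, var G s -> M s.

(** The analogue of [vcase] for motives in [Type], where the domains of a model live. *)
Definition ecase {G : ctx} {s : ty} (P : ty -> Type) (p0 : P s)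
  (pS : forall t, var G t -> P t) {t : ty} (x : var (s :: G) t) : P t :=
  match x in var G' t' return
    match G' with
    | [] => unit
    | s' :: G'' => P s' -> (forall t0, var G'' t0 -> P t0) -> P t'
    end
  with
  | vz _ _ => fun p _ => p
  | vs _ _ _ y => fun _ q => q _ y
  end p0 pS.

Definition enil {M : ty -> Type} : env M [] := fun s x =>
  match x in var G' t' return match G' with [] => M t' | _ => unit end with
  | vz _ _ => tt
  | vs _ _ _ _ => tt
  end.

Definition econs {M : ty -> Type} {G s} (d : M s) (e : env M G) : env M (s :: G) :=
  fun t x => ecase (P := M) d e x.

Lemma env_ext (M : ty -> Type) G (e e' : env M G) :
  (forall s x, e s x = e' s x) -> e = e'.
Proof.
move=> h; refine (functional_extensionality_dep (fun s => _)).
by refine (functional_extensionality_dep (fun x => _)); apply: h.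
Qed.

Fixpoint tev (M : model) G (e : env (dom M) G) s (a : tm G s) : dom M s :=
  match a with
  | TVar _ x => e _ x
  | TApp _ _ b c => ap (tev e b) (tev e c)
  | TZero => m0
  | TOne => m1
  | TPlus => mplus
  | TMult => mmult
  | TPi _ _ => mpi
  | TSigma _ _ _ => msigma
  | TRec => mrec
  end.

Fixpoint sat (M : model) G (e : env (dom M) G) (f : fm G) : Prop :=
  match f with
  | Eq a b => tev e a = tev e b
  | Lt a b => mlt (tev e a) (tev e b)
  | Bot => False
  | Imp a b => sat e a -> sat e b
  | And a b => sat e a /\ sat e b
  | Or a b => sat e a \/ sat e b
  | All _ a => forall d, sat (econs d e) a
  | Ex _ a => exists d, sat (econs d e) a
  end.

(** * Completeness *)

(** Every type has a closed term. Hence a fresh variable cannot create an inconsistency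
    ([consistent_shift]), and junk values are available at every type. *)
Fixpoint dummy {G} s : tm G s :=
  match s with N => TZero | Arr r t => TPi · dummy t end.

Definition c2 (a b : nat) : nat := Cantor.to_nat (a, b).

Lemma c2_inj a b c d : c2 a b = c2 c d -> a = c /\ b = d.
Proof. by move/Cantor.to_nat_inj => [-> ->]. Qed.

Fixpoint tyc (s : ty) : nat :=
  match s with N => 0 | Arr r t => S (c2 (tyc r) (tyc t)) end.

Lemma tyc_inj s t : tyc s = tyc t -> s = t.
Proof.
by elim: s t => [|r IHr s IHs] [|r' s'] //= [/c2_inj [/IHr -> /IHs ->]].
Qed.

Lemma ty_dec (s t : ty) : {s = t} + {s <> t}.
Proof. by decide equality. Qed.

Lemma existT_ty (P : ty -> Type) s (x y : P s) :
  existT P s x = existT P s y -> x = y.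
Proof. exact/inj_pair2_eq_dec/ty_dec. Qed.

Fixpoint varc G s (x : var G s) : nat :=
  match x with vz _ _ => 0 | vs _ _ _ y => S (varc y) end.

Lemma varc_inj G s (x : var G s) t (y : var G t) :
  varc x = varc y -> existT (var G) s x = existT (var G) t y.
Proof.
elim: x t y => {G s} [G s|G s t x IH] u y.
  by move: u y; var_cases.
move: u y; var_cases => //= u y [/IH E].
have e := projT1_eq E; simpl in e; case: u / e y E => y E.
by rewrite (existT_ty E).
Qed.

Fixpoint tmc G s (a : tm G s) : nat :=
  match a with
  | TVar _ x => c2 0 (varc x)
  | TApp _ _ b c => c2 1 (c2 (tmc b) (tmc c))
  | TZero => c2 2 0
  | TOne => c2 3 0
  | TPlus => c2 4 0
  | TMult => c2 5 0
  | TPi s t => c2 6 (c2 (tyc s) (tyc t))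
  | TSigma r s t => c2 7 (c2 (tyc r) (c2 (tyc s) (tyc t)))
  | TRec => c2 8 0
  end.

(** The statement compares terms of different types because an application hides the type of its
    argument, which must be recovered from the code of the function part. *)
Lemma tmc_inj G s (a : tm G s) t (b : tm G t) :
  tmc a = tmc b -> existT (tm G) s a = existT (tm G) t b.
Proof.
elim: a t b => {s} [s x|s t f IHf a IHa| | | | |s t|r s t|] u [s' y|s' t' g b| | | | |s' t'|r' s' t'|] //= /c2_inj [] //.
- move=> _ /varc_inj E.
  have e := projT1_eq E; simpl in e; case: s' / e y E => y E.
  by rewrite (existT_ty E).
- move=> _ /c2_inj [/IHf E1 /IHa E2].
  have e := projT1_eq E1; simpl in e; case: e => e1 e2; subst s' t'.
  by rewrite (existT_ty E1) (existT_ty E2).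
- by move=> _ /c2_inj [/tyc_inj -> /tyc_inj ->].
- by move=> _ /c2_inj [/tyc_inj -> /c2_inj [/tyc_inj -> /tyc_inj ->]].
Qed.

Lemma tmc_inj1 G s (a b : tm G s) : tmc a = tmc b -> a = b.
Proof. by move/tmc_inj=> E; exact: (existT_ty E). Qed.

Fixpoint fmc G (f : fm G) : nat :=
  match f with
  | Eq a b => c2 0 (c2 (tmc a) (tmc b))
  | Lt a b => c2 1 (c2 (tmc a) (tmc b))
  | Bot => c2 2 0
  | Imp a b => c2 3 (c2 (fmc a) (fmc b))
  | And a b => c2 4 (c2 (fmc a) (fmc b))
  | Or a b => c2 5 (c2 (fmc a) (fmc b))
  | All s a => c2 6 (c2 (tyc s) (fmc a))
  | Ex s a => c2 7 (c2 (tyc s) (fmc a))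
  end.

Lemma fmc_inj G (f g : fm G) : fmc f = fmc g -> f = g.
Proof.
elim: f g => {G} [G a b|G a b|G|G a IHa b IHb|G a IHa b IHb|G a IHa b IHb|G s a IHa|G s a IHa]
  [a' b'|a' b'| |a' b'|a' b'|a' b'|s' a'|s' a'] //= /c2_inj [] // _ /c2_inj [].
- by move=> /tmc_inj1 -> /tmc_inj1 ->.
- by move=> /tmc_inj1 -> /tmc_inj1 ->.
- by move=> /IHa -> /IHb ->.
- by move=> /IHa -> /IHb ->.
- by move=> /IHa -> /IHb ->.
- by move=> /tyc_inj e; subst s' => /IHa ->.
- by move=> /tyc_inj e; subst s' => /IHa ->.
Qed.

(* [germ a] is the coherent sequence with value [a] at [m]; below [m] it is junk. *)
Section Germ.
Variables (X : nat -> Type) (sh : forall n, X n -> X (S n)) (d : forall n, X n).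
Variables (m : nat) (a : X m).

Definition cast_at n (x : X n) : X n :=
  match PeanoNat.Nat.eq_dec m n with
  | left e => match e in _ = k return X k with erefl => a end
  | right _ => x
  end.

Fixpoint germ n : X n :=
  match n with
  | 0 => cast_at (d 0)
  | S n' => cast_at (sh (germ n'))
  end.

Lemma germ_at : germ m = a.
Proof.
have E x : cast_at (n := m) x = a.
  rewrite /cast_at; case: PeanoNat.Nat.eq_dec => // e.
  by rewrite (UIP_dec PeanoNat.Nat.eq_dec e erefl).
by move: E; case: (m) a => [|k] b /=.
Qed.

Lemma germS n : m <= n -> germ (S n) = sh (germ n).
Proof.
move=> mn /=; rewrite /cast_at; case: PeanoNat.Nat.eq_dec => // e.
by exfalso; move: mn; rewrite e ltnn.
Qed.
End Germ.

(* Step [n] of the Henkin construction decides the formula of level [task_m n]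
   with code [task_q n], the new variable having the type with code [task_t n]. *)
Definition task_m n := (Cantor.of_nat n).1.
Definition task_q n := (Cantor.of_nat (Cantor.of_nat n).2).1.
Definition task_t n := (Cantor.of_nat (Cantor.of_nat n).2).2.

Definition sg n : ty :=
  match pselect (exists s, tyc s = task_t n) with
  | left h => projT1 (cid h)
  | right _ => N
  end.

Fixpoint level n : ctx := match n with 0 => [] | S n' => sg n' :: level n' end.

(** A Cantor code dominates its components, so a task about a formula of level [m] comes no earlier
    than stage [m], when the formula already has a meaning in the current context. *)
Lemma task_ex m q s : exists n, [/\ m <= n, task_m n = m, task_q n = q & sg n = s].
Proof.
exists (c2 m (c2 q (tyc s))).
have E : task_t (c2 m (c2 q (tyc s))) = tyc s.
  by rewrite /task_t /c2 !Cantor.cancel_of_to /= ?Cantor.cancel_of_to.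
split.
- have := Cantor.to_nat_non_decreasing m (c2 q (tyc s)).
  by move/leP; apply: leq_trans; rewrite leq_addl.
- by rewrite /task_m /c2 Cantor.cancel_of_to.
- by rewrite /task_q /c2 !Cantor.cancel_of_to /= ?Cantor.cancel_of_to.
- rewrite /sg E; case: pselect => [h|[]]; last by exists s.
  by case: (cid h) => t /= /tyc_inj.
Qed.

Definition fgerm m (f : fm (level m)) : forall n, fm (level n) :=
  germ (X := fun n => fm (level n)) (fun n => fshift (s := sg n)) (fun n => Bot) f.

Definition consistent G (H : list (fm G)) := ~ (H ⊢ Bot).

Lemma consistent_decide G (H : list (fm G)) f :
  consistent H -> consistent (f :: H) \/ consistent (Not f :: H).
Proof.
move=> cH; have [h|h] := pselect (f :: H ⊢ Bot); last by left.
right=> h'; apply: cH; apply: p_impE (p_raa h'); exact: p_impI.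
Qed.

Lemma consistent_shift G (H : list (fm G)) s :
  consistent H -> consistent (List.map (fshift (s := s)) H).
Proof. by move=> cH h; apply: cH; have := p_allE (dummy s) (p_allI h). Qed.

(** The variable added to the context doubles as Henkin constant: if the accepted formula is [Ex h]
    over the type [sg n], then [h] itself, read in the longer context, is added. If the types
    differ, a later task with the same formula and the right type supplies the witness. *)
Lemma henkin_step n (H : list (fm (level n))) : consistent H ->
  exists H' : list (fm (level (S n))),
  [/\ consistent H', (forall a, List.In a H -> List.In (fshift a) H') &
   forall f : fm (level (task_m n)), fmc f = task_q n ->
    (List.In (fshift (fgerm f n)) H' \/ List.In (fshift (Not (fgerm f n))) H') /\
    forall h : fm (sg n :: level n), fgerm f n = Ex h ->
      List.In (fshift (fgerm f n)) H' -> List.In h H'].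
Proof.
move=> cH.
have [[f ef]|nf] := pselect (exists f : fm (level (task_m n)), fmc f = task_q n); last first.
  exists (List.map fshift H); split; first exact: consistent_shift.
    by move=> a; apply: List.in_map.
  by move=> f ef; case: nf; exists f.
have uf (f' : fm (level (task_m n))) : fmc f' = task_q n -> f' = f.
  by rewrite -ef; apply: fmc_inj.
set g := fgerm f n.
have [cg|ncg] := pselect (consistent (g :: H)).
- have [[h eh]|nh] := pselect (exists h : fm (sg n :: level n), g = Ex h).
  + exists (h :: List.map fshift (g :: H)); split.
    (* The new variable is fresh for the shifted hypotheses, so a contradiction from [h] would
       refute [g] by existential elimination. *)
    * move=> b; apply: cg; refine (@p_exE _ _ (g :: H) (sg n) h Bot _ b).
      by apply: p_hyp; rewrite eh; left.
    * by move=> a ina; right; right; apply: List.in_map.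
    * move=> f' /uf ->; split; first by left; right; left.
      by move=> h'; rewrite -/g eh => -[E] _; left; exact: (existT_ty E).
  + exists (List.map fshift (g :: H)); split; first exact: consistent_shift.
      by move=> a ina; right; apply: List.in_map.
    move=> f' /uf ->; split; first by left; left.
    by move=> h' eh; case: nh; exists h'.
- have cg : consistent (Not g :: H) by case: (consistent_decide g cH).
  exists (List.map fshift (Not g :: H)); split; first exact: consistent_shift.
    by move=> a ina; right; apply: List.in_map.
  move=> f' /uf ->; split; first by right; left.
  move=> h' _ ing; exfalso; apply: (consistent_shift (s := sg n) cg).
  apply: (p_impE (f := fshift g)); first by apply: p_hyp; left.
  exact: p_hyp.
Qed.

(** * The term model of a complete theory with witnesses *)

Section Henkin.
Variable f0 : fm [].
Hypothesis f0_consistent : consistent [f0].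

Fixpoint hseq n : {H : list (fm (level n)) | consistent H} :=
  match n return {H : list (fm (level n)) | consistent H} with
  | 0 => exist _ [f0] f0_consistent
  | S n' =>
    let c := cid (henkin_step (proj2_sig (hseq n'))) in
    exist _ (proj1_sig c) (let 'And3 h _ _ := proj2_sig c in h)
  end.

Definition hs n := proj1_sig (hseq n).

Lemma hs_consistent n : consistent (hs n).
Proof. exact: proj2_sig (hseq n). Qed.

Lemma hs_shift n a : List.In a (hs n) -> List.In (fshift a) (hs (S n)).
Proof. by case: (proj2_sig (cid (henkin_step (proj2_sig (hseq n))))) => _ h _; apply: h. Qed.

Lemma hs_task n (f : fm (level (task_m n))) : fmc f = task_q n ->
  (List.In (fshift (fgerm f n)) (hs (S n)) \/ List.In (fshift (Not (fgerm f n))) (hs (S n))) /\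
    forall h : fm (sg n :: level n), fgerm f n = Ex h ->
      List.In (fshift (fgerm f n)) (hs (S n)) -> List.In h (hs (S n)).
Proof. by case: (proj2_sig (cid (henkin_step (proj2_sig (hseq n))))) => _ _ h; apply: h. Qed.

Lemma hs_up n a : (hs n ⊢ a) -> (hs (S n) ⊢ fshift a).
Proof.
move/(prv_shift (sg n)); apply: prv_weaken => b.
by rewrite List.in_map_iff => -[c [<- hc]]; apply: hs_shift.
Qed.

Definition coh s (t : forall n, tm (level n) s) m :=
  forall n, m <= n -> t (S n) = tren wks (t n).

(** Elements of the direct limit of the terms over the growing contexts; only the values from some
    level on matter. *)
Definition raw s := {t : forall n, tm (level n) s | exists m, coh t m}.

Definition at_ G (r : env raw G) n : sub G (level n) := fun s x => proj1_sig (r s x) n.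

Lemma env_coh G (r : env raw G) :
  exists m, forall s (x : var G s), coh (proj1_sig (r s x)) m.
Proof.
elim: G r => [|s G IH] r.
  exists 0 => s x; exfalso; move: (enil (M := fun _ => False) x); exact.
have [m hm] := IH (fun t x => r t (vs x)).
have [m' hm'] := proj2_sig (r s vz).
exists (m + m'); var_cases.
- by move=> n hn; apply: hm'; apply: leq_trans hn; apply: leq_addl.
- by move=> t y n hn; apply: hm; apply: leq_trans hn; apply: leq_addr.
Qed.

Definition coh_env G (r : env raw G) m := forall s (x : var G s), coh (proj1_sig (r s x)) m.

Lemma at_shift G (r : env raw G) m n f :
  coh_env r m -> m <= n -> fsub (at_ r (S n)) f = fshift (fsub (at_ r n) f).
Proof.
move=> hm mn; rewrite /fshift fren_fsub fsub_comp; apply: fsub_ext => s x.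
by rewrite /at_ hm // tren_tsub.
Qed.

Lemma tat_shift G (r : env raw G) m n s (a : tm G s) :
  coh_env r m -> m <= n -> tsub (at_ r (S n)) a = tren wks (tsub (at_ r n) a).
Proof.
move=> hm mn; rewrite tren_tsub tsub_comp; apply: tsub_ext => t x.
by rewrite /at_ hm // tren_tsub.
Qed.

Definition rsub G (r : env raw G) s (a : tm G s) : raw s.
Proof.
exists (fun n => tsub (at_ r n) a).
have [m hm] := env_coh r; exists m => n mn; exact: tat_shift mn.
Defined.

Definition T G (f : fm G) (r : env raw G) :=
  exists m, forall n, m <= n -> hs n ⊢ fsub (at_ r n) f.

(** One stage suffices: from a level where the environment is coherent, [hs_up] carries derivability
    to all later ones. *)
Lemma T_intro G (f : fm G) r m n :
  coh_env r m -> m <= n -> (hs n ⊢ fsub (at_ r n) f) -> T f r.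
Proof.
move=> hm mn h; exists n => k nk; rewrite -(subnK nk).
elim: (k - n) => [//|j IH].
change (hs (S (j + n)) ⊢ fsub (at_ r (S (j + n))) f).
rewrite (at_shift _ hm); first exact: hs_up.
exact: leq_trans mn (leq_addl _ _).
Qed.

Lemma fgerm_at G (f : fm G) r m n : coh_env r m -> m <= n ->
  fgerm (fsub (at_ r m) f) n = fsub (at_ r n) f.
Proof.
move=> hm mn; rewrite -(subnK mn); elim: (n - m) => [|j IH].
  by rewrite add0n /fgerm germ_at.
change (fgerm (fsub (at_ r m) f) (S (j + m)) = fsub (at_ r (S (j + m))) f).
rewrite (at_shift _ hm) ?leq_addl // -IH.
exact: (germS (X := fun n => fm (level n)) _ _ _ (leq_addl _ _)).
Qed.

Lemma T_task G (f : fm G) r s : exists n m,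
  [/\ sg n = s, coh_env r m, m <= n &
   (List.In (fsub (at_ r (S n)) f) (hs (S n)) \/
    List.In (fsub (at_ r (S n)) (Not f)) (hs (S n))) /\
    forall h : fm (sg n :: level n), fsub (at_ r n) f = Ex h ->
      List.In (fsub (at_ r (S n)) f) (hs (S n)) -> List.In h (hs (S n))].
Proof.
have [m hm] := env_coh r.
have [n [mn tm tq ts]] := task_ex m (fmc (fsub (at_ r m) f)) s.
exists n, m; split => //.
(* The level of the task is identified with [m], so that the coded formula has the type expected by
   [hs_task]. *)
case: _ / tm mn hm tq => mn hm tq.
by have := hs_task (esym tq); rewrite (fgerm_at _ hm) // !(at_shift _ hm mn).
Qed.

Lemma T_decide G (f : fm G) r : T f r \/ T (Not f) r.
Proof.
have [n [m [_ hm mn [[h|h] _]]]] := T_task f r N; [left|right];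
  apply: (T_intro (n := S n) hm); rewrite ?(leqW mn) //; exact: p_hyp.
Qed.

Lemma T_rule G (f g : fm G) r :
  (forall n, (hs n ⊢ fsub (at_ r n) f) -> (hs n ⊢ fsub (at_ r n) g)) -> T f r -> T g r.
Proof. by move=> h [m hm]; exists m => n mn; apply/h/hm. Qed.

Lemma T_rule2 G (f g k : fm G) r :
  (forall n, (hs n ⊢ fsub (at_ r n) f) -> (hs n ⊢ fsub (at_ r n) g) ->
     (hs n ⊢ fsub (at_ r n) k)) -> T f r -> T g r -> T k r.
Proof.
move=> h [m hm] [m' hm']; exists (m + m') => n mn; apply: h.
- by apply: hm; apply: leq_trans mn; apply: leq_addr.
- by apply: hm'; apply: leq_trans mn; apply: leq_addl.
Qed.

Lemma T_bot G (r : env raw G) : ~ T Bot r.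
Proof. by move=> [m hm]; apply: (hs_consistent (hm m (leqnn _))). Qed.

Lemma T_not G (f : fm G) r : T (Not f) r <-> ~ T f r.
Proof.
split=> [h1 h2|h]; last by case: (T_decide f r).
apply: (T_bot (r := r)); apply: T_rule2 h1 h2 => n; exact: p_impE.
Qed.

Lemma T_imp G (f g : fm G) r : T (f ⊃ g) r <-> (T f r -> T g r).
Proof.
split=> [|h]; first by apply: T_rule2 => n; apply: p_impE.
have [hf|/T_not hf] := pselect (T f r).
- apply: T_rule (h hf) => n hg; apply: p_impI.
  by apply: prv_weaken hg; apply: List.incl_tl.
- apply: T_rule hf => n hg; apply/p_impI/prv_botE; apply: (p_impE (f := fsub (at_ r n) f)).
    by apply: prv_weaken hg; apply: List.incl_tl.
  by apply: p_hyp; left.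
Qed.

Lemma T_and G (f g : fm G) r : T (f ∧' g) r <-> T f r /\ T g r.
Proof.
split=> [h|[]]; last by apply: T_rule2 => n; apply: p_andI.
by split; apply: T_rule h => n; [apply: p_andE1 | apply: p_andE2].
Qed.

Lemma T_or G (f g : fm G) r : T (f ∨' g) r <-> T f r \/ T g r.
Proof.
split=> [h|]; last first.
  by case; [apply: T_rule => n; apply: p_orI1 | apply: T_rule => n; apply: p_orI2].
have [|/T_not hf] := pselect (T f r); first by left.
right; apply: T_rule2 h hf => n h1 h2; apply: (p_orE h1); last by apply: p_hyp; left.
apply: prv_botE; apply: (p_impE (f := fsub (at_ r n) f)).
  by apply: prv_weaken h2; apply: List.incl_tl.
by apply: p_hyp; left.
Qed.

Lemma at_econs G s (c : raw s) (r : env raw G) n :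
  at_ (econs c r) n = scons (proj1_sig c n) (at_ r n).
Proof. by apply: sub_ext; var_cases. Qed.

Definition rvar n : raw (sg n).
Proof.
exists (germ (X := fun k => tm (level k) (sg n)) (fun k => tren wks)
  (fun k => dummy (sg n)) (m := S n) (TVar vz)).
by exists (S n) => k nk; apply: germS.
Defined.

Lemma T_ex G s (f : fm (s :: G)) r : T (Ex f) r <-> exists c, T f (econs c r).
Proof.
split=> [h|[c [m hm]]]; last first.
  exists m => n mn; apply: (p_exI (a := proj1_sig c n)).
  by rewrite inst_slift -at_econs; apply: hm.
have [n [m [es hm mn [hd hw]]]] := T_task (Ex f) r s.
have hin : List.In (fsub (at_ r (S n)) (Ex f)) (hs (S n)).
  case: hd => // hn; exfalso; suff /T_not : T (Not (Ex f)) r by [].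
  by apply: (T_intro (n := S n) hm (leqW mn)); apply: p_hyp.
case: s / es f h hd hw hin => f h hd hw hin.
exists (rvar n).
(* At level [S n] the element [rvar n] is the newest variable, so the extended environment acts on
   [f] as the lifted substitution, and the witness formula of the Henkin step is literally this
   instance. *)
suff E : fsub (at_ (econs (rvar n) r) (S n)) f = fsub (slift (at_ r n)) f.
  have hm1 : coh_env (econs (rvar n) r) (S n).
    move=> {E} t x; move: t x; var_cases.
      by move=> j nj; apply: germS.
    by move=> t y j nj; apply: hm; apply: leq_trans nj; apply: leqW.
  apply: (T_intro (n := S n) hm1 (leqnn _)); apply: p_hyp; rewrite E.
  exact: hw.
rewrite at_econs; apply: fsub_ext; var_cases => [|t y].
  exact: (germ_at (X := fun k => tm (level k) (sg n))).
exact: hm.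
Qed.

(** Reduced to [T_ex]: if the universal formula is refuted, then classically its negated body has a
    witness in the limit. *)
Lemma T_all G s (f : fm (s :: G)) r : T (All f) r <-> forall c, T f (econs c r).
Proof.
split=> [[m hm] c|h].
  exists m => n mn; rewrite at_econs -inst_slift; apply: p_allE; exact: hm.
have [//|/T_not hf] := pselect (T (All f) r).
have /T_ex [c /T_not []] : T (Ex (Not f)) r; last exact: h.
apply: T_rule hf => n hn /=; apply: p_raa.
apply: p_impE; first by apply: prv_weaken hn; apply: List.incl_tl.
apply/p_allI/p_raa; set g := fsub (slift (at_ r n)) f.
apply: (p_impE (f := fshift (Ex (Not g)))).
  by apply: p_hyp; right; left.
apply: (p_exI (a := TVar vz)); apply: p_hyp; left.
rewrite /inst -/(fren _ g) /= fren_fsub /= fsub_comp.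
by congr Not; rewrite -[LHS]fsub_id; apply: fsub_ext; var_cases.
Qed.

Definition eqv s (a b : raw s) :=
  exists m, forall n, m <= n -> hs n ⊢ eqT (proj1_sig a n) (proj1_sig b n).

Lemma eqv_refl s (a : raw s) : eqv a a.
Proof. by exists 0 => n _; apply: eqT_refl. Qed.

Lemma eqv_sym s (a b : raw s) : eqv a b -> eqv b a.
Proof. by move=> [m hm]; exists m => n mn; apply/eqT_sym/hm. Qed.

Lemma eqv_trans s (a b c : raw s) : eqv a b -> eqv b c -> eqv a c.
Proof.
move=> [m hm] [k hk]; exists (m + k) => n mn; apply: eqT_trans.
- by apply: hm; apply: leq_trans mn; apply: leq_addr.
- by apply: hk; apply: leq_trans mn; apply: leq_addl.
Qed.

Definition rap s t (f : raw (s ⇒ t)) (a : raw s) : raw t.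
Proof.
exists (fun n => proj1_sig f n · proj1_sig a n).
have [m hm] := proj2_sig f; have [k hk] := proj2_sig a; exists (m + k) => n mn.
rewrite hm; last by apply: leq_trans mn; apply: leq_addr.
by rewrite hk //; apply: leq_trans mn; apply: leq_addl.
Defined.

Lemma eqv_rap s t (f g : raw (s ⇒ t)) a b : eqv f g -> eqv a b -> eqv (rap f a) (rap g b).
Proof.
move=> [m hm] [k hk]; exists (m + k) => n mn; apply: eqT_cong.
- by apply: hm; apply: leq_trans mn; apply: leq_addr.
- by apply: hk; apply: leq_trans mn; apply: leq_addl.
Qed.

Definition rdummy s : raw s.
Proof.
exists (fun n => dummy s); exists 0 => n _; elim: s => //= r _ s <- //.
Defined.

(** The choice depends on [a] only through the predicate [eqv a], and equivalent elements have equal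
    predicates; hence they get the same representative. By reflexivity the default is never
    reached. *)
Definition canon s (a : raw s) : raw s :=
  match pselect (exists b, eqv a b) with
  | left h => projT1 (cid h)
  | right _ => rdummy s
  end.

Lemma canon_eqv s (a : raw s) : eqv a (canon a).
Proof.
rewrite /canon; case: pselect => [h|[]]; first by case: (cid h).
exists a; exact: eqv_refl.
Qed.

Lemma eqv_canon s (a b : raw s) : eqv a b -> canon a = canon b.
Proof.
move=> h; suff -> : canon a = canon b by [].
rewrite /canon; suff -> : eqv a = eqv b by [].
apply: funext => c; apply: propext; split; first exact/eqv_trans/eqv_sym.
exact: eqv_trans.
Qed.

(** The quotient by [eqv], realised by canonical representatives so that [Eq] can be interpreted as
    identity. *)
Definition hdom s := {a : raw s | canon a = a}.

Definition cls s (a : raw s) : hdom s :=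
  exist _ (canon a) (esym (eqv_canon (canon_eqv a))).

Lemma clsE s (a b : raw s) : cls a = cls b <-> eqv a b.
Proof.
split=> [[E]|/eqv_canon E]; last exact: eq_exist.
by apply: eqv_trans (canon_eqv a) _; rewrite E; apply/eqv_sym/canon_eqv.
Qed.

Lemma cls_rep s (d : hdom s) : cls (proj1_sig d) = d.
Proof. by case: d => a ha; apply: eq_exist. Qed.

Definition hmodel : model := {|
  dom := hdom;
  ap := fun s t f a => cls (rap (proj1_sig f) (proj1_sig a));
  m0 := cls (rsub enil TZero);
  m1 := cls (rsub enil TOne);
  mplus := cls (rsub enil TPlus);
  mmult := cls (rsub enil TMult);
  mpi := fun s t => cls (rsub enil TPi);
  msigma := fun r s t => cls (rsub enil TSigma);
  mrec := cls (rsub enil TRec);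
  mlt := fun a b => exists m, forall n, m <= n ->
    hs n ⊢ (proj1_sig (proj1_sig a) n ≺ proj1_sig (proj1_sig b) n) |}.

Definition ecls G (r : env raw G) : env hdom G := fun s x => cls (r s x).

Lemma cls_rap s t (f : raw (s ⇒ t)) a :
  cls (rap (proj1_sig (cls f)) (proj1_sig (cls a))) = cls (rap f a).
Proof. by apply/clsE/eqv_rap; apply/eqv_sym/canon_eqv. Qed.

Lemma tev_cls G (r : env raw G) s (a : tm G s) :
  tev (M := hmodel) (ecls r) a = cls (rsub r a).
Proof.
elim: a => //= [s' x|s' t f IHf b IHb| | | | |s' t|r' s' t|]; try exact/clsE/eqv_refl.
by rewrite IHf IHb cls_rap; apply/clsE/eqv_refl.
Qed.

(** The truth lemma. Equations hold by the choice of the quotient; for [Lt], the axiom [ax_lt_eq]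
    allows a change of representatives. *)
Lemma sat_T G (r : env raw G) (f : fm G) : sat (M := hmodel) (ecls r) f <-> T f r.
Proof.
elim: f r => {G} [G a b|G a b|G|G a IHa b IHb|G a IHa b IHb|G a IHa b IHb|G s a IHa|G s a IHa] r.
- by rewrite /= !tev_cls; apply: clsE.
- have lt_cong c d c' d' : eqv c c' -> eqv d d' ->
    (exists m, forall n, m <= n -> hs n ⊢ (proj1_sig c n ≺ proj1_sig d n)) ->
    exists m, forall n, m <= n -> hs n ⊢ (proj1_sig c' n ≺ proj1_sig d' n).
    move=> [m hm] [k hk] [l hl]; exists (m + k + l) => n.
    rewrite -addnA addnC => mn; apply: p_impE; last first.
      by apply: hl; apply: leq_trans mn; rewrite -addnA addnC -addnA leq_addr.
    apply: p_impE; last first.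
      by apply: hk; apply: leq_trans mn; rewrite -addnA leq_addr.
    apply: p_impE; first exact/p_ax/ax_lt_eq.
    by apply: hm; apply: leq_trans mn; rewrite leq_addl.
  rewrite /= !tev_cls; split=> h.
    by apply: (lt_cong _ _ (rsub r a) (rsub r b) _ _ h); apply/eqv_sym/canon_eqv.
  by apply: (lt_cong (rsub r a) (rsub r b) _ _ _ _ h); apply: canon_eqv.
- by split=> // /T_bot.
- by rewrite /= T_imp IHa IHb.
- by rewrite /= T_and IHa IHb.
- by rewrite /= T_or IHa IHb.
- have E (c : raw s) : econs (cls c) (ecls r) = ecls (econs c r).
    by apply: env_ext; var_cases.
  rewrite /= T_all; split=> h c; first by apply/IHa; rewrite -E.
  by rewrite -(cls_rep c) E; apply/IHa.
- have E (c : raw s) : econs (cls c) (ecls r) = ecls (econs c r).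
    by apply: env_ext; var_cases.
  rewrite /= T_ex; split=> [[c]|[c hc]].
    by rewrite -(cls_rep c) E => /IHa; exists (proj1_sig c).
  by exists (cls c); rewrite E; apply/IHa.
Qed.

Lemma ecls_rep G (e : env hdom G) : ecls (fun s x => proj1_sig (e s x)) = e.
Proof. by apply: env_ext => s x; apply: cls_rep. Qed.

(** Equality at an arrow type is itself a universal formula, so [T_all] turns agreement at all
    elements of the model into eventual derivability of the equality. *)
Lemma hmodel_ext s t (f g : hdom (s ⇒ t)) :
  (forall a, ap (m := hmodel) f a = ap (m := hmodel) g a) -> f = g.
Proof.
move=> h; rewrite -(cls_rep f) -(cls_rep g); apply/clsE.
set r : env raw [s ⇒ t; s ⇒ t] := econs (proj1_sig f) (econs (proj1_sig g) enil).
suff : T (eqT (TVar (vz : var [s ⇒ t; s ⇒ t] _)) (TVar (vs vz))) r.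
  by move=> [m hm]; exists m => n mn; have := hm n mn; rewrite fsub_eqT.
rewrite /= /all_; apply/T_all => c.
have /clsE [m hm] : cls (rap (proj1_sig f) c) = cls (rap (proj1_sig g) c).
  have E (k : hdom (s ⇒ t)) :
      cls (rap (proj1_sig k) (proj1_sig (cls c))) = cls (rap (proj1_sig k) c).
    by apply/clsE/eqv_rap; [exact: eqv_refl | exact/eqv_sym/canon_eqv].
  by have := h (cls c); rewrite /= !E.
by exists m => n mn; rewrite fsub_eqT; apply: hm.
Qed.
End Henkin.

Definition extensional (M : model) := forall s t (f g : dom M (s ⇒ t)),
  (forall a, ap f a = ap g a) -> f = g.

Definition models (M : model) :=
  forall G (f : fm G), RCAw f -> forall e : env (dom M) G, sat e f.

(** If [f] is not derivable, its negation is consistent by reductio, and the term model built over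
    that negation is an extensional model refuting [f]. *)
Theorem completeness (f : fm []) :
  (forall M, extensional M -> models M -> forall e : env (dom M) [], sat e f) ->
  RCAw_proves f.
Proof.
move=> h; apply: p_raa; have [//|nf] := pselect ([¬' f] ⊢ Bot).
exfalso.
have mM : models (hmodel nf).
  move=> G a ax e; rewrite -(ecls_rep e); apply/sat_T.
  by exists 0 => n _; apply/p_ax/RCAw_sub.
have r : env raw [] by exact: enil.
have hm : coh_env r 0 by move=> s x; move: (enil (M := fun _ => False) x).
suff hT : T nf (Not f) r.
  by apply: (proj1 (T_not _ _ _) hT); apply/sat_T; apply: h mM _; apply: hmodel_ext.
exists 0 => n _; elim: n => [|n IH].
  by apply: p_hyp; left; congr Not; rewrite -[LHS]fsub_id; apply: fsub_ext => s x;
    move: (enil (M := fun _ => False) x).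
by rewrite (at_shift _ hm) //; apply: hs_up.
Qed.

(** * Arithmetic in a model *)

Import Order.TTheory GRing.Theory Num.Theory.
Open Scope ring_scope.

Lemma tev_tsub M G D (e : env (dom M) D) (f : sub G D) s (a : tm G s) :
  tev e (tsub f a) = tev (fun _ x => tev e (f _ x)) a.
Proof. by elim: a => //= s' t b -> c ->. Qed.

Lemma tev_wk M G s t (e : env (dom M) G) (d : dom M s) (a : tm G t) :
  tev (econs d e) (↑a) = tev e a.
Proof. by rewrite /wk tren_tsub tev_tsub. Qed.

Lemma sat_fsub M G D (e : env (dom M) D) (f : sub G D) (a : fm G) :
  sat e (fsub f a) <-> sat (fun _ x => tev e (f _ x)) a.
Proof.
have E G' D' (e' : env (dom M) D') (f' : sub G' D') s (d : dom M s) :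
  (fun _ x => tev (econs d e') (slift f' x)) = econs d (fun _ x => tev e' (f' _ x)).
  by apply: env_ext; var_cases => //= t y; rewrite /slift /= tren_tsub tev_tsub.
elim: a D e f => {G} [G a b|G a b|G|G a IHa b IHb|G a IHa b IHb|G a IHa b IHb|G s a IHa|G s a IHa] D e f /=;
  rewrite ?tev_tsub ?IHa ?IHb //.
- by split=> h d; have := h d; rewrite IHa E.
- by split=> -[d h]; exists d; move: h; rewrite IHa E.
Qed.

Lemma sat_eqT (M : model) (Mext : extensional M) s G (e : env (dom M) G) (a b : tm G s) :
  sat e (eqT a b) <-> tev e a = tev e b.
Proof.
elim: s G e a b => // r _ t IH G e a b; rewrite /= /all_ /=.
split=> [h|E d]; last by rewrite IH /= !tev_wk E.
by apply: Mext => d; have := h d; rewrite IH /= !tev_wk.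
Qed.

Record rmodel := RModel {
  rm :> model; rm_ext : extensional rm; rm_models : models rm }.

Lemma rmP (M : rmodel) G (f : fm G) (e : env (dom M) G) : RCAw f -> sat e f.
Proof. by move=> ax; apply: (rm_models (r := M)). Qed.

Notation "f ∙ a" := (ap f a) (at level 39, left associativity).

Section Laws.
Variable M : rmodel.
Implicit Types a b c d : dom M N.

(** Axioms are stated for terms; taking variables as terms and evaluating them gives the law for all
    elements of the model. *)
Let ax1 (f : forall G, tm G N -> fm G) :
  (forall G x, RCAw (f G x)) -> forall a, sat (econs a enil) (f _ (TVar vz)).
Proof. by move=> h a; apply: rmP. Qed.
Let ax2 (f : forall G, tm G N -> tm G N -> fm G) :
  (forall G x y, RCAw (f G x y)) ->
  forall a b, sat (econs a (econs b enil)) (f _ (TVar vz) (TVar (vs vz))).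
Proof. by move=> h a b; apply: rmP. Qed.
Let ax3 (f : forall G, tm G N -> tm G N -> tm G N -> fm G) :
  (forall G x y z, RCAw (f G x y z)) ->
  forall a b c, sat (econs a (econs b (econs c enil)))
     (f _ (TVar vz) (TVar (vs vz)) (TVar (vs (vs vz)))).
Proof. by move=> h a b c; apply: rmP. Qed.

Definition nadd a b := mplus ∙ a ∙ b.
Definition nmul a b := mmult ∙ a ∙ b.

Lemma naddA : associative nadd. Proof. exact: ax3 ax_addA. Qed.
Lemma naddC : commutative nadd. Proof. exact: ax2 ax_addC. Qed.
Lemma nadd0 : left_id m0 nadd. Proof. by move=> a; rewrite naddC; apply: ax1 ax_add0 a. Qed.
Lemma nmulA : associative nmul. Proof. exact: ax3 ax_mulA. Qed.
Lemma nmulC : commutative nmul. Proof. exact: ax2 ax_mulC. Qed.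
Lemma nmul1 : left_id m1 nmul. Proof. by move=> a; rewrite nmulC; apply: ax1 ax_mul1 a. Qed.
Lemma nmul0 : left_zero m0 nmul. Proof. by move=> a; rewrite nmulC; apply: ax1 ax_mul0 a. Qed.
Lemma nmulD : left_distributive nmul nadd.
Proof. by move=> a b c; rewrite nmulC !(nmulC _ c); apply: ax3 ax_mulDr c a b. Qed.

Lemma nlt_irr a : ~ mlt a a. Proof. exact: ax1 ax_lt_irr a. Qed.
Lemma nlt_trans a b c : mlt a b -> mlt b c -> mlt a c. Proof. exact: ax3 ax_lt_trans a b c. Qed.
Lemma nlt_total a b : mlt a b \/ a = b \/ mlt b a. Proof. exact: ax2 ax_lt_total a b. Qed.
Lemma nlt_add a b c : mlt a b -> mlt (nadd a c) (nadd b c). Proof. exact: ax3 ax_lt_add a b c. Qed.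
Lemma nlt_mul a b c : mlt m0 c -> mlt a b -> mlt (nmul a c) (nmul b c).
Proof. exact: ax3 ax_lt_mul a b c. Qed.
Lemma nlt01 : @mlt M m0 m1. Proof. exact: (rmP (enil : env (dom M) []) (ax_lt_01 _)). Qed.
Lemma nlt0 a : ~ mlt a m0. Proof. exact: ax1 ax_lt_0 a. Qed.
Lemma nltS a b : mlt a (nadd b m1) <-> mlt a b \/ a = b. Proof. exact: ax2 ax_lt_S a b. Qed.

Lemma piE s t (x : dom M s) (y : dom M t) : mpi ∙ x ∙ y = x.
Proof.
have := rmP (econs x (econs y enil)) (ax_Pi (TVar vz) (TVar (vs vz))).
by move/(sat_eqT (@rm_ext M)).
Qed.

Lemma sigmaE r s t (x : dom M (r ⇒ s ⇒ t)) (y : dom M (r ⇒ s)) (z : dom M r) :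
  msigma ∙ x ∙ y ∙ z = x ∙ z ∙ (y ∙ z).
Proof.
have := rmP (econs x (econs y (econs z enil)))
  (ax_Sigma (TVar vz) (TVar (vs vz)) (TVar (vs (vs vz)))).
by move/(sat_eqT (@rm_ext M)).
Qed.

Lemma rec0 f a : @mrec M ∙ f ∙ a ∙ m0 = a.
Proof.
exact: (rmP (econs f (econs a enil)) (ax_Rec0 (TVar vz) (TVar (vs vz)))).
Qed.

Lemma recS f a b : @mrec M ∙ f ∙ a ∙ nadd b m1 = f ∙ b ∙ (mrec ∙ f ∙ a ∙ b).
Proof.
exact: (rmP (econs f (econs a (econs b enil)))
  (ax_RecS (TVar vz) (TVar (vs vz)) (TVar (vs (vs vz))))).
Qed.

Lemma ind_qfree G (A : fm (N :: G)) (e : env (dom M) G) : qfree A ->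
  sat (econs m0 e) A -> (forall n, sat (econs n e) A -> sat (econs (nadd n m1) e) A) ->
  forall n, sat (econs n e) A.
Proof.
move=> qA h0 hS n; have /= := rmP e (ax_ind qA); apply.
  rewrite sat_fsub; suff -> : (fun _ x => tev e (scons TZero (fun _ y => TVar y) x)) = econs m0 e by [].
  by apply: env_ext; var_cases.
move=> d /hS; rewrite sat_fsub.
suff -> : (fun _ x => tev (econs d e) (scons (TVar vz +' TOne) (fun _ y => TVar (vs y)) x))
  = econs (nadd d m1) e by [].
by apply: env_ext; var_cases.
Qed.

Lemma qfac (c : dom M (T1 ⇒ N ⇒ N)) :
  (forall x, exists n, c ∙ x ∙ n = m0) -> exists F : dom M (T1 ⇒ N), forall x, c ∙ x ∙ (F ∙ x) = m0.
Proof.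
move=> h; set A : fm [N; T1; T1 ⇒ N ⇒ N] := TVar (vs (vs vz)) · TVar (vs vz) · TVar vz ≐ TZero.
exact: (rmP (econs c enil) (@ax_qfac _ A I) h).
Qed.

End Laws.

HB.instance Definition _ (M : rmodel) := gen_eqMixin (dom M N).
HB.instance Definition _ (M : rmodel) := gen_choiceMixin (dom M N).
HB.instance Definition _ (M : rmodel) :=
  GRing.isNmodule.Build (dom M N) (@naddA M) (@naddC M) (@nadd0 M).

Lemma n1_neq0 (M : rmodel) : (m1 : dom M N) != 0.
Proof. by apply/eqP => E; have := nlt01 M; rewrite (E : m1 = m0); apply: nlt_irr. Qed.

HB.instance Definition _ (M : rmodel) :=
  GRing.Nmodule_isComNzSemiRing.Build (dom M N)
   (@nmulA M) (@nmulC M) (@nmul1 M) (@nmulD M) (@nmul0 M) (@n1_neq0 M).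

Section Bootstrap.
Variable M : rmodel.
Implicit Types a b c d n : dom M N.

Definition mle a b := ~ mlt b a.

Lemma ncancel a b c : a + c = b + c -> a = b.
Proof.
move=> E; have [h|[//|h]] := nlt_total a b; exfalso.
  by have : mlt (a + c) (b + c) := nlt_add c h; rewrite E => /nlt_irr.
by have : mlt (b + c) (a + c) := nlt_add c h; rewrite E => /nlt_irr.
Qed.

Lemma nlt_succ a : mlt a (a + 1).
Proof. by apply/nltS; right. Qed.

Lemma nsucc_neq0 a : a + 1 <> 0.
Proof. by move=> E; apply: (@nlt0 _ a); rewrite -[m0]E; apply: nlt_succ. Qed.

(** The recursion step [mpi] returns the index and discards the previous value. *)
Definition npred : dom M (N ⇒ N) := mrec ∙ mpi ∙ 0.

Lemma npred0 : npred ∙ 0 = 0. Proof. exact: rec0. Qed.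
Lemma npredS n : npred ∙ (n + 1) = n. Proof. by rewrite /npred recS piE. Qed.

Lemma ncase n : n = 0 \/ exists k, n = k + 1.
Proof.
(* Induction is restricted to quantifier-free formulas, so the existential quantifier is first
   replaced by an explicit term. *)
suff : n = 0 \/ n = npred ∙ n + 1 by case; [left | right; exists (npred ∙ n)].
pose A : fm [N; N ⇒ N] := Or (TVar vz ≐ TZero) (TVar vz ≐ (TVar (vs vz) · TVar vz) +' TOne).
apply: (@ind_qfree M _ A (econs npred enil)) => //=; first by left.
by move=> {}n _; right; change (n + 1 = npred ∙ (n + 1) + 1); rewrite npredS.
Qed.

(** Truncated subtraction: each step applies [npred] to the previous value. *)
Definition nsub : dom M (N ⇒ N ⇒ N) := mrec ∙ (mpi ∙ npred).

Lemma nsub0 a : nsub ∙ a ∙ 0 = a. Proof. exact: rec0. Qed.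
Lemma nsubS a n : nsub ∙ a ∙ (n + 1) = npred ∙ (nsub ∙ a ∙ n).
Proof. by rewrite /nsub recS piE. Qed.

Lemma nsubK a n : mle n a -> nsub ∙ a ∙ n + n = a.
Proof.
pose A : fm [N; N; N ⇒ N ⇒ N] := Imp (Not (TVar (vs vz) ≺ TVar vz))
   ((TVar (vs (vs vz)) · TVar (vs vz) · TVar vz) +' TVar vz ≐ TVar (vs vz)).
apply: (@ind_qfree M _ A (econs a (econs nsub enil))) => //=.
  by move=> _; change (nsub ∙ a ∙ 0 + 0 = a); rewrite nsub0 addr0.
move=> {}n IH h; change (nsub ∙ a ∙ (n + 1) + (n + 1) = a); rewrite nsubS.
have {IH} : nsub ∙ a ∙ n + n = a.
  by apply: IH => h'; apply: h; apply: nlt_trans h' (nlt_succ n).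
have [->|[k ->]] := ncase (nsub ∙ a ∙ n).
  by rewrite add0r => E; case: h; rewrite -E; apply: nlt_succ.
by rewrite npredS -addrA (addrC 1).
Qed.

Lemma nle_ex a b : mle a b -> exists c, b = a + c.
Proof. by move/nsubK => E; exists (nsub ∙ b ∙ a); rewrite addrC. Qed.

Lemma nlt_le a b : mlt a b -> mle a b.
Proof. by move=> h1 h2; apply: nlt_irr (nlt_trans h1 h2). Qed.

Lemma nlt_ex a b : mlt a b -> exists c, b = a + c + 1.
Proof.
move=> h; have [c E] := nle_ex (nlt_le h); have [c0|[k ck]] := ncase c.
  by move: h; rewrite E c0 addr0 => /nlt_irr.
by exists k; rewrite E ck addrA.
Qed.

Lemma nle_add a c : mle a (a + c).
Proof.
move=> h; have [k E] := nlt_ex h.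
have : (c + k + 1) + a = 0 + a by rewrite add0r {2}E; ring.
by move/ncancel/nsucc_neq0.
Qed.

Lemma nlt_addS a c : mlt a (a + c + 1).
Proof. by apply/nltS; have [|[|h]] := nlt_total a (a + c); auto; case: (nle_add h). Qed.

Lemma nsub_le a b : nsub ∙ a ∙ b = 0 <-> mle a b.
Proof.
split=> [E h|/nle_ex [c ->]].
  have := nsubK (nlt_le h); rewrite E add0r => E'; move: h; rewrite E'.
  exact: nlt_irr.
pose A : fm [N; N; N ⇒ N ⇒ N] := (TVar (vs (vs vz)) · TVar (vs vz) · (TVar (vs vz) +' TVar vz)) ≐ TZero.
apply: (@ind_qfree M _ A (econs a (econs nsub enil))) => //=.
  change (nsub ∙ a ∙ (a + 0) = 0); rewrite addr0; apply: (ncancel (c := a)).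
  by rewrite add0r; apply: nsubK; apply: nlt_irr.
move=> {}c E; change (nsub ∙ a ∙ (a + (c + 1)) = 0); rewrite addrA nsubS.
by rewrite (E : nsub ∙ a ∙ (a + c) = 0) npred0.
Qed.

Lemma nadd_eq0 a b : a + b = 0 <-> a = 0 /\ b = 0.
Proof.
split=> [E|[-> ->]]; last exact: addr0.
have [a0|[k ak]] := ncase a; last by case: (@nsucc_neq0 (k + b)); rewrite -E ak; ring.
by split => //; move: E; rewrite a0 add0r.
Qed.

Lemma nmul_eq0 a b : a * b = 0 <-> a = 0 \/ b = 0.
Proof.
split=> [E|[->|->]]; rewrite ?mul0r ?mulr0 //.
have [a0|[k ak]] := ncase a; [by left | right].
have [//|[l bl]] := ncase b.
by case: (@nsucc_neq0 (k * l + k + l)); rewrite -E ak bl; ring.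
Qed.

Definition ncond a b c : dom M N := mrec ∙ (mpi ∙ (mpi ∙ b)) ∙ a ∙ c.

Lemma ncond0 a b : ncond a b 0 = a. Proof. exact: rec0. Qed.
Lemma ncondS a b c : c <> 0 -> ncond a b c = b.
Proof. by have [->|[k ->]] := ncase c; rewrite // /ncond recS !piE. Qed.

(** * Definable functions and decidable predicates *)

Fixpoint tup (l : list ty) : Type :=
  match l with [] => unit | s :: l => (dom M s * tup l)%type end.

(** The head of the list is the last argument, so a new variable is added without disturbing the
    earlier ones, and the combinators always abstract over the head. *)
Fixpoint arrs (l : list ty) (t : ty) : ty :=
  match l with [] => t | s :: l => arrs l (s ⇒ t) end.

Fixpoint aps (l : list ty) (t : ty) : dom M (arrs l t) -> tup l -> dom M t :=
  match l with
  | [] => fun F _ => F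
  | s :: l => fun F r => aps (t := s ⇒ t) F r.2 ∙ r.1
  end.

Definition rep l t (h : tup l -> dom M t) := exists F, forall r, aps F r = h r.

Lemma rep_const l t (c : dom M t) : rep (fun _ : tup l => c).
Proof.
elim: l t c => [|s l IH] t c; first by exists c.
by have [F hF] := IH _ (mpi ∙ c : dom M (s ⇒ t)); exists F => r /=; rewrite hF piE.
Qed.

(** Bracket abstraction: [msigma] distributes the innermost parameter over an application, and the
    induction hypothesis handles the remaining ones. *)
Lemma rep_app l s t (f : tup l -> dom M (s ⇒ t)) (g : tup l -> dom M s) :
  rep f -> rep g -> rep (fun r => f r ∙ g r).
Proof.
move=> [F hF] [G hG].
suff [H hH] : rep (fun r => aps F r ∙ aps G r) by exists H => r; rewrite hH hF hG.
elim: l s t F G {f g hF hG} => [|u l IH] s t F G; first by exists (F ∙ G).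
have [S hS] := rep_const l (@msigma M u s t).
have [F' hF'] := IH _ _ S F; have [H hH] := IH _ _ F' G.
by exists H => r /=; rewrite hH hF' hS sigmaE.
Qed.

Lemma rep_weak s l t (h : tup l -> dom M t) : rep h -> rep (fun r : tup (s :: l) => h r.2).
Proof.
move=> hh; have [F hF] := rep_app (rep_const l (@mpi M t s)) hh.
by exists F => r /=; rewrite hF piE.
Qed.

Lemma rep_v0 s l : rep (fun r : tup (s :: l) => r.1).
Proof.
have [F hF] := rep_const l (msigma ∙ mpi ∙ (mpi (t := N)) : dom M (s ⇒ s)).
by exists F => r /=; rewrite hF sigmaE piE.
Qed.
Lemma rep_v1 s0 s l : rep (fun r : tup (s0 :: s :: l) => r.2.1).
Proof. exact: rep_weak (rep_v0 _ _). Qed.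
Lemma rep_v2 s0 s1 s l : rep (fun r : tup (s0 :: s1 :: s :: l) => r.2.2.1).
Proof. exact: rep_weak (rep_v1 _ _ _). Qed.
Lemma rep_v3 s0 s1 s2 s l : rep (fun r : tup (s0 :: s1 :: s2 :: s :: l) => r.2.2.2.1).
Proof. exact: rep_weak (rep_v2 _ _ _ _). Qed.
Lemma rep_v4 s0 s1 s2 s3 s l : rep (fun r : tup (s0 :: s1 :: s2 :: s3 :: s :: l) => r.2.2.2.2.1).
Proof. exact: rep_weak (rep_v3 _ _ _ _ _). Qed.
Lemma rep_v5 s0 s1 s2 s3 s4 s l :
  rep (fun r : tup (s0 :: s1 :: s2 :: s3 :: s4 :: s :: l) => r.2.2.2.2.2.1).
Proof. exact: rep_weak (rep_v4 _ _ _ _ _ _). Qed.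

Lemma rep_add l (f g : tup l -> dom M N) : rep f -> rep g -> rep (fun r => f r + g r).
Proof. by move=> hf hg; do 2 apply: rep_app => //; apply: rep_const. Qed.

Lemma rep_mul l (f g : tup l -> dom M N) : rep f -> rep g -> rep (fun r => f r * g r).
Proof. by move=> hf hg; do 2 apply: rep_app => //; apply: rep_const. Qed.

Lemma rep_cond l (f g h : tup l -> dom M N) :
  rep f -> rep g -> rep h -> rep (fun r => ncond (f r) (g r) (h r)).
Proof.
move=> hf hg hh; do 3 (apply: rep_app => //; try exact: rep_const).
by do 2 (apply: rep_app => //; try exact: rep_const).
Qed.

(** The semantic counterpart of quantifier-free formulas with parameters. Truth is coded by 0, so
    that conjunction becomes a sum and disjunction a product. *)
Definition dec l (P : tup l -> Prop) := exists2 c, rep c & forall r, P r <-> c r = 0.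

Lemma dec_ext l (P Q : tup l -> Prop) : (forall r, P r <-> Q r) -> dec P -> dec Q.
Proof. by move=> h [c rc hc]; exists c => // r; rewrite -h. Qed.

Lemma dec_const l (P : Prop) : dec (fun _ : tup l => P).
Proof.
have [h|h] := pselect P.
  by exists (fun _ => 0); [exact: rep_const | split].
exists (fun _ => 1) => [|r]; first exact: rep_const.
by split=> // /eqP; rewrite oner_eq0.
Qed.

Lemma dec_eq l (f g : tup l -> dom M N) : rep f -> rep g -> dec (fun r => f r = g r).
Proof.
move=> hf hg; exists (fun r => nsub ∙ f r ∙ g r + nsub ∙ g r ∙ f r).
  by apply: rep_add; do 2 apply: rep_app => //; apply: rep_const.
move=> r; rewrite nadd_eq0 !nsub_le; split=> [->|[h1 h2]].
  by split; apply: nlt_irr.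
by have [|[]] := nlt_total (f r) (g r).
Qed.

Lemma dec_not l (P : tup l -> Prop) : dec P -> dec (fun r => ~ P r).
Proof.
move=> [c hc E]; exists (fun r => ncond 1 0 (c r)).
  by apply: rep_cond => //; apply: rep_const.
move=> r; rewrite E; have [->|h] := pselect (c r = 0); last by rewrite ncondS.
by rewrite ncond0; split=> [|/eqP]; rewrite ?oner_eq0.
Qed.

Lemma dec_lt l (f g : tup l -> dom M N) : rep f -> rep g -> dec (fun r => mlt (f r) (g r)).
Proof.
move=> hf hg; apply: (dec_ext (P := fun r => ~ (nsub ∙ g r ∙ f r = 0))).
  by move=> r; rewrite nsub_le; split=> [/contrapT|h h'] //; apply: h'.
apply/dec_not/dec_eq; last exact: rep_const.
by do 2 apply: rep_app => //; apply: rep_const.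
Qed.

Lemma dec_and l (P Q : tup l -> Prop) : dec P -> dec Q -> dec (fun r => P r /\ Q r).
Proof.
move=> [c hc E] [d hd E']; exists (fun r => c r + d r); first exact: rep_add.
by move=> r; rewrite nadd_eq0 E E'.
Qed.

Lemma dec_or l (P Q : tup l -> Prop) : dec P -> dec Q -> dec (fun r => P r \/ Q r).
Proof.
move=> [c hc E] [d hd E']; exists (fun r => c r * d r); first exact: rep_mul.
by move=> r; rewrite nmul_eq0 E E'.
Qed.

Lemma dec_imp l (P Q : tup l -> Prop) : dec P -> dec Q -> dec (fun r => P r -> Q r).
Proof.
move=> hP hQ; apply: (dec_ext (P := fun r => ~ P r \/ Q r)).
  move=> r; split=> [[|]|h] //; have [/h|] := pselect (P r); by [right | left].
by apply: dec_or => //; apply: dec_not.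
Qed.

Lemma dec_iff l (P Q : tup l -> Prop) : dec P -> dec Q -> dec (fun r => P r <-> Q r).
Proof. by move=> hP hQ; apply: dec_and; apply: dec_imp. Qed.

Lemma dec_le l (f g : tup l -> dom M N) : rep f -> rep g -> dec (fun r => mle (f r) (g r)).
Proof. by move=> hf hg; apply/dec_not/dec_lt. Qed.

Definition ifp T (P : Prop) (a b : T) : T := if pselect P then a else b.

Lemma ifpT T (P : Prop) (a b : T) : P -> ifp P a b = a.
Proof. by rewrite /ifp; case: pselect. Qed.

Lemma ifpF T (P : Prop) (a b : T) : ~ P -> ifp P a b = b.
Proof. by rewrite /ifp; case: pselect. Qed.

(** [ifp] decides by excluded middle in the metatheory; decidability of [P] inside the model is what
    turns it into [ncond]. *)
Lemma rep_ifp l (P : tup l -> Prop) (f g : tup l -> dom M N) :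
  dec P -> rep f -> rep g -> rep (fun r => ifp (P r) (f r) (g r)).
Proof.
move=> [c hc E] hf hg; have [F hF] := rep_cond hf hg hc.
exists F => r; rewrite hF; have [h|h] := pselect (P r).
  by rewrite ifpT // (E r).1 // ncond0.
by rewrite ifpF // ncondS // -E.
Qed.

Lemma rep_ex1 s t (h : dom M s -> dom M t) : rep (fun r : tup [s] => h r.1) ->
  exists F : dom M (s ⇒ t), forall x, F ∙ x = h x.
Proof. by move=> [F hF]; exists F => x; apply: (hF (x, tt)). Qed.

Lemma rep_ex2 s1 s2 t (h : dom M s1 -> dom M s2 -> dom M t) :
  rep (fun r : tup [s2; s1] => h r.2.1 r.1) ->
  exists F : dom M (s1 ⇒ s2 ⇒ t), forall x y, F ∙ x ∙ y = h x y.
Proof. by move=> [F hF]; exists F => x y; apply: (hF (y, (x, tt))). Qed.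

Lemma rep_ex3 s1 s2 s3 t (h : dom M s1 -> dom M s2 -> dom M s3 -> dom M t) :
  rep (fun r : tup [s3; s2; s1] => h r.2.2.1 r.2.1 r.1) ->
  exists F : dom M (s1 ⇒ s2 ⇒ s3 ⇒ t), forall x y z, F ∙ x ∙ y ∙ z = h x y z.
Proof. by move=> [F hF]; exists F => x y z; apply: (hF (z, (y, (x, tt)))). Qed.

Lemma rep_rec l (a : tup l -> dom M N) (h : tup l -> dom M N -> dom M N -> dom M N) :
  rep a -> rep (fun r : tup (N :: N :: l) => h r.2.2 r.2.1 r.1) ->
  exists F : tup l -> dom M N -> dom M N,
  [/\ rep (fun r : tup (N :: l) => F r.2 r.1), (forall r, F r 0 = a r) &
      forall r n, F r (n + 1) = h r n (F r n)].
Proof.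
move=> ha [H hH]; exists (fun r n => mrec ∙ (aps (l := l) (t := N ⇒ N ⇒ N) H r) ∙ a r ∙ n); split.
- refine (rep_app (rep_app (rep_app (rep_const _ _) _) _) (rep_v0 _ _)); last exact: rep_weak ha.
  by apply: (@rep_weak N l _ (aps (l := l) (t := N ⇒ N ⇒ N) H)); exists H.
- by move=> r; apply: rec0.
- by move=> r n; rewrite recS; apply: (hH (_, (n, r))).
Qed.

(** From here on every induction on numbers of the model goes through this form: the predicate is
    reduced to an equation [F ∙ n = 0] with [F] a parameter. *)
Lemma dec_ind (P : dom M N -> Prop) : dec (fun r : tup [N] => P r.1) ->
  P 0 -> (forall n, P n -> P (n + 1)) -> forall n, P n.
Proof.
move=> [c [F hF] E] h0 hS n.
have {}E k : P k <-> F ∙ k = m0 by rewrite (E (k, tt)) -hF.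
apply/E; pose A : fm [N; N ⇒ N] := TVar (vs vz) · TVar vz ≐ TZero.
apply: (@ind_qfree M _ A (econs F enil)) => //=; first exact/E.
by move=> k /E/hS/E.
Qed.

Lemma choice_T1 (P : dom M T1 -> dom M N -> Prop) :
  dec (fun r : tup [N; T1] => P r.2.1 r.1) -> (forall x, exists n, P x n) ->
  exists F : dom M (T1 ⇒ N), forall x, P x (F ∙ x).
Proof.
move=> [c [F hF] E] h.
have {}E x k : P x k <-> F ∙ x ∙ k = m0 by rewrite (E (k, (x, tt))) -hF.
have [x|G hG] := qfac (c := F); first by have [n /E] := h x; exists n.
by exists G => x; apply/E.
Qed.

(** The choice axiom takes arguments of type 1, so a number is passed as the constant function
    [mpi ∙ x] and read back by evaluation at 0. *)
Lemma choice_N (P : dom M N -> dom M N -> Prop) :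
  dec (fun r : tup [N; N] => P r.2.1 r.1) -> (forall x, exists n, P x n) ->
  exists F : dom M (N ⇒ N), forall x, P x (F ∙ x).
Proof.
move=> [c [F hF] E] h.
have {}E x k : P x k <-> F ∙ x ∙ k = 0 by rewrite (E (k, (x, tt))) -hF.
have [||G hG] := @choice_T1 (fun x n => F ∙ (x ∙ 0) ∙ n = 0).
- apply: dec_eq; last exact: rep_const.
  apply: rep_app (rep_v0 _ _); apply: rep_app (rep_const _ _) _.
  exact: rep_app (rep_v1 _ _ _) (rep_const _ _).
- by move=> x; have [n /E] := h (x ∙ 0); exists n.
have [|K hK] := @rep_ex1 _ _ (fun x => G ∙ (mpi ∙ x)).
  by apply: rep_app (rep_const _ _) _; apply: rep_app (rep_const _ _) (rep_v0 _ _).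
by exists K => x; apply/E; rewrite hK; have := hG (mpi ∙ x); rewrite piE.
Qed.
End Bootstrap.
Arguments npred {M}.
Arguments nsub {M}.

Ltac rep1 :=
  first [ assumption | exact: rep_const | exact: rep_v0 | exact: rep_v1 | exact: rep_v2
        | exact: rep_v3 | exact: rep_v4 | exact: rep_v5 
        | apply: rep_add | apply: rep_mul | apply: rep_ifp | apply: rep_app
        | exact: dec_const | apply: dec_eq | apply: dec_lt | apply: dec_le
        | apply: dec_not | apply: dec_and | apply: dec_or | apply: dec_iff | apply: dec_imp ].
Ltac rep := repeat rep1.

(** * The ordered field of fractions of the numbers of a model *)

Section Fractions.
Variable M : rmodel.
Implicit Types a b c : dom M N.

(* [((a, b), c)] stands for (a - b) / (c + 1). *)
Definition triple : Type := (dom M N * dom M N) * dom M N.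
HB.instance Definition _ := Choice.on triple.
Implicit Types s t : triple.

(** Cross-multiplied, with the negative parts moved across, since the numbers form only a
    semiring. *)
Definition feq s t : Prop :=
  s.1.1 * (t.2 + 1) + t.1.2 * (s.2 + 1) = t.1.1 * (s.2 + 1) + s.1.2 * (t.2 + 1).

Lemma nmul_cancel a b c : a * (c + 1) = b * (c + 1) -> a = b.
Proof.
have h x y : mlt x y -> mlt (x * (c + 1)) (y * (c + 1)).
  by apply: nlt_mul; have := @nlt_addS M 0 c; rewrite add0r.
move=> E; have [/h|[//|/h]] := nlt_total a b; rewrite E => /nlt_irr //.
Qed.

Lemma feq_refl : reflexive (fun s t => `[< feq s t >]).
Proof. by move=> s; apply/asboolP; rewrite /feq. Qed.

Lemma feq_sym : symmetric (fun s t => `[< feq s t >]).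
Proof.
by move=> s t; apply: asbool_equiv_eq; split; apply: esym.
Qed.

Lemma feq_trans : transitive (fun s t => `[< feq s t >]).
Proof.
move=> [[a1 b1] c1] [[a b] c] [[a2 b2] c2] /asboolP E1 /asboolP E2; apply/asboolP.
move: E1 E2; rewrite /feq /= => E1 E2.
(* Multiplying by the middle denominator and adding its negative part to both sides makes the left
   side of [E1], and then that of [E2], appear. *)
apply: (nmul_cancel (c := c1)); apply: (ncancel (c := b1 * (c + 1) * (c2 + 1))).
transitivity ((a * (c1 + 1) + b1 * (c + 1)) * (c2 + 1) + b2 * (c1 + 1) * (c + 1)); first by ring.
rewrite E1.
transitivity ((a1 * (c2 + 1) + b2 * (c1 + 1)) * (c + 1) + b * (c1 + 1) * (c2 + 1)); first by ring.
by rewrite E2; ring.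
Qed.

Definition feqb s t : bool := `[< feq s t >].
Canonical feq_equiv := EquivRel feqb feq_refl feq_sym feq_trans.
Definition rat_of : Type := {eq_quot feq_equiv}%qT.
HB.instance Definition _ := Choice.on rat_of.
Implicit Types p q r : rat_of.

Definition pi_ t : rat_of := (\pi_({eq_quot feq_equiv}) t)%qT.
Definition rp q : triple := repr (q : {eq_quot feq_equiv}%qT).

Lemma pi_rp q : pi_ (rp q) = q. Proof. exact: (@reprK _ {eq_quot feq_equiv}%qT). Qed.

Lemma pi_eq s t : pi_ s = pi_ t <-> feq s t.
Proof.
split=> [/(eqmodP feq_equiv s t) /asboolP //|E].
by apply/(eqmodP feq_equiv s t)/asboolP.
Qed.

Lemma rp_pi t : feq (rp (pi_ t)) t. Proof. by apply/pi_eq; rewrite pi_rp. Qed.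

Lemma pi_ex q : exists a b c, q = pi_ ((a, b), c).
Proof. by rewrite -(pi_rp q); case: (rp q) => -[a b] c; exists a, b, c. Qed.

(** Denominators are stored minus one, and [s.2 * t.2 + s.2 + t.2] is the product of the
    denominators minus one. *)
Definition addt s t : triple :=
  ((s.1.1 * (t.2 + 1) + t.1.1 * (s.2 + 1), s.1.2 * (t.2 + 1) + t.1.2 * (s.2 + 1)),
   s.2 * t.2 + s.2 + t.2).
Definition mult s t : triple :=
  ((s.1.1 * t.1.1 + s.1.2 * t.1.2, s.1.1 * t.1.2 + s.1.2 * t.1.1), s.2 * t.2 + s.2 + t.2).
Definition oppt s : triple := ((s.1.2, s.1.1), s.2).

Lemma addt_cong s s' t t' : feq s s' -> feq t t' -> feq (addt s t) (addt s' t').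
Proof.
move: s s' t t' => [[a b] c] [[a1 b1] c1] [[e f] g] [[e1 f1] g1]; rewrite /feq /= => E F.
transitivity ((a * (c1 + 1) + b1 * (c + 1)) * ((g + 1) * (g1 + 1)) +
   (e * (g1 + 1) + f1 * (g + 1)) * ((c + 1) * (c1 + 1))); first by ring.
by rewrite E F; ring.
Qed.

Lemma mult_congl s s' t : feq s s' -> feq (mult s t) (mult s' t).
Proof.
move: s s' t => [[a b] c] [[a1 b1] c1] [[e f] g]; rewrite /feq /= => E.
transitivity ((g + 1) * (e * (a * (c1 + 1) + b1 * (c + 1)) + f * (a1 * (c + 1) + b * (c1 + 1)))).
  by ring.
transitivity ((g + 1) * (e * (a1 * (c + 1) + b * (c1 + 1)) + f * (a * (c1 + 1) + b1 * (c + 1)))).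
  by rewrite E.
by ring.
Qed.

Lemma mult_comm s t : feq (mult s t) (mult t s).
Proof. by rewrite /feq /=; ring. Qed.

Definition addq p q := pi_ (addt (rp p) (rp q)).
Definition mulq p q := pi_ (mult (rp p) (rp q)).
Definition oppq p := pi_ (oppt (rp p)).

Lemma addq_pi s t : addq (pi_ s) (pi_ t) = pi_ (addt s t).
Proof. by apply/pi_eq/addt_cong; apply: rp_pi. Qed.

Lemma mulq_pi s t : mulq (pi_ s) (pi_ t) = pi_ (mult s t).
Proof.
have h u v w : feq u v -> pi_ (mult u w) = pi_ (mult v w).
  by move=> E; apply/pi_eq/mult_congl.
have C u v : pi_ (mult u v) = pi_ (mult v u) by apply/pi_eq/mult_comm.
by rewrite /mulq (h _ _ _ (rp_pi s)) C (h _ _ _ (rp_pi t)) C.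
Qed.

Lemma oppq_pi s : oppq (pi_ s) = pi_ (oppt s).
Proof.
apply/pi_eq; have := rp_pi s; rewrite /feq /= => E.
by rewrite addrC -E addrC.
Qed.

Definition iq a : rat_of := pi_ ((a, 0), 0).

Lemma addqA : associative addq.
Proof.
move=> p q r; rewrite -(pi_rp p) -(pi_rp q) -(pi_rp r) !addq_pi.
by apply/pi_eq; rewrite /feq /=; ring.
Qed.
Lemma addqC : commutative addq.
Proof. by move=> p q; apply/pi_eq; rewrite /feq /=; ring. Qed.
Lemma add0q : left_id (iq 0) addq.
Proof. by move=> p; rewrite -(pi_rp p) addq_pi; apply/pi_eq; rewrite /feq /=; ring. Qed.
Lemma addNq : left_inverse (iq 0) oppq addq.
Proof. by move=> p; rewrite -(pi_rp p) oppq_pi addq_pi; apply/pi_eq; rewrite /feq /=; ring. Qed.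
Lemma mulqA : associative mulq.
Proof.
move=> p q r; rewrite -(pi_rp p) -(pi_rp q) -(pi_rp r) !mulq_pi.
by apply/pi_eq; rewrite /feq /=; ring.
Qed.
Lemma mulqC : commutative mulq.
Proof. by move=> p q; apply/pi_eq; apply: mult_comm. Qed.
Lemma mul1q : left_id (iq 1) mulq.
Proof. by move=> p; rewrite -(pi_rp p) mulq_pi; apply/pi_eq; rewrite /feq /=; ring. Qed.
Lemma mulqD : left_distributive mulq addq.
Proof.
move=> p q r; rewrite -(pi_rp p) -(pi_rp q) -(pi_rp r) !(addq_pi, mulq_pi).
by apply/pi_eq; rewrite /feq /=; ring.
Qed.
Lemma iq_inj : injective iq.
Proof. by move=> a b /pi_eq; rewrite /feq /= !(add0r, mulr1, addr0). Qed.
Lemma oneq_neq0 : iq 1 != iq 0.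
Proof. by apply/eqP => /iq_inj/eqP; rewrite oner_eq0. Qed.

HB.instance Definition _ := GRing.isZmodule.Build rat_of addqA addqC add0q addNq.
HB.instance Definition _ := GRing.Zmodule_isComNzRing.Build rat_of mulqA mulqC mul1q mulqD oneq_neq0.

Lemma piD s t : pi_ s + pi_ t = pi_ (addt s t). Proof. exact: addq_pi. Qed.
Lemma piM s t : pi_ s * pi_ t = pi_ (mult s t). Proof. exact: mulq_pi. Qed.
Lemma piN s : - pi_ s = pi_ (oppt s). Proof. exact: oppq_pi. Qed.

Lemma iqD a b : iq (a + b) = iq a + iq b.
Proof. by rewrite /iq piD; apply/pi_eq; rewrite /feq /=; ring. Qed.
Lemma iqM a b : iq (a * b) = iq a * iq b.
Proof. by rewrite /iq piM; apply/pi_eq; rewrite /feq /=; ring. Qed.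
Lemma iq0 : iq 0 = 0. Proof. by []. Qed.
Lemma iq1 : iq 1 = 1. Proof. by []. Qed.

Lemma pi_nq a b c : pi_ ((a, b), c) * (iq c + 1) = iq a - iq b.
Proof. by rewrite -iq1 -iqD /iq piN !piM !piD; apply/pi_eq; rewrite /feq /=; ring. Qed.

Definition nonneg q := exists a c, q = pi_ ((a, 0), c).

Lemma nonneg_total q : nonneg q \/ nonneg (- q).
Proof.
have [a [b [c ->]]] := pi_ex q.
have [/nlt_le/nle_ex [k ->]|h] := pselect (mlt a b); last have [k ->] := nle_ex h.
  by right; exists k, c; rewrite piN; apply/pi_eq; rewrite /feq /=; ring.
by left; exists k, c; apply/pi_eq; rewrite /feq /=; ring.
Qed.

Lemma nonneg_add p q : nonneg p -> nonneg q -> nonneg (p + q).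
Proof.
move=> [a [c ->]] [b [d ->]]; rewrite piD.
by exists (a * (d + 1) + b * (c + 1)), (c * d + c + d); apply/pi_eq; rewrite /feq /=; ring.
Qed.

Lemma nonneg_mul p q : nonneg p -> nonneg q -> nonneg (p * q).
Proof.
move=> [a [c ->]] [b [d ->]]; rewrite piM.
by exists (a * b), (c * d + c + d); apply/pi_eq; rewrite /feq /=; ring.
Qed.

Lemma nonneg_anti q : nonneg q -> nonneg (- q) -> q = 0.
Proof.
move=> [a [c E]] [b [d F]]; have : q + - q = 0 by rewrite subrr.
rewrite F E piD => /pi_eq; rewrite /feq /= => G.
suff h : a * (d + 1) = 0.
  have a0 : a = 0.
    by have /nmul_eq0 [//|/nsucc_neq0] := h.
  by rewrite a0; apply/pi_eq; rewrite /feq /=; ring.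
apply: (proj1 (_ : _ /\ b * (c + 1) = 0)); apply/nadd_eq0.
by move: G; rewrite !(mul0r, add0r, addr0, mulr1).
Qed.

Lemma mulq_inv q : q != 0 -> exists r, r * q = 1.
Proof.
have [a [b [c ->]]] := pi_ex q => h.
have [/nlt_ex [k ->]|[E|/nlt_ex [k ->]]] := nlt_total a b.
- by exists (pi_ ((0, c + 1), k)); rewrite piM; apply/pi_eq; rewrite /feq /=; ring.
- by case/eqP: h; apply/pi_eq; rewrite E /feq /=; ring.
- by exists (pi_ ((c + 1, 0), k)); rewrite piM; apply/pi_eq; rewrite /feq /=; ring.
Qed.

Definition invq q : rat_of :=
  match pselect (exists r, r * q = 1) with left h => projT1 (cid h) | right _ => 0 end.

Lemma mulVq q : q != 0 -> invq q * q = 1.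
Proof. by move/mulq_inv => h; rewrite /invq; case: pselect => // h'; case: (cid h'). Qed.

Lemma invq0 : invq 0 = 0.
Proof.
rewrite /invq; case: pselect => // h; exfalso; case: h => r.
by rewrite mulr0 => /esym/eqP; rewrite oner_eq0.
Qed.

HB.instance Definition _ := GRing.ComNzRing_isField.Build rat_of mulVq invq0.

Definition leq_ p q : bool := `[< nonneg (q - p) >].
Definition normq q : rat_of := if `[< nonneg q >] then q else - q.

Lemma le0_addq p q : leq_ 0 p -> leq_ 0 q -> leq_ 0 (p + q).
Proof. by move=> /asboolP; rewrite subr0 => h /asboolP; rewrite subr0 => k; apply/asboolP; rewrite subr0; apply: nonneg_add. Qed.
Lemma le0_mulq p q : leq_ 0 p -> leq_ 0 q -> leq_ 0 (p * q).
Proof. by move=> /asboolP; rewrite subr0 => h /asboolP; rewrite subr0 => k; apply/asboolP; rewrite subr0; apply: nonneg_mul. Qed.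
Lemma le0_antiq q : leq_ 0 q -> leq_ q 0 -> q = 0.
Proof. by move=> /asboolP; rewrite subr0 => h /asboolP; rewrite sub0r; apply: nonneg_anti. Qed.
Lemma subq_ge0 p q : leq_ 0 (q - p) = leq_ p q.
Proof. by rewrite /leq_ subr0. Qed.
Lemma le0_totalq q : leq_ 0 q || leq_ q 0.
Proof.
by rewrite /leq_ subr0 sub0r; have [/asboolP ->|/asboolP ->] := nonneg_total q; rewrite ?orbT.
Qed.
Lemma normqN q : normq (- q) = normq q.
Proof.
rewrite /normq opprK; case: asboolP => [h|h]; case: asboolP => [k|k] //.
  by rewrite (nonneg_anti k h) oppr0.
by case: (nonneg_total q).
Qed.
Lemma ge0_normq q : leq_ 0 q -> normq q = q.
Proof. by rewrite /leq_ subr0 /normq => ->. Qed.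

HB.instance Definition _ := Num.IntegralDomain_isLeReal.Build rat_of
  le0_addq le0_mulq le0_antiq subq_ge0 le0_totalq normqN ge0_normq (fun _ _ => erefl).

Lemma iq_ge0 a : 0 <= iq a.
Proof. by apply/asboolP; rewrite subr0; exists a, 0. Qed.

Lemma iq_le a b : (iq a <= iq b) <-> mle a b.
Proof.
split=> [h k|/nle_ex [c ->]]; last by rewrite iqD lerDl iq_ge0.
have [c E] := nlt_ex k; move: h; rewrite E !iqD iq1 => h.
by have := iq_ge0 b; have := iq_ge0 c; lra.
Qed.

Lemma iq_lt a b : (iq a < iq b) <-> mlt a b.
Proof.
rewrite ltNge; split=> [/negP h|h]; first by apply: contrapT => k; apply/h/iq_le.
by apply/negP => /iq_le.
Qed.

Lemma pi_div a b c : pi_ ((a, b), c) = (iq a - iq b) / (iq c + 1).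
Proof. by rewrite -(pi_nq a b c) mulfK // gt_eqF //; have := iq_ge0 c; lra. Qed.

End Fractions.

Record fracs (M : rmodel) := Fracs {
  fr_field : realFieldType;
  fr_nq : dom M N -> fr_field;
  fr_D : {morph fr_nq : a b / a + b};
  fr_M : {morph fr_nq : a b / a * b};
  fr_0 : fr_nq 0 = 0;
  fr_1 : fr_nq 1 = 1;
  fr_ge0 : forall a, 0 <= fr_nq a;
  fr_lt : forall a b, fr_nq a < fr_nq b <-> mlt a b;
  fr_ex : forall x, exists a b c, x = (fr_nq a - fr_nq b) / (fr_nq c + 1) }.

(* Sealed, so that the field tactics never unfold the quotient. *)
Lemma fracs_of (M : rmodel) : fracs M.
Proof.
apply: (@Fracs M (rat_of M) (@iq M)).
- exact: iqD.
- exact: iqM.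
- exact: iq0.
- exact: iq1.
- exact: iq_ge0.
- exact: iq_lt.
- by move=> x; have [a [b [c ->]]] := pi_ex x; exists a, b, c; apply: pi_div.
Qed.

(** * Codes of rationals *)

Section Codes.
Variable M : rmodel.
Implicit Types a b c n p q : dom M N.

Definition qf : realFieldType := fr_field (fracs_of M).
Definition nq a : qf := fr_nq (fracs_of M) a.
Lemma nqD a b : nq (a + b) = nq a + nq b. Proof. exact: fr_D. Qed.
Lemma nqM a b : nq (a * b) = nq a * nq b. Proof. exact: fr_M. Qed.
Lemma nq0 : nq 0 = 0. Proof. exact: fr_0. Qed.
Lemma nq1 : nq 1 = 1. Proof. exact: fr_1. Qed.
Lemma nq_ge0 a : 0 <= nq a. Proof. exact: fr_ge0. Qed.
Lemma nq_lt a b : nq a < nq b <-> mlt a b. Proof. exact: fr_lt. Qed.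
Lemma nq_le a b : nq a <= nq b <-> mle a b.
Proof.
rewrite leNgt; split=> [/negP h k|h]; first exact/h/nq_lt.
by apply/negP => /nq_lt.
Qed.
Lemma nq_ex (x : qf) : exists a b c, x = (nq a - nq b) / (nq c + 1).
Proof. exact: fr_ex. Qed.

Definition npair a b : dom M N := (a + b) * (a + b) + a.

Lemma nlt_nle a b : mlt a b <-> mle (a + 1) b.
Proof.
rewrite -nq_le -nq_lt nqD nq1; split=> [/nq_lt/nlt_ex [c ->]|]; last by lra.
by rewrite !nqD nq1; have := nq_ge0 c; lra.
Qed.

(** Needed to invert the pairing: [npair a b] lies between the squares of a + b and a + b + 1, so
    its integer root is a + b. The root grows by at most one from n to n + 1, hence the
    recursion. *)
Lemma nsqrt_ex : exists F : dom M (N ⇒ N), forall n,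
  mle (F ∙ n * F ∙ n) n /\ mlt n ((F ∙ n + 1) * (F ∙ n + 1)).
Proof.
have [||F [rF F0 FS]] := @rep_rec M [] (fun _ => 0)
  (fun _ n r => ifp (mle ((r + 1) * (r + 1)) (n + 1)) (r + 1) r); try by rep.
have [F' hF'] := rep_ex1 (h := F tt) (ltac:(by case: rF => G hG; exists G => -[x []])).
exists F'; apply: dec_ind; first by rep.
  by rewrite hF' F0; split; [rewrite mul0r; apply: nlt_irr | rewrite add0r mulr1; apply: nlt01].
move=> n; rewrite !hF' FS; set r := F tt n => -[h1 h2].
have [h|h] := pselect (mle ((r + 1) * (r + 1)) (n + 1)).
  rewrite ifpT //; split => //; move: h2; rewrite -!nq_lt !(nqD, nqM, nq1).
  by have := nq_ge0 r; nra.
rewrite ifpF //; split; last by apply: contrapT => h'; apply: h.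
by move: h1; rewrite -!nq_le nqD nq1; lra.
Qed.

Definition nsqrt : dom M (N ⇒ N) := projT1 (cid nsqrt_ex).

Lemma nsqrtE n s : mle (s * s) n -> mlt n ((s + 1) * (s + 1)) -> nsqrt ∙ n = s.
Proof.
rewrite /nsqrt; case: (cid nsqrt_ex) => F /= /(_ n) [].
move: (F ∙ n) => r h1 h2 h3 h4; have [/nlt_nle/nq_le h|[//|/nlt_nle/nq_le h]] := nlt_total r s; exfalso.
  move/nq_le: h3; move/nq_lt: h2; move: h; rewrite !(nqD, nqM, nq1).
  by have := nq_ge0 r; nra.
move/nq_le: h1; move/nq_lt: h4; move: h; rewrite !(nqD, nqM, nq1).
by have := nq_ge0 s; nra.
Qed.

Lemma nsubDl a b : nsub ∙ (a + b) ∙ a = b.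
Proof. by apply: (ncancel (c := a)); rewrite nsubK ?(addrC b) //; apply: nle_add. Qed.

Lemma unpair_ex : exists FG : dom M (N ⇒ N) * dom M (N ⇒ N), forall a b,
  FG.1 ∙ npair a b = a /\ FG.2 ∙ npair a b = b.
Proof.
have [|F hF] := @rep_ex1 M _ _ (fun p => nsub ∙ p ∙ (nsqrt ∙ p * nsqrt ∙ p)); first by rep.
have [|G hG] := @rep_ex1 M _ _ (fun p => nsub ∙ (nsqrt ∙ p) ∙ (F ∙ p)); first by rep.
exists (F, G) => a b /=.
have E : nsqrt ∙ npair a b = a + b.
  apply: nsqrtE; first exact: nle_add.
  apply/nq_lt; rewrite !(nqD, nqM, nq1); have := nq_ge0 a; have := nq_ge0 b; lra.
by rewrite hG hF E nsubDl nsubDl.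
Qed.

Definition pr1 : dom M (N ⇒ N) := (projT1 (cid unpair_ex)).1.
Definition pr2 : dom M (N ⇒ N) := (projT1 (cid unpair_ex)).2.

Lemma pr1E a b : pr1 ∙ npair a b = a.
Proof. by rewrite /pr1; case: (cid unpair_ex) => FG /= /(_ a b) []. Qed.
Lemma pr2E a b : pr2 ∙ npair a b = b.
Proof. by rewrite /pr2; case: (cid unpair_ex) => FG /= /(_ a b) []. Qed.

Definition nrat a b c := npair (npair a b) c.
Definition nnum p := pr1 ∙ (pr1 ∙ p).
Definition nneg p := pr2 ∙ (pr1 ∙ p).
Definition nden p := pr2 ∙ p.
(** [qlt] expresses this by existential quantifiers; encoding the projections again gives an
    equivalent equation, which is decidable. Not every number is a code, as [npair] is not onto. *)
Definition code p := p = nrat (nnum p) (nneg p) (nden p).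
Definition val p : qf := (nq (nnum p) - nq (nneg p)) / (nq (nden p) + 1).

Lemma code_rat a b c : code (nrat a b c).
Proof. by rewrite /code /nnum /nneg /nden !(pr1E, pr2E). Qed.

Lemma val_rat a b c : val (nrat a b c) = (nq a - nq b) / (nq c + 1).
Proof. by rewrite /val /nnum /nneg /nden !(pr1E, pr2E). Qed.

Definition npow2 n : dom M N :=
  mrec ∙ (mpi ∙ (msigma ∙ mplus ∙ (msigma ∙ mpi ∙ mpi (t := N)))) ∙ m1 ∙ n.

Lemma npow2_0 : npow2 0 = 1. Proof. exact: rec0. Qed.
Lemma npow2_S n : npow2 (n + 1) = npow2 n + npow2 n.
Proof. by rewrite /npow2 recS piE !sigmaE piE. Qed.

Lemma npow2_gt n : mlt n (npow2 n).
Proof.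
apply: (@dec_ind M (fun n => mlt n (npow2 n))); first by rewrite /npow2; rep.
  by rewrite npow2_0; apply: nlt01.
move=> {}n /nlt_nle/nq_le h; apply/nq_lt; rewrite npow2_S !nqD.
by move: h; rewrite nqD nq1; have := nq_ge0 n; lra.
Qed.

Definition ee n : qf := (nq (npow2 n))^-1.

Lemma npow2_gt0 n : 0 < nq (npow2 n).
Proof. by apply: le_lt_trans (nq_ge0 n) _; apply/nq_lt/npow2_gt. Qed.
Lemma ee_gt0 n : 0 < ee n. Proof. by rewrite invr_gt0 npow2_gt0. Qed.
Lemma ee0 : ee 0 = 1. Proof. by rewrite /ee npow2_0 nq1 invr1. Qed.
Lemma eeS n : ee (n + 1) = ee n / 2.
Proof.
rewrite /ee npow2_S nqD; have := npow2_gt0 n; move: (nq _) => x hx.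
by field; lra.
Qed.

Lemma ee1 : ee 1 = 1 / 2.
Proof. by rewrite -[X in ee X]add0r eeS ee0. Qed.

Lemma npow2D a b : npow2 (a + b) = npow2 a * npow2 b.
Proof.
apply: (@dec_ind M (fun b => npow2 (a + b) = npow2 a * npow2 b)); first by rewrite /npow2; rep.
  by rewrite addr0 npow2_0 mulr1.
by move=> {}b h; rewrite addrA !npow2_S h; ring.
Qed.

Lemma eeD a b : ee (a + b) = ee a * ee b.
Proof. by rewrite /ee npow2D nqM invfM. Qed.

Lemma ee_le1 n : ee n <= 1.
Proof.
rewrite /ee invf_le1 ?npow2_gt0 //; have /nlt_nle/nq_le := npow2_gt n.
by rewrite nqD nq1; have := nq_ge0 n; lra.
Qed.

Lemma ee_anti a b : mle a b -> ee b <= ee a.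
Proof.
move=> /nle_ex [c ->]; rewrite eeD; have := ee_le1 c; have := ee_gt0 a.
by have := ee_gt0 c; nra.
Qed.

(** A positive fraction with denominator c + 1 is at least 1/(c + 1), and 2^(c+1) exceeds c + 1. *)
Lemma ee_small (x : qf) : 0 < x -> exists n, ee n < x.
Proof.
move=> x0; have [a [b [c E]]] := nq_ex x; exists (c + 1).
have hc : 0 < nq c + 1 by have := nq_ge0 c; lra.
have h : (nq c + 1)^-1 <= x.
  have E' : x * (nq c + 1) = nq a - nq b by rewrite E divfK ?gt_eqF.
  rewrite -[X in X <= _]mul1r ler_pdivrMr // E'.
  have : 0 < x * (nq c + 1) by rewrite mulr_gt0.
  rewrite E' subr_gt0 => /nq_lt/nlt_nle/nq_le; rewrite nqD nq1; lra.
apply: lt_le_trans h; rewrite /ee ltf_pV2 ?posrE ?npow2_gt0 //.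
by rewrite -nq1 -nqD; apply/nq_lt/npow2_gt.
Qed.

Definition qltn p u q w n :=
  [/\ code p, code q & val p + nq u * ee n < val q + nq w * ee n].

(** Multiplying by 2^n and both denominators removes all divisions; what results is the matrix of
    [qlt], and it is visibly decidable. *)
Lemma qltnE p u q w n : qltn p u q w n <->
  code p /\ code q /\
  mlt (npow2 n * (nnum p * (nden q + 1) + nneg q * (nden p + 1)) + u * ((nden p + 1) * (nden q + 1)))
      (npow2 n * (nneg p * (nden q + 1) + nnum q * (nden p + 1)) + w * ((nden p + 1) * (nden q + 1))).
Proof.
suff E : (val p + nq u * ee n < val q + nq w * ee n) <->
  mlt (npow2 n * (nnum p * (nden q + 1) + nneg q * (nden p + 1)) + u * ((nden p + 1) * (nden q + 1)))
      (npow2 n * (nneg p * (nden q + 1) + nnum q * (nden p + 1)) + w * ((nden p + 1) * (nden q + 1))).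
  by rewrite /qltn; split=> [[h1 h2 /E]|[h1 [h2 /E]]].
rewrite -nq_lt !(nqD, nqM, nq1) /val /ee; have := npow2_gt0 n.
have : 0 < nq (nden p) + 1 by have := nq_ge0 (nden p); lra.
have : 0 < nq (nden q) + 1 by have := nq_ge0 (nden q); lra.
move: (nq (nnum p)) (nq (nneg p)) (nq (nden p) + 1) (nq (nnum q)) (nq (nneg q)) (nq (nden q) + 1)
  (nq u) (nq w) (nq (npow2 n)) => a b d a' b' d' u' w' v hd' hd hv.
have hD : 0 < v * (d * d') by rewrite !mulr_gt0.
rewrite -subr_gt0 -(pmulr_lgt0 _ hD) -[in X in _ <-> X]subr_gt0.
suff -> : ((a' - b') / d' + w' / v - ((a - b) / d + u' / v)) * (v * (d * d')) =
  v * (b * d' + a' * d) + w' * (d * d') - (v * (a * d' + b' * d) + u' * (d * d')) by [].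
by field; rewrite !gt_eqF.
Qed.

Lemma dec_qltn l (p u q w n : tup M l -> dom M N) :
  rep p -> rep u -> rep q -> rep w -> rep n ->
  dec (fun r => qltn (p r) (u r) (q r) (w r) (n r)).
Proof.
move=> hp hu hq hw hn; apply: (dec_ext (fun r => iff_sym (qltnE _ _ _ _ _))).
by rewrite /code /nrat /npair /nnum /nneg /nden /npow2; rep.
Qed.

Lemma tev_wkE G D (i : Ext G D) (e : env (dom M) D) s (a : tm G s) :
  tev e (wk (e := i) a) = tev (fun _ x => e _ (i _ x)) a.
Proof. by rewrite /wk tren_tsub tev_tsub. Qed.

Lemma sat_qlt G (e : env (dom M) G) (p u q w n : tm G N) :
  sat e (qlt p u q w (pow2 n)) <-> qltn (tev e p) (tev e u) (tev e q) (tev e w) (tev e n).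
Proof.
rewrite qltnE /qlt /ex_ /=; split.
  move=> [a [b [c [a' [b' [c' ]]]]]]; rewrite !tev_wkE.
  move=> [-> [-> h]]; do 2 (split; first exact: code_rat).
  by rewrite /nnum /nneg /nden !(pr1E, pr2E).
move=> [E [E' h]]; exists (nnum (tev e p)), (nneg (tev e p)), (nden (tev e p)),
  (nnum (tev e q)), (nneg (tev e q)), (nden (tev e q)).
by rewrite !tev_wkE; split; first exact: E; split; first exact: E'.
Qed.

(** * Reals *)

Definition isR (x : dom M T1) := forall n i,
  qltn (x ∙ n) 0 (x ∙ (n + i)) 1 n /\ qltn (x ∙ (n + i)) 0 (x ∙ n) 1 n.

Definition eqR (x y : dom M T1) := forall n,
  ~ qltn (y ∙ n) (1 + 1) (x ∙ n) 0 n /\ ~ qltn (x ∙ n) (1 + 1) (y ∙ n) 0 n.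

Definition ltR (x y : dom M T1) := exists n, qltn (x ∙ n) (1 + 1) (y ∙ n) 0 n.

Definition posR (x : dom M T1) := ltR (mpi ∙ nrat 0 0 0) x.

#[local] Opaque qlt pow2 wk.

Lemma sat_isReal G (e : env (dom M) G) x : sat e (isReal x) <-> isR (tev e x).
Proof.
rewrite /isReal /all_ /=; split=> h n i; have := h n i;
by rewrite !sat_qlt /= !tev_wkE.
Qed.

Lemma sat_req G (e : env (dom M) G) (x y : tm G T1) : sat e (req x y) <-> eqR (tev e x) (tev e y).
Proof.
rewrite /req /all_ /=; split=> h n; have := h n;
by rewrite !sat_qlt /= !tev_wkE.
Qed.

Lemma sat_rlt G (e : env (dom M) G) (x y : tm G T1) : sat e (rlt x y) <-> ltR (tev e x) (tev e y).
Proof.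
rewrite /rlt /ex_ /=; split=> -[n h]; exists n; move: h;
by rewrite !sat_qlt /= !tev_wkE.
Qed.

Definition app_ (x : dom M T1) n := val (x ∙ n).

Lemma isRE x : isR x <-> (forall n, code (x ∙ n)) /\
  forall n i, `|app_ x (n + i) - app_ x n| < ee n.
Proof.
rewrite /isR /app_; split=> [h|[hc h] n i].
  split=> [n|n i]; first by have [[]] := h n 0.
  have [[_ _ h1] [_ _ h2]] := h n i; move: h1 h2; rewrite nq0 nq1.
  by rewrite ltr_norml; lra.
have := h n i; rewrite ltr_norml => h'.
by split; split=> //; rewrite nq0 nq1; lra.
Qed.

Lemma isR_code x n : isR x -> code (x ∙ n). Proof. by move/isRE => []. Qed.

Lemma isR_dist x m n : isR x -> mle n m -> `|app_ x m - app_ x n| < ee n.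
Proof. by move=> /isRE [_ h] /nle_ex [i ->]. Qed.

Lemma eqRE x y : isR x -> isR y ->
  eqR x y <-> forall n, `|app_ x n - app_ y n| <= 2 * ee n.
Proof.
move=> hx hy; split=> h n.
  have [h1 h2] := h n; rewrite ler_norml; apply/andP; split.
    rewrite leNgt; apply/negP => h3; apply: h2; split; try exact: isR_code.
    by rewrite nqD nq1 nq0; rewrite /app_ in h3; lra.
  rewrite leNgt; apply/negP => h3; apply: h1; split; try exact: isR_code.
  by rewrite nqD nq1 nq0; rewrite /app_ in h3; lra.
have := h n; rewrite ler_norml /app_ => h'.
by split=> -[_ _]; rewrite nqD nq1 nq0; lra.
Qed.

Lemma ltRE x y : isR x -> isR y -> ltR x y <-> exists n, app_ x n + 2 * ee n < app_ y n.
Proof.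
move=> hx hy; split=> -[n].
  by move=> [_ _]; rewrite nqD nq1 nq0 => h; exists n; rewrite /app_; lra.
move=> h; exists n; split; try exact: isR_code.
by rewrite nqD nq1 nq0; rewrite /app_ in h; lra.
Qed.

Lemma le_ee_small (x y k : qf) : (forall n, x <= y + k * ee n) -> 0 <= k -> x <= y.
Proof.
move=> h k0; rewrite leNgt; apply/negP => xy.
have k1 : 0 < k + 1 by lra.
have [n hn] := ee_small (x := (x - y) / (k + 1)) (ltac:(by rewrite divr_gt0 // subr_gt0)).
move: hn; rewrite ltr_pdivlMr // => hn; have := h n; have := ee_gt0 n; lra.
Qed.

Lemma nle_maxl a b : exists c, mle a c /\ mle b c.
Proof. by exists (a + b); split; [|rewrite addrC]; apply: nle_add. Qed.

Lemma nle_trans a b c : mle a b -> mle b c -> mle a c.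
Proof. by rewrite -!nq_le; apply: le_trans. Qed.

(** Each sequence moves by less than 2^-n after the index n, so a comparison at a late index yields
    2 * 2^-n plus an error that can be made arbitrarily small, whatever the constant [k]. *)
Lemma eqR_far x y k : isR x -> isR y -> 0 <= k ->
  (forall n, exists2 m, mle n m & `|app_ x m - app_ y m| <= k * ee n) -> eqR x y.
Proof.
move=> hx hy k0 h; apply/(eqRE hx hy) => n; apply: (le_ee_small (k := k)) => // j.
have [c [nc jc]] := nle_maxl n j; have [m cm hm] := h c.
have := isR_dist hx (nle_trans nc cm); have := isR_dist hy (nle_trans nc cm).
have : k * ee c <= k * ee j by rewrite ler_wpM2l // ee_anti.
move: hm; rewrite !ler_norml !ltr_norml; lra.
Qed.

Lemma eqR_refl x : isR x -> eqR x x.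
Proof.
move=> hx; apply/eqRE => // n; rewrite subrr normr0 mulr_ge0 //.
by rewrite ltW // ee_gt0.
Qed.

Lemma eqR_sym x y : eqR x y -> eqR y x.
Proof. by move=> h n; have [] := h n. Qed.

Lemma eqR_trans x y z : isR x -> isR y -> isR z -> eqR x y -> eqR y z -> eqR x z.
Proof.
move=> hx hy hz /(eqRE hx hy) h1 /(eqRE hy hz) h2.
apply: (eqR_far (k := 4)) => // n; exists n; first exact: nlt_irr.
by have := h1 n; have := h2 n; rewrite !ler_norml; lra.
Qed.

Lemma ltR_eqR x y z : isR x -> isR y -> isR z -> ltR x y -> eqR y z -> ltR x z.
Proof.
move=> hx hy hz /(ltRE hx hy) [n hn] /(eqRE hy hz) h.
(* The numerator is the gap that survives once both approximations have moved by 2^-n. It must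
   absorb 2 * 2^-m for the equality and 2 * 2^-m for the strict inequality, hence the 4. *)
have [m0 hm0] := ee_small (x := (app_ y n - app_ x n - 2 * ee n) / 4) (ltac:(lra)).
have [m [nm mm]] := nle_maxl n m0; apply/(ltRE hx hz); exists m.
have := isR_dist hx nm; have := isR_dist hy nm; have := h m; have := ee_anti mm.
by rewrite !ler_norml !ltr_norml; lra.
Qed.

Lemma isR_const a b c : isR (mpi ∙ nrat a b c).
Proof.
apply/isRE; split=> [n|n i]; first by rewrite piE; apply: code_rat.
by rewrite /app_ !piE subrr normr0 ee_gt0.
Qed.

Lemma app_const a b c n : app_ (mpi ∙ nrat a b c) n = (nq a - nq b) / (nq c + 1).
Proof. by rewrite /app_ piE val_rat. Qed.

Lemma posR_eqR x y : isR x -> isR y -> posR x -> eqR x y -> posR y.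
Proof. by move=> hx hy; apply: ltR_eqR => //; apply: isR_const. Qed.

Lemma posRE x : isR x -> posR x <-> exists n, 2 * ee n < app_ x n.
Proof.
move=> hx; rewrite /posR ltRE //; last exact: isR_const.
by split=> -[n h]; exists n; move: h; rewrite app_const !nq0; rewrite subrr mul0r add0r.
Qed.

Lemma posR_one : posR (mpi ∙ nrat 1 0 0).
Proof.
apply/posRE; first exact: isR_const.
by exists (1 + 1); rewrite app_const nq0 nq1 eeS ee1 subr0 add0r divr1; lra.
Qed.

Lemma posR_zero : ~ posR (mpi ∙ nrat 0 0 0).
Proof.
move/posRE => h; have [n] := h (isR_const _ _ _).
by rewrite app_const !nq0; have := ee_gt0 n; lra.
Qed.
End Codes.

Section Lin.
Variable M : rmodel.
Implicit Types a b c n p q : dom M N.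

Lemma den_gt0 n : 0 < nq n + 1 :> qf M.
Proof. by have := nq_ge0 n; lra. Qed.

(* A code of (p m + i - j) / (d + 1). *)
Definition lin p m i j d :=
  nrat (nnum p * m + i * (nden p + 1)) (nneg p * m + j * (nden p + 1)) (nden p * d + nden p + d).

Lemma code_lin p m i j d : code (lin p m i j d). Proof. exact: code_rat. Qed.

Lemma val_lin p m i j d : val (lin p m i j d) = (val p * nq m + nq i - nq j) / (nq d + 1).
Proof.
rewrite val_rat /val !(nqD, nqM, nq1).
have -> : nq (nden p) * nq d + nq (nden p) + nq d + 1 = (nq (nden p) + 1) * (nq d + 1) by ring.
have := den_gt0 d; have := den_gt0 (nden p).
move: (nq (nden p) + 1) (nq d + 1) => x y hx hy.
by field; rewrite !gt_eqF.
Qed.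

Lemma npredK n : n <> 0 -> npred ∙ n + 1 = n.
Proof. by have [//|[k ->]] := ncase n; rewrite npredS. Qed.

Lemma npow2_neq0 n : npow2 n <> 0.
Proof. by move=> E; have := npow2_gt0 n; rewrite E nq0 ltxx. Qed.

Lemma nle0 n : mle 0 n. Proof. exact: nlt0. Qed.

End Lin.

(** * Kleene's functional E2 from a countable set *)

Definition hasE2 (M : rmodel) :=
  exists phi : dom M (T1 ⇒ N), forall f, phi ∙ f = 0 <-> forall n, f ∙ n = 0.

Lemma dec_all (M : rmodel) (hE : hasE2 M) l (P : tup M l -> dom M N -> Prop) :
  dec (fun r : tup M (N :: l) => P r.2 r.1) -> dec (fun r => forall n, P r n).
Proof.
have [phi hphi] := hE; move=> [c [F hF] E].
exists (fun r => phi ∙ aps (l := l) (t := N ⇒ N) F r).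
  by apply: rep_app; [exact: rep_const | exists F].
move=> r; rewrite hphi; split=> h n; first by move: (hF (n, r)) => /= ->; apply/(E (n, r))/h.
by apply/(E (n, r)); rewrite -hF; apply: h.
Qed.

Lemma dec_ex (M : rmodel) (hE : hasE2 M) l (P : tup M l -> dom M N -> Prop) :
  dec (fun r : tup M (N :: l) => P r.2 r.1) -> dec (fun r => exists n, P r n).
Proof.
move=> h; apply: (dec_ext (P := fun r => ~ forall n, ~ P r n)).
  by move=> r; split=> [/existsNP [n /contrapT]|[n hn] /(_ n)] //; exists n.
exact/dec_not/dec_all/dec_not.
Qed.

Section FromSet.
Variable M : rmodel.
Variables (A : dom M (T1 ⇒ T1)) (Y : dom M (T1 ⇒ N)) (a : dom M T1).
Hypothesis A_real : forall x, isR x -> isR (A ∙ x).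
Hypothesis A_ext : forall x y, isR x -> isR y -> eqR x y -> eqR (A ∙ x) (A ∙ y).
Hypothesis Y_inj : forall x y, isR x -> isR y -> posR (A ∙ x) -> posR (A ∙ y) ->
  Y ∙ x = Y ∙ y -> eqR x y.
Hypothesis Y_ext : forall x y, isR x -> isR y -> posR (A ∙ x) -> posR (A ∙ y) ->
  eqR x y -> Y ∙ x = Y ∙ y.
Hypothesis (a_real : isR a) (a_in : posR (A ∙ a)).

(* Equality with the fixed element [a] is decidable: a rough approximation of
   [A z] either shows that [A z] differs from [A a] or that [z] is in [A], and
   in the second case [Y] decides. *)
Lemma eq_elt_dec : exists2 P : dom M T1 -> Prop, dec (fun r : tup M [T1] => P r.1) &
  forall z, isR z -> P z <-> eqR z a.
Proof.
have [n0 hn0] := (posRE (A_real a_real)).1 a_in.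
(* Here 2^-n0 = 4 * 2^-m. If z equals a, then A z at m exceeds 2 * 2^-n0 - 2^-n0 - 2 * 2^-m = 2 *
   2^-m, which is positivity witnessed at m; so testing this one index loses no such z. *)
set m := n0 + 1 + 1.
have em : ee n0 = 4 * ee m by rewrite /m !eeS; field.
exists (fun z => Y ∙ z = Y ∙ a /\ qltn (nrat 0 0 0) (1 + 1) (A ∙ z ∙ m) 0 m).
  by apply: dec_and; [rep | apply: dec_qltn; rep].
move=> z hz; split=> [[E h]|E].
  by apply: Y_inj => //; exists m; rewrite piE.
have hA := A_ext hz a_real E.
have zin : posR (A ∙ z) by apply: posR_eqR a_in (eqR_sym hA); apply: A_real.
split; first exact: Y_ext.
split; [exact: code_rat | exact/isR_code/A_real |].
have := (eqRE (A_real hz) (A_real a_real)).1 hA m.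
have := isR_dist (A_real a_real) (n := n0) (m := m) (ltac:(by rewrite /m -addrA; apply: nle_add)).
rewrite val_rat nqD nq1 !nq0 /app_ ltr_norml ler_norml; move: hn0; rewrite /app_.
rewrite subrr mul0r; lra.
Qed.

(** The real [r ∙ f] equals [a] exactly when [f] vanishes everywhere, and [eq_elt_dec] decides that
    equality by a number-valued functional of the model. *)
Lemma E2_of_set : hasE2 M.
Proof.
have [P dP hP] := eq_elt_dec.
(* The value at k is 0 while [f] vanishes below k, and then freezes at the successor of the first
   nonzero place; the successor keeps 0 free as a marker. *)
have [||S [rS S0 SS]] := @rep_rec M [T1] (fun _ => 0)
  (fun r k s => ifp (s = 0) (ifp (r.1 ∙ k = 0) 0 (k + 1)) s); try by rep.
pose s f k := S (f, tt) k.
have s0 f : s f 0 = 0 by apply: S0.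
have sS f k : s f (k + 1) = ifp (s f k = 0) (ifp (f ∙ k = 0) 0 (k + 1)) (s f k) by apply: SS.
have sr f : rep (fun r : tup M [N] => s f r.1).
  by case: rS => F hF; exists (F ∙ f) => -[x []]; apply: (hF (x, (f, tt))).
have s_stay f k i : s f k <> 0 -> s f (k + i) = s f k.
  move=> h; apply: (@dec_ind M (fun i => s f (k + i) = s f k)); last 2 first.
  - by rewrite addr0.
  - by move=> {}i E; rewrite addrA sS E ifpF.
  apply: dec_eq; last exact: rep_const.
  have [F hF] := rep_ex1 (sr f).
  have -> : (fun r : tup M [N] => s f (k + r.1)) = (fun r => F ∙ (k + r.1)).
    by apply: funext => r; rewrite hF.
  by rep.
have [F hF] : exists F : dom M (T1 ⇒ N ⇒ N), forall f k, F ∙ f ∙ k = s f k.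
  by apply: rep_ex2; case: rS => F hF; exists F => -[x [f []]]; apply: (hF (x, (f, tt))).
have s_late f k i : s f k = 0 -> s f (k + i) = 0 \/ mlt k (s f (k + i)).
  move=> h; rewrite -!hF; apply: (@dec_ind M (fun i => F ∙ f ∙ (k + i) = 0 \/ mlt k (F ∙ f ∙ (k + i)))).
  - by rep.
  - by left; rewrite addr0 hF.
  move=> {}i; rewrite !hF addrA sS; have [->|h'] := pselect (s f (k + i) = 0).
    rewrite ifpT // => _; have [E|E] := pselect (f ∙ (k + i) = 0); first by left; rewrite ifpT.
    by right; rewrite ifpF //; apply: nlt_addS.
  by rewrite ifpF.
have s_zero f k : (forall n, f ∙ n = 0) -> s f k = 0.
  move=> h; rewrite -hF; apply: (@dec_ind M (fun k => F ∙ f ∙ k = 0)); first by rep.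
    by rewrite hF.
  by move=> {}k; rewrite !hF sS => ->; rewrite !ifpT.
have s_found f n : f ∙ n <> 0 -> s f (n + 1) <> 0.
  move=> h; rewrite sS; have [->|h'] := pselect (s f n = 0); last by rewrite ifpF.
  by rewrite ifpT // ifpF //; apply: nsucc_neq0.
(* After the jump, with frozen value t, the real stays at a_(t+2) + 2^-t. At an index k before the
   jump t > k, so the total change is below 2^-(k+2) + 2^-(k+1) < 2^-k and the sequence still
   converges fast. *)
pose q k := lin (a ∙ (k + 1 + 1)) (npow2 k) 1 0 (npred ∙ npow2 k).
have val_q k : val (q k) = app_ a (k + 1 + 1) + ee k.
  rewrite val_lin nq0 nq1 -nq1 -nqD npredK; last exact: npow2_neq0.
  by rewrite nq1 subr0 mulrDl mulfK ?gt_eqF ?npow2_gt0 // mul1r.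
have [r hr] : exists r : dom M (T1 ⇒ T1), forall f k,
    r ∙ f ∙ k = ifp (F ∙ f ∙ k = 0) (a ∙ (k + 1 + 1)) (q (F ∙ f ∙ k)).
  by apply: rep_ex2; rewrite /q /lin /nrat /npair /nnum /nneg /nden /npow2; rep.
have r0 f k : s f k = 0 -> app_ (r ∙ f) k = app_ a (k + 1 + 1).
  by move=> h; rewrite /app_ hr hF h ifpT.
have r1 f k : s f k <> 0 -> app_ (r ∙ f) k = app_ a (s f k + 1 + 1) + ee (s f k).
  by move=> h; rewrite /app_ hr hF ifpF // val_q.
have r_real f : isR (r ∙ f).
  apply/isRE; split=> [k|k i].
    rewrite hr; have [->|h] := pselect (F ∙ f ∙ k = 0).
      by rewrite ifpT //; apply: isR_code.
    by rewrite ifpF //; apply: code_lin.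
  have ek := ee_gt0 k.
  have [h|h] := pselect (s f k = 0); last first.
    by rewrite !r1 ?s_stay // subrr normr0.
  have [h'|h'] := s_late f k i h.
    rewrite !r0 //; have := isR_dist a_real (n := k + 1 + 1) (m := k + i + 1 + 1).
    rewrite !eeS => /(_ _)/lt_trans; apply; last by lra.
    by have := @nle_add M (k + 1 + 1) i; rewrite -!addrA [i + _]addrC !addrA.
  rewrite (r0 _ k) // r1; last by move=> E; move: h'; rewrite E => /nlt0.
  move: (s f (k + i)) h' => t /nlt_ex [j ->] {h}.
  have := isR_dist a_real (n := k + 1 + 1) (m := k + j + 1 + 1 + 1).
  have h1 : mle (k + 1 + 1) (k + j + 1 + 1 + 1).
    by have := @nle_add M (k + 1 + 1) (j + 1); rewrite -!addrA ![j + _]addrC -!addrA.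
  move/(_ h1); have := ee_anti (@nle_add M k j); have := ee_gt0 (k + j).
  by rewrite !eeS !ltr_norml; lra.
have [phi hphi] : exists phi : dom M (T1 ⇒ N), forall f, phi ∙ f = ifp (P (r ∙ f)) 0 1.
  apply: rep_ex1; apply: rep_ifp; try exact: rep_const.
  case: dP => c [G hG] E; exists (fun x => G ∙ (r ∙ x.1)); first by rep.
  by move=> x; rewrite (E (r ∙ x.1, tt)) -hG.
exists phi => f; rewrite hphi; split=> [h n|h].
  have {}h : eqR (r ∙ f) a.
    apply/(hP _ (r_real f)); apply: contrapT => h'; move: h; rewrite ifpF // => /eqP.
    by rewrite oner_eq0.
  apply: contrapT => /s_found; move: (n + 1) => k hk.
  set t := s f k in hk *.
  (* At an index of at least t + 2 the sequence [a] is within 2^-(t+2) of a_(t+2), and equality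
     tolerates at most 2^-(t+1); together these stay below the jump 2^-t. *)
  have := (eqRE (r_real f) a_real).1 h (k + (t + 1 + 1)).
  rewrite r1 ?s_stay // -/t.
  have := isR_dist a_real (n := t + 1 + 1) (m := k + (t + 1 + 1)).
  have h1 : mle (t + 1 + 1) (k + (t + 1 + 1)) by rewrite [X in mle _ X]addrC; apply: nle_add.
  have := ee_gt0 t; move/ee_anti: (h1) => h2 h3 /(_ h1).
  by move: h2 h3; rewrite !eeS ltr_norml ler_norml; lra.
rewrite ifpT //; apply/hP => //; apply: (eqR_far (k := 1)) => // n.
exists n; first exact: nlt_irr.
rewrite r0; last exact: s_zero.
by rewrite mul1r ltW //; apply: isR_dist => //; rewrite -addrA; apply: nle_add.
Qed.
End FromSet.

(** * Decidability and choice in the presence of E2 *)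

Section Toolkit.
Variable M : rmodel.
Hypothesis hE : hasE2 M.

Lemma dec_isR l (x : tup M l -> dom M T1) : rep x -> dec (fun r => isR (x r)).
Proof.
move=> hx; have h := @rep_weak _ N _ _ _ (@rep_weak _ N _ _ _ hx).
do 2 apply: (dec_all hE); apply: dec_and; apply: dec_qltn; rep.
Qed.

Lemma dec_eqR l (x y : tup M l -> dom M T1) : rep x -> rep y -> dec (fun r => eqR (x r) (y r)).
Proof.
move=> hx hy; have h := @rep_weak _ N _ _ _ hx; have h' := @rep_weak _ N _ _ _ hy.
by apply: (dec_all hE); apply: dec_and; apply: dec_not; apply: dec_qltn; rep.
Qed.

Lemma dec_ltR l (x y : tup M l -> dom M T1) : rep x -> rep y -> dec (fun r => ltR (x r) (y r)).
Proof.
move=> hx hy; have h := @rep_weak _ N _ _ _ hx; have h' := @rep_weak _ N _ _ _ hy.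
by apply: (dec_ex hE); apply: dec_qltn; rep.
Qed.

Lemma dec_posR l (x : tup M l -> dom M T1) : rep x -> dec (fun r => posR (x r)).
Proof. by move=> hx; apply: dec_ltR => //; apply: rep_const. Qed.

Lemma choice_NN (P : dom M N -> dom M N -> dom M N -> Prop) :
  dec (fun r : tup M [N; N; N] => P r.2.2.1 r.2.1 r.1) -> (forall a b, exists n, P a b n) ->
  exists F : dom M (N ⇒ N ⇒ N), forall a b, P a b (F ∙ a ∙ b).
Proof.
move=> dP h.
have [||F hF] := @choice_N M (fun p n => P (pr1 M ∙ p) (pr2 M ∙ p) n); last 2 first.
- by move=> p; apply: h.
- have [|G hG] := @rep_ex2 M _ _ _ (fun a b => F ∙ npair a b); first by rewrite /npair; rep.
  by exists G => a b; rewrite hG; have := hF (npair a b); rewrite pr1E pr2E.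
case: dP => c [G hG] E.
exists (fun r => G ∙ (pr1 M ∙ r.2.1) ∙ (pr2 M ∙ r.2.1) ∙ r.1); first by rep.
by move=> r; rewrite (E (r.1, (pr2 M ∙ r.2.1, (pr1 M ∙ r.2.1, tt)))) -hG.
Qed.
End Toolkit.

Ltac repE hE := repeat first
  [ apply: dec_qltn | apply: (dec_isR hE) | apply: (dec_eqR hE) | apply: (dec_ltR hE)
  | apply: (dec_posR hE) | rep1 | apply: (dec_all hE) | apply: (dec_ex hE) ].

(** If there were no least element, induction on m would show that nothing below m satisfies [P];
    this bounded universal statement is decidable by E2. *)
Lemma least (M : rmodel) (hE : hasE2 M) (P : dom M N -> Prop) :
  dec (fun r : tup M [N] => P r.1) -> (exists n, P n) ->
  exists n, P n /\ forall k, mlt k n -> ~ P k.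
Proof.
move=> dP [n hn]; apply: contrapT => /forallNP h.
suff /(_ (n + 1) n (nlt_succ n)) : forall m k, mlt k m -> ~ P k by [].
apply: dec_ind; [|by move=> k /nlt0|].
  case: dP => c [F hF] E.
  have {}E k : P k <-> F ∙ k = 0 by rewrite (E (k, tt)) -hF.
  apply: (dec_ext (P := fun r : tup M [N] => forall k, mlt k r.1 -> ~ F ∙ k = 0)); last by repE hE.
  by move=> r; split=> h' k /h'; rewrite E.
by move=> m IH k /nltS [|->]; [apply: IH | move=> hm; apply: (h m)].
Qed.

(** * The principles read in a model *)

Section Semantics.
Variable M : rmodel.
Implicit Types (A : dom M (T1 ⇒ T1)) (Y : dom M (T1 ⇒ N)).

(** This and the following definitions copy the nesting of quantifiers in the formulas, so that once
    the atoms are rewritten the two readings are convertible. *)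
Definition setR A := (forall x, isR x -> isR (A ∙ x)) /\
  (forall x, isR x -> forall y, isR y -> eqR x y -> eqR (A ∙ x) (A ∙ y)).
Definition funRN Y := forall x, isR x -> forall y, isR y -> eqR x y -> Y ∙ x = Y ∙ y.
Definition injOnR Y A := forall x, isR x -> forall y, isR y ->
  posR (A ∙ x) -> posR (A ∙ y) -> Y ∙ x = Y ∙ y -> eqR x y.
Definition extOnR Y A := forall x, isR x -> forall y, isR y ->
  posR (A ∙ x) -> posR (A ∙ y) -> eqR x y -> Y ∙ x = Y ∙ y.
Definition countableR A := exists Y, funRN Y /\ injOnR Y A.
Definition strongR A := exists Y, funRN Y /\ injOnR Y A /\
  forall n, exists x, isR x /\ posR (A ∙ x) /\ Y ∙ x = n.
Definition nonemptyR A := exists x, isR x /\ posR (A ∙ x).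
Definition sub01R A := forall x, isR x -> posR (A ∙ x) ->
  ~ ltR x (mpi ∙ nrat 0 0 0) /\ ~ ltR (mpi ∙ nrat 1 0 0) x.
Definition enumR A := exists x : dom M (N ⇒ T1),
  (forall n, isR (x ∙ n) /\ posR (A ∙ (x ∙ n))) /\
  forall y, isR y -> (posR (A ∙ y) <-> exists n, eqR (x ∙ n) y).
Definition cocode0R := forall A, setR A -> sub01R A -> nonemptyR A -> countableR A -> enumR A.
Definition cocode1R := forall A, setR A -> sub01R A -> nonemptyR A -> strongR A -> enumR A.
Definition CBNR := forall A, setR A -> countableR A ->
  (exists x : dom M (N ⇒ T1), (forall n, isR (x ∙ n) /\ posR (A ∙ (x ∙ n))) /\
     forall n m, n <> m -> ~ eqR (x ∙ n) (x ∙ m)) -> strongR A.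
Definition relR (R : dom M (T1 ⇒ T1 ⇒ T1)) :=
  (forall x, isR x -> forall y, isR y -> isR (R ∙ x ∙ y)) /\
  (forall x, isR x -> forall x', isR x' -> forall y, isR y -> forall y', isR y' ->
     eqR x x' -> eqR y y' -> eqR (R ∙ x ∙ y) (R ∙ x' ∙ y')).
Definition fin_injR Y A k := extOnR Y A /\
  (forall x, isR x -> posR (A ∙ x) -> mlt (Y ∙ x) (k + 1)) /\ injOnR Y A.
Definition Korg2R := forall (E : dom M (N ⇒ T1 ⇒ T1)) (R : dom M (T1 ⇒ T1 ⇒ T1)),
  (forall n, setR (E ∙ n)) /\
  (exists (k : dom M (N ⇒ N)) (Y : dom M (N ⇒ T1 ⇒ N)),
     forall n, fin_injR (Y ∙ n) (E ∙ n) (k ∙ n)) ->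
  (forall n, nonemptyR (E ∙ n)) -> relR R ->
  (forall n x, isR x -> posR (E ∙ (n + 1) ∙ x) ->
     exists y, isR y /\ posR (E ∙ n ∙ y) /\ posR (R ∙ y ∙ x)) ->
  exists x : dom M (N ⇒ T1), forall n,
    isR (x ∙ n) /\ posR (E ∙ n ∙ (x ∙ n)) /\ posR (R ∙ (x ∙ n) ∙ (x ∙ (n + 1))).

Ltac sat_unfold :=
  unfold Korg2, cocode0, cocode1, CBN, seq_of_finite_sets, fin_inj, sub01, nonempty,
    countable, strongly_countable, enumerated, isSet, isRel, rel, injOn, isFunRR, isFunRN,
    mem, rle, all_, ex_, Not, Iff; cbn [sat];
  repeat setoid_rewrite sat_isReal; repeat setoid_rewrite sat_req; repeat setoid_rewrite sat_rlt.

#[local] Opaque isReal req rlt.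

Lemma sat_cocode0 (e : env (dom M) []) : sat e cocode0 <-> cocode0R.
Proof. sat_unfold. exact: iff_refl. Qed.

Lemma sat_cocode1 (e : env (dom M) []) : sat e cocode1 <-> cocode1R.
Proof. sat_unfold. exact: iff_refl. Qed.

Lemma sat_CBN (e : env (dom M) []) : sat e CBN <-> CBNR.
Proof. sat_unfold. exact: iff_refl. Qed.

Lemma sat_Korg2 (e : env (dom M) []) : sat e Korg2 <-> Korg2R.
Proof. sat_unfold. exact: iff_refl. Qed.
End Semantics.

(** * Coding a sequence of countable sets by one countable subset of [0,1] *)

Section Compare.
Variable M : rmodel.

(** The real 2^-n, an endpoint of the intervals that carry the codes. *)
Definition rconst (n : dom M N) : dom M T1 := mpi ∙ nrat 1 0 (npred ∙ npow2 n).

Lemma rconst_real n : isR (rconst n). Proof. exact: isR_const. Qed.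

Lemma app_rconst n k : app_ (rconst n) k = ee n.
Proof.
rewrite app_const nq0 -(nq1 M) -nqD npredK; last exact: npow2_neq0.
by rewrite nq1 subr0 /ee mul1r.
Qed.

Lemma eqR_ltR (x y z : dom M T1) : isR x -> isR y -> isR z -> eqR x y -> ltR x z -> ltR y z.
Proof.
move=> hx hy hz /(eqRE hx hy) h /(ltRE hx hz) [n hn].
have [m0 hm0] := ee_small (x := (app_ z n - app_ x n - 2 * ee n) / 4) (ltac:(lra)).
have [m [nm mm]] := nle_maxl n m0; apply/(ltRE hy hz); exists m.
have := isR_dist hx nm; have := isR_dist hz nm; have := h m; have := ee_anti mm.
by rewrite !ler_norml !ltr_norml; lra.
Qed.

Lemma ltR_between (x y z : dom M T1) c d : isR x -> isR y -> isR z ->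
  (forall k, app_ x k = c) -> (forall k, app_ y k = d) -> ltR x z -> ltR z y -> c < d.
Proof.
move=> hx hy hz ex ey /(ltRE hx hz) [n hn] /(ltRE hz hy) [m hm].
move: hn hm; rewrite ex ey => hn hm; have := ee_gt0 n; have := ee_gt0 m.
have [h|h] := pselect (mlt n m).
  by have := isR_dist hz (nlt_le h); rewrite ltr_norml; lra.
by have := isR_dist hz h; rewrite ltr_norml; lra.
Qed.
End Compare.

Section Coding.
Variable M : rmodel.
Hypothesis hE : hasE2 M.
Implicit Types (J n k : dom M N) (x z : dom M T1).

(* Reals in ]2^-(J+1), 2^-J[ with [J = npair n (s - 1)] code the pairs of [n] and
   a real in ]-s, s[, by the affine map [z |-> s (2^(J+2) z - 3)]; the index is
   shifted to keep the speed of convergence. *)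
Definition scale J := pr2 M ∙ J + 1.
Definition factor J := scale J * npow2 (J + 1 + 1).
Definition delay J := scale J + (J + 1 + 1).
Definition within J z := ltR (rconst (J + 1)) z /\ ltR z (rconst J).

Lemma factor_ge1 J : 1 <= nq (factor J).
Proof.
rewrite /factor nqM /scale nqD nq1; have := nq_ge0 (pr2 M ∙ J).
have /nlt_nle/nq_le := npow2_gt (J + 1 + 1).
have := nq_ge0 J; rewrite !nqD !nq1; nra.
Qed.

(** This inequality dictates [delay]: the affine map stretches errors by scale J * 2^(J+2), and
    scale J is at most 2^(scale J). *)
Lemma factor_delay J : ee (delay J) * nq (factor J) <= 1.
Proof.
rewrite /delay eeD /factor nqM /ee.
have h1 := npow2_gt0 (scale J); have h2 := npow2_gt0 (J + 1 + 1).
have h3 : nq (scale J) <= nq (npow2 (scale J)) by rewrite ltW //; apply/nq_lt/npow2_gt.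
rewrite mulrACA mulVf ?gt_eqF // mulr1 mulrC ler_pdivrMr //.
by rewrite mul1r.
Qed.

Lemma decode_ex : exists D : dom M (N ⇒ T1 ⇒ T1), forall J z k,
  D ∙ J ∙ z ∙ k = lin (z ∙ (k + delay J)) (factor J) 0 ((1 + 1 + 1) * scale J) 0.
Proof.
apply: rep_ex3; rewrite /lin /factor /delay /scale /nrat /npair /nnum /nneg /nden /npow2.
by rep.
Qed.

Definition decode := projT1 (cid decode_ex).

Lemma app_decode J z k :
  app_ (decode ∙ J ∙ z) k = app_ z (k + delay J) * nq (factor J) - 3 * nq (scale J).
Proof.
rewrite /app_ /decode; case: (cid decode_ex) => D /= ->.
by rewrite val_lin nqM !nqD nq0 nq1 addr0 add0r divr1; congr (_ - _ * _); ring.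
Qed.

Lemma decode_real J z : isR z -> isR (decode ∙ J ∙ z).
Proof.
move=> hz; apply/isRE; split=> [k|k i].
  by rewrite /decode; case: (cid decode_ex) => D /= ->; apply: code_lin.
rewrite !app_decode.
have h : mle (k + delay J) (k + i + delay J).
  by rewrite -addrA (addrC i) addrA; apply: nle_add.
have := isR_dist hz h; have := factor_ge1 J; have := factor_delay J; have := ee_gt0 k.
rewrite eeD; set m := nq (factor J); set e := ee (delay J).
set u := app_ z (k + i + delay J); set v := app_ z (k + delay J) => hk h1 h2 h3.
have -> : u * m - 3 * nq (scale J) - (v * m - 3 * nq (scale J)) = (u - v) * m by ring.
rewrite normrM (ger0_norm (x := m)); last by lra.
have : `|u - v| * m < ee k * e * m by rewrite ltr_pM2r //; lra.
move/lt_le_trans; apply; rewrite -mulrA -[leRHS]mulr1 ler_wpM2l //; lra.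
Qed.

Lemma decode_ext J z z' : isR z -> isR z' -> eqR z z' -> eqR (decode ∙ J ∙ z) (decode ∙ J ∙ z').
Proof.
move=> hz hz' /(eqRE hz hz') h.
apply/eqRE; try exact: decode_real; move=> k; rewrite !app_decode.
have := h (k + delay J); have := factor_ge1 J; have := factor_delay J; have := ee_gt0 k.
rewrite eeD; set m := nq (factor J); set e := ee (delay J).
set u := app_ z _; set v := app_ z' _ => hk h1 h2 h3.
have -> : u * m - 3 * nq (scale J) - (v * m - 3 * nq (scale J)) = (u - v) * m by ring.
rewrite normrM (ger0_norm (x := m)); last by lra.
have : `|u - v| * m <= 2 * (ee k * e) * m by rewrite ler_pM2r //; lra.
move/le_trans; apply; rewrite -!mulrA ler_pM2l // -[leRHS]mulr1 ler_wpM2l //; lra.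
Qed.

(** The affine map does not shrink distances, so the bound on the images at k bounds the preimages
    at the later index k + delay J. *)
Lemma decode_inj J z z' : isR z -> isR z' -> eqR (decode ∙ J ∙ z) (decode ∙ J ∙ z') -> eqR z z'.
Proof.
move=> hz hz' /eqRE h; have {}h := h (decode_real _ hz) (decode_real _ hz').
apply: (eqR_far (k := 2)) => // k; exists (k + delay J); first exact: nle_add.
have := h k; rewrite !app_decode; have := factor_ge1 J.
set m := nq (factor J); set u := app_ z _; set v := app_ z' _ => h1.
have -> : u * m - 3 * nq (scale J) - (v * m - 3 * nq (scale J)) = (u - v) * m by ring.
rewrite normrM (ger0_norm (x := m)); last by lra.
apply: le_trans; rewrite ler_peMr //; exact: normr_ge0.
Qed.

Lemma nq_scale J : nq (scale J) = nq (factor J) * ee (J + 1 + 1).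
Proof. by rewrite /factor nqM /ee mulfK // gt_eqF // npow2_gt0. Qed.

Lemma encode x n : isR x -> exists J z,
  [/\ pr1 M ∙ J = n, isR z, within J z & eqR (decode ∙ J ∙ z) x].
Proof.
(* |x_0| is at most the sum of the two parts of its numerator, and x moves by less than 1 from
   there. Since scale J is s + 1, it exceeds every |x_k| by at least 1. *)
move=> hx; set s := nnum (x ∙ 0) + nneg (x ∙ 0) + 1.
exists (npair n s); set J := npair n s.
have [z hz] : exists z : dom M T1, forall k,
    z ∙ k = lin (x ∙ k) 1 ((1 + 1 + 1) * scale J) 0 (npred ∙ factor J).
  by apply: rep_ex1; rewrite /lin /factor /scale /nrat /npair /nnum /nneg /nden /npow2; rep.
have m1 := factor_ge1 J.
have app_z k : app_ z k = (app_ x k + 3 * nq (scale J)) / nq (factor J).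
  rewrite /app_ hz val_lin -(nq1 M) -nqD npredK; last first.
    by move=> E; move: m1; rewrite E nq0; lra.
  rewrite nqM !nqD nq0 nq1 subr0 mulr1; congr ((_ + _ * _) / _); ring.
have s_def : nq (scale J) = nq (nnum (x ∙ 0)) + nq (nneg (x ∙ 0)) + 2.
  by rewrite /scale pr2E /s !nqD nq1; ring.
have x_bound k : `|app_ x k| <= nq (scale J) - 1.
  have h0 : `|app_ x 0| <= nq (scale J) - 2.
    rewrite s_def /app_ /val; have := den_gt0 (nden (x ∙ 0)) => hd.
    have := nq_ge0 (nnum (x ∙ 0)); have := nq_ge0 (nneg (x ∙ 0)); have := nq_ge0 (nden (x ∙ 0)).
    set a := nq (nnum _); set b := nq (nneg _); set c := nq (nden _) in hd * => hc hb ha.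
    rewrite normrM (ger0_norm (x := (c + 1)^-1)); last by rewrite invr_ge0 ltW.
    rewrite ler_pdivrMr //; have : `|a - b| <= a + b by rewrite ler_norml; lra.
    move/le_trans; apply; rewrite -[leLHS]mulr1 addrK ler_pM //; lra.
  have := isR_dist hx (@nle0 M k); rewrite ee0; move: h0.
  by rewrite !ler_norml ltr_norml; lra.
have z_real : isR z.
  apply/isRE; split=> [k|k i]; first by rewrite hz; apply: code_lin.
  rewrite !app_z -mulrBl normrM (ger0_norm (x := _^-1)); last by rewrite invr_ge0; lra.
  have := isR_dist hx (nle_add (a := k) (c := i)); set m := nq _ in m1 *.
  have -> : app_ x (k + i) + 3 * nq (scale J) - (app_ x k + 3 * nq (scale J))
    = app_ x (k + i) - app_ x k by ring.
  move=> h; rewrite ltr_pdivrMr; last by lra.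
  by apply: lt_le_trans h _; rewrite ler_peMr // ltW // ee_gt0.
(* The margin 1 between |x_k| and scale J becomes 1 / factor J after encoding; an index with 2 *
   2^-k below that witnesses both strict inequalities of [within]. *)
have [k hk] := ee_small (x := (2 * nq (factor J))^-1) (ltac:(rewrite invr_gt0; lra)).
have mk : 2 * ee k * nq (factor J) < 1.
  move: hk; rewrite -[ltRHS]mul1r ltr_pdivlMr; last by lra.
  by rewrite mulrCA mulrA.
have eJ1 : ee (J + 1) = 2 * nq (scale J) / nq (factor J).
  rewrite nq_scale (eeS (J + 1)); set m := nq (factor J) in m1 *.
  by field; rewrite gt_eqF //; lra.
have eJ : ee J = 4 * nq (scale J) / nq (factor J).
  rewrite nq_scale (eeS (J + 1)) eeS; set m := nq (factor J) in m1 *.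
  by field; rewrite gt_eqF //; lra.
have m0 : 0 < nq (factor J) by lra.
exists z; split=> //; first exact: pr1E.
  split; apply/ltRE => //; try exact: rconst_real; exists k.
    rewrite app_rconst app_z eJ1 ltr_pdivlMr // mulrDl divfK ?gt_eqF //.
    by have := x_bound k; rewrite ler_norml; lra.
  rewrite app_rconst app_z eJ ltr_pdivlMr // mulrDl divfK ?gt_eqF //.
  by have := x_bound k; rewrite ler_norml; lra.
apply: (eqR_far (k := 1)) => //; first exact: decode_real.
move=> n'; exists n'; first exact: nlt_irr.
rewrite app_decode app_z divfK ?gt_eqF // addrK mul1r ltW //.
by apply: isR_dist => //; apply: nle_add.
Qed.

Lemma within_ext J z z' : isR z -> isR z' -> eqR z z' -> within J z -> within J z'.
Proof.
move=> hz hz' E [h1 h2]; split.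
  by apply: ltR_eqR h1 E => //; apply: rconst_real.
by apply: eqR_ltR h2 => //; apply: rconst_real.
Qed.

(** For J < J' the upper end 2^-J' of one interval is at most the lower end 2^-(J+1) of the
    other. *)
Lemma within_uniq J J' z : isR z -> within J z -> within J' z -> J = J'.
Proof.
move=> hz.
have h I I' : within I z -> within I' z -> ~ mlt I I'.
  move=> [h1 _] [_ h2] /nlt_nle /ee_anti.
  have := ltR_between (rconst_real _) (rconst_real _) hz (app_rconst _) (app_rconst _) h1 h2.
  by lra.
by move=> h1 h2; have [/h|[//|/h]] := nlt_total J J'; case.
Qed.

(** [cocode0R] is applied to the set of all codes. A code lies in a unique interval J, so J together
    with the [Y]-value of the decoded real is an injective label. A real may have codes in several
    intervals, which only produces repetitions. *)
Lemma enum_union (E : dom M (N ⇒ T1 ⇒ T1)) (Y : dom M (N ⇒ T1 ⇒ N)) :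
  cocode0R M -> (forall n, setR (E ∙ n)) ->
  (forall n, extOnR (Y ∙ n) (E ∙ n) /\ injOnR (Y ∙ n) (E ∙ n)) ->
  (exists n, nonemptyR (E ∙ n)) ->
  exists (I : dom M (N ⇒ N)) (x : dom M (N ⇒ T1)),
    (forall i, isR (x ∙ i) /\ posR (E ∙ (I ∙ i) ∙ (x ∙ i))) /\
    forall n y, isR y -> posR (E ∙ n ∙ y) -> exists i, I ∙ i = n /\ eqR (x ∙ i) y.
Proof.
move=> hC hset hY [n0 [x0 [x0_real x0_in]]].
pose inA z J := within J z /\ posR (E ∙ (pr1 M ∙ J) ∙ (decode ∙ J ∙ z)).
have inA_ext z z' J : isR z -> isR z' -> eqR z z' -> inA z J -> inA z' J.
  move=> hz hz' e [h1 h2]; split; first exact: within_ext e h1.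
  have hd := decode_ext J hz hz' e.
  by apply: posR_eqR h2 ((hset _).2 _ _ _ _ hd); try apply: (hset _).1; apply: decode_real.
(* E2 decides membership, so [A] can be a characteristic function with values 1 and 0; real-equal
   arguments then give identical values. *)
have [A hA] : exists A : dom M (T1 ⇒ T1), forall z k,
    A ∙ z ∙ k = ifp (exists J, inA z J) (nrat 1 0 0) (nrat 0 0 0).
  by apply: rep_ex2; rewrite /inA /within /rconst /nrat /npair /npow2; repE hE.
have AT z : (exists J, inA z J) -> A ∙ z = mpi ∙ nrat 1 0 0.
  by move=> h; apply: (@rm_ext M) => k; rewrite hA ifpT // piE.
have AF z : ~ (exists J, inA z J) -> A ∙ z = mpi ∙ nrat 0 0 0.
  by move=> h; apply: (@rm_ext M) => k; rewrite hA ifpF // piE.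
have AE z : posR (A ∙ z) <-> exists J, inA z J.
  split=> [h|/AT ->]; last exact: posR_one.
  by apply: contrapT => /AF h'; move: h; rewrite h' => /posR_zero.
have [Jf hJ] : exists Jf : dom M (T1 ⇒ N), forall z, (exists J, inA z J) -> inA z (Jf ∙ z).
  apply: (@choice_T1 M (fun z J => (exists J, inA z J) -> inA z J)).
    by rewrite /inA /within /rconst /nrat /npair /npow2; repE hE.
  move=> z; have [[J h]|h] := pselect (exists J, inA z J); first by exists J.
  by exists 0.
(* Countability asks for a label that respects equality on all reals, hence the constant 0 outside
   [A]. *)
have [YA hYA] : exists YA : dom M (T1 ⇒ N), forall z,
    YA ∙ z = ifp (posR (A ∙ z)) (npair (Jf ∙ z) (Y ∙ (pr1 M ∙ (Jf ∙ z)) ∙ (decode ∙ (Jf ∙ z) ∙ z))) 0.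
  by apply: rep_ex1; rewrite /npair; repE hE.
have Asame z z' : isR z -> isR z' -> eqR z z' -> A ∙ z = A ∙ z'.
  move=> hz hz' e; have [h|h] := pselect (exists J, inA z J).
    by rewrite (AT _ h) AT //; case: h => J h; exists J; apply: inA_ext h.
  rewrite (AF _ h) AF // => -[J h']; apply: h; exists J; apply: inA_ext h' => //.
  exact: eqR_sym.
have Areal z : isR (A ∙ z).
  have [h|h] := pselect (exists J, inA z J); first by rewrite (AT _ h); apply: isR_const.
  by rewrite (AF _ h); apply: isR_const.
have Jsame z z' : isR z -> isR z' -> eqR z z' -> posR (A ∙ z) -> Jf ∙ z = Jf ∙ z'.
  move=> hz hz' e hin; have hin' : posR (A ∙ z') by rewrite -(Asame z).
  have [h _] := hJ _ ((AE z).1 hin); have [h' _] := hJ _ ((AE z').1 hin').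
  by apply: within_uniq h'; last exact: within_ext e h.
have [w [hw wE]] : enumR A.
  apply: hC.
  - split=> [//|z hz z' hz' e]; rewrite (Asame z z') //; exact: eqR_refl.
  - move=> z hz /AE [J [[h1 h2] _]]; split=> h.
      have := ltR_between (rconst_real _) (isR_const _ _ _) hz (app_rconst _) (app_const _ _ _) h1 h.
      by rewrite nq0 subrr mul0r; have := ee_gt0 (J + 1); lra.
    have := ltR_between (isR_const _ _ _) (rconst_real _) hz (app_const _ _ _) (app_rconst _) h h2.
    by rewrite nq0 nq1 subr0 add0r divr1; have := ee_le1 J; lra.
  - have [J [z [J1 hz hJz hd]]] := encode n0 x0_real.
    exists z; split=> //; apply/AE; exists J; split=> //; rewrite J1.
    apply: posR_eqR x0_in ((hset _).2 _ _ _ _ (eqR_sym hd)) => //; try exact: decode_real.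
      by apply: (hset _).1.
    by apply: (hset _).1; apply: decode_real.
  - exists YA; split=> [z hz z' hz' e|z hz z' hz' hin hin'].
      rewrite !hYA; have [h|h] := pselect (posR (A ∙ z)); last first.
        by rewrite !ifpF // -(Asame z).
      have h' : posR (A ∙ z') by rewrite -(Asame z).
      rewrite !ifpT // -(Jsame z z') //; set J := Jf ∙ z.
      have [_ hd] := hJ _ ((AE z).1 h); have [_ hd'] := hJ _ ((AE z').1 h').
      rewrite -(Jsame z z') // -/J in hd'.
      rewrite ((hY (pr1 M ∙ J)).1 _ (decode_real J hz) _ (decode_real J hz')) //.
      exact: decode_ext.
    rewrite !hYA !ifpT // => e.
    have eJ := congr1 (fun a => pr1 M ∙ a) e; rewrite /= !pr1E in eJ.
    have eY := congr1 (fun a => pr2 M ∙ a) e; rewrite /= !pr2E -eJ in eY.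
    have [_ hd] := hJ _ ((AE z).1 hin); have [_ hd'] := hJ _ ((AE z').1 hin').
    rewrite -eJ in hd'; apply: (decode_inj (J := Jf ∙ z)) => //.
    by apply: (hY (pr1 M ∙ (Jf ∙ z))).2 => //; apply: decode_real.
have [I hI] := @rep_ex1 M _ _ (fun i => pr1 M ∙ (Jf ∙ (w ∙ i))) (ltac:(rep)).
have [x hx] := @rep_ex1 M _ _ (fun i => decode ∙ (Jf ∙ (w ∙ i)) ∙ (w ∙ i)) (ltac:(rep)).
exists I, x; split=> [i|n y hy yin].
  have [wr win] := hw i; rewrite hx hI; split; first exact: decode_real.
  by have [_] := hJ _ ((AE _).1 win).
have [J [z [J1 hz hJz hd]]] := encode n hy.
have zin : inA z J.
  split=> //; rewrite J1; apply: posR_eqR yin ((hset _).2 _ _ _ _ (eqR_sym hd)) => //.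
  - by apply: (hset _).1.
  - by apply: (hset _).1; apply: decode_real.
  - exact: decode_real.
have [i hi] := (wE z hz).1 ((AE z).2 (ex_intro _ _ zin)).
have [wr win] := hw i; exists i; rewrite hI hx.
have -> : Jf ∙ (w ∙ i) = J.
  have [h1 _] := hJ _ ((AE _).1 win); apply: within_uniq h1 _ => //.
  by apply: within_ext hJz => //; apply: eqR_sym.
split=> //; apply: eqR_trans hd => //; try exact: decode_real.
exact: decode_ext.
Qed.
End Coding.

(** * Koenig's lemma *)

Section Koenig.
Variable M : rmodel.
Hypothesis hE : hasE2 M.
Implicit Types (a b c d n m y : dom M N).

Lemma nsub_add a b c : nsub ∙ a ∙ (b + c) = nsub ∙ (nsub ∙ a ∙ b) ∙ c.
Proof.
apply: (@dec_ind M (fun c => nsub ∙ a ∙ (b + c) = nsub ∙ (nsub ∙ a ∙ b) ∙ c)); first by rep.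
  by rewrite addr0 nsub0.
by move=> {}c E; rewrite addrA !nsubS E.
Qed.

Lemma nsubDr a b : nsub ∙ (a + b) ∙ b = a.
Proof. by rewrite addrC nsubDl. Qed.

(** Induction on the bound; the statement contains unbounded number quantifiers, which E2 makes
    admissible. *)
Lemma bounded_collection (P : dom M N -> dom M N -> Prop) b :
  dec (fun r : tup M [N; N] => P r.2.1 r.1) ->
  (forall y, mlt y b -> exists d, P y d) ->
  exists D, forall y, mlt y b -> exists d, mle d D /\ P y d.
Proof.
move=> [c [F hF] E].
have {}E y d : P y d <-> F ∙ y ∙ d = 0 by rewrite (E (d, (y, tt))) -hF.
move=> h; have {}h y : mlt y b -> exists d, F ∙ y ∙ d = 0 by move=> /h [d /E]; exists d.
suff [D hD] : exists D, forall y, mlt y b -> exists d, mle d D /\ F ∙ y ∙ d = 0.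
  by exists D => y /hD [d [h1 /E]]; exists d.
move: h; apply: (@dec_ind M (fun b => (forall y, mlt y b -> exists d, F ∙ y ∙ d = 0) ->
  exists D, forall y, mlt y b -> exists d, mle d D /\ F ∙ y ∙ d = 0)); first by repE hE.
  by move=> _; exists 0 => y /nlt0.
move=> {}b IH h; have [|D hD] := IH.
  by move=> y yb; apply: h; apply: nlt_trans yb (nlt_succ b).
have [d hd] := h b (nlt_succ b); exists (D + d) => y /nltS [/hD [d' [h1 h2]]| ->].
  by exists d'; split => //; apply: nle_trans h1 (@nle_add M D d).
by exists d; split => //; rewrite addrC; apply: nle_add.
Qed.

(** A finitely branching tree of numbers: [L ∙ n] vanishes on the nodes of level n, [K] bounds them,
    and [par ∙ n] sends level n + 1 to level n. Nodes of different levels may be the same number. *)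
Variables (L : dom M (N ⇒ N ⇒ N)) (K : dom M (N ⇒ N)) (par : dom M (N ⇒ N ⇒ N)).
Let lv n y := L ∙ n ∙ y = 0.
Hypothesis lv_bound : forall n y, lv n y -> mlt y (K ∙ n + 1).
Hypothesis lv_ex : forall n, exists y, lv n y.
Hypothesis lv_par : forall n y, lv (n + 1) y -> lv n (par ∙ n ∙ y).

(* [It m y j] is the ancestor of the node [y] of level [m] at level [m - j]. *)
Lemma ancestor_ex : exists It : dom M (N ⇒ N ⇒ N ⇒ N),
  (forall m y, It ∙ m ∙ y ∙ 0 = y) /\
  (forall m y j, It ∙ m ∙ y ∙ (j + 1) = par ∙ (nsub ∙ m ∙ (j + 1)) ∙ (It ∙ m ∙ y ∙ j)).
Proof.
have [||F [[G hG] F0 FS]] := @rep_rec M [N; N] (fun r => r.1)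
  (fun r j z => par ∙ (nsub ∙ r.2.1 ∙ (j + 1)) ∙ z); try by rep.
have {}hG m y j : G ∙ m ∙ y ∙ j = F (y, (m, tt)) j by apply: (hG (j, (y, (m, tt)))).
by exists G; split=> *; rewrite !hG ?F0 ?FS.
Qed.

(** A node is good if it has descendants at every depth. There is a good root, every good node has a
    good child, and choice followed by recursion produces the path. *)
Lemma koenig : exists f : dom M (N ⇒ N), forall n,
  lv n (f ∙ n) /\ par ∙ n ∙ (f ∙ (n + 1)) = f ∙ n.
Proof.
have [It [It0 ItS]] := ancestor_ex.
have It_lv m y j : lv m y -> mle j m -> lv (nsub ∙ m ∙ j) (It ∙ m ∙ y ∙ j).
  move=> hy; apply: (@dec_ind M (fun j => mle j m -> lv (nsub ∙ m ∙ j) (It ∙ m ∙ y ∙ j))).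
  - by rewrite /lv; rep.
  - by rewrite nsub0 It0.
  move=> {}j IH hj; rewrite ItS; apply: lv_par.
  have jm : mle j m by apply: nle_trans hj; apply: nle_add.
  have [c E] := nle_ex hj; have -> : nsub ∙ m ∙ (j + 1) + 1 = nsub ∙ m ∙ j; last exact: IH.
  by rewrite E nsubDl -addrA (addrC 1) nsubDl.
have It_comp m y j i : It ∙ (nsub ∙ m ∙ j) ∙ (It ∙ m ∙ y ∙ j) ∙ i = It ∙ m ∙ y ∙ (j + i).
  apply: (@dec_ind M (fun i => It ∙ (nsub ∙ m ∙ j) ∙ (It ∙ m ∙ y ∙ j) ∙ i = It ∙ m ∙ y ∙ (j + i))).
  - by rep.
  - by rewrite It0 addr0.
  by move=> {}i E; rewrite addrA !ItS E -!nsub_add addrA.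
pose desc n y d := exists y', lv (n + d) y' /\ It ∙ (n + d) ∙ y' ∙ d = y.
pose good n y := forall d, desc n y d.
(* The pigeonhole step, stated with a side condition S y = c to serve twice: with [S] constant for
   the root and with [S] the parent map for a child. If no such y were good, some D would bound
   depths at which they all fail, against the hypothesis at D. *)
have sel n (S : dom M (N ⇒ N)) c :
    (forall D, exists y', lv (n + D) y' /\ S ∙ (It ∙ (n + D) ∙ y' ∙ D) = c) ->
    exists y, [/\ lv n y, S ∙ y = c & good n y].
  move=> h; apply: contrapT => /forallNP nex.
  have [||D hD] := @bounded_collection (fun y d => ~ (lv n y /\ S ∙ y = c /\ desc n y d)) (K ∙ n + 1).
  - by rewrite /desc /lv; repE hE.
  - move=> y _; have [hy|hy] := pselect (lv n y /\ S ∙ y = c); last first.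
      by exists 0 => -[h1 [h2 _]]; apply: hy.
    have /existsNP [d hd] : ~ good n y by move=> hg; apply: (nex y); case: hy.
    by exists d => -[_ [_]].
  have [y' [h1 h2]] := h D.
  set y := It ∙ (n + D) ∙ y' ∙ D in h2.
  have Dm : mle D (n + D) by rewrite addrC; apply: nle_add.
  have ly : lv n y by have := It_lv _ _ _ h1 Dm; rewrite nsubDr.
  have [d [/nle_ex [e De] hd]] := hD y (lv_bound ly); apply: hd; do 2 split=> //.
  (* Going up e levels from the node at depth D gives a descendant of y at depth d, where y was
     supposed to have none. *)
  have E : n + D = n + d + e by rewrite De addrA.
  exists (It ∙ (n + D) ∙ y' ∙ e); split.
    have := It_lv _ _ e h1; rewrite {2}E nsubDr; apply.
    by rewrite E addrC; apply: nle_add.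
  have := It_comp (n + D) y' e d; rewrite {1}E nsubDr => ->.
  by rewrite /y {3}De (addrC d).
have [root [root0 _ root_good]] : exists y, [/\ lv 0 y, mpi ∙ 0 ∙ y = 0 & good 0 y].
  by apply: sel => D; have [y hy] := lv_ex (0 + D); exists y; rewrite piE.
have child n y : good n y -> exists y', [/\ lv (n + 1) y', par ∙ n ∙ y' = y & good (n + 1) y'].
  move=> hg; apply: sel => D; have [y' [h1 h2]] := hg (1 + D).
  exists y'; rewrite -addrA; split=> //; rewrite -[RHS]h2.
  by rewrite [in RHS](addrC 1 D) ItS (addrC 1 D) nsubDr.
have [||ch hch] := @choice_NN M (fun n y y' => good n y -> lv (n + 1) y' /\ par ∙ n ∙ y' = y /\ good (n + 1) y').
- by rewrite /good /desc /lv; repE hE.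
- move=> n y; have [/child [y' [h1 h2 h3]]|h] := pselect (good n y); first by exists y'.
  by exists 0.
have [||F [[f hf] F0 FS]] := @rep_rec M [] (fun _ => root) (fun _ n y => ch ∙ n ∙ y); try by rep.
have {}hf n : f ∙ n = F tt n by apply: (hf (n, tt)).
have {}F0 : f ∙ 0 = root by rewrite hf F0.
have {}FS n : f ∙ (n + 1) = ch ∙ n ∙ (f ∙ n) by rewrite !hf FS.
have fg : forall n, lv n (f ∙ n) /\ good n (f ∙ n).
  apply: dec_ind; first by rewrite /good /desc /lv; repE hE.
    by rewrite F0.
  by move=> n [_ /hch]; rewrite -FS => -[h1 [_ h2]].
exists f => n; have [h1 h2] := fg n; split=> //.
by have [_ []] := hch _ _ h2; rewrite -FS.
Qed.
End Koenig.

(** The enumeration of all E_n replaces reals by numbers: the nodes of level n are the values of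
    [Y ∙ n] on E_n, each standing for one real up to equality. E2 makes this tree and the relation
    between its nodes decidable, so parents can be chosen. *)
Lemma korg_of_cocode0 (M : rmodel) : cocode0R M -> Korg2R M.
Proof.
move=> hC E R [hset [k [Y hY]]] hne [Rreal Rext] hpred.
(* The finiteness witness of E_0 respects equality only on members of E_0, which is all that
   [E2_of_set] asks of a label. *)
have hE : hasE2 M.
  have [a [ar ain]] := hne 0; have [h1 [_ h2]] := hY 0.
  apply: (E2_of_set (A := E ∙ 0) (Y := Y ∙ 0) (a := a)) => //.
  - exact: (hset 0).1.
  - by move=> *; apply: (hset 0).2.
  - by move=> *; apply: h2.
  - by move=> *; apply: h1.
have [||I [x [hx xE]]] := enum_union hE (Y := Y) hC hset.
- by move=> n; have [h1 [_ h2]] := hY n.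
- by exists 0.
pose P n y i := I ∙ i = n /\ Y ∙ n ∙ (x ∙ i) = y.
have [||idx hidx] := @choice_NN M (fun n y i => (exists i, P n y i) -> P n y i).
- by rewrite /P; repE hE.
- move=> n y; have [[i h]|h] := pselect (exists i, P n y i); first by exists i.
  by exists 0.
have [L hL] : exists L : dom M (N ⇒ N ⇒ N), forall n y, L ∙ n ∙ y = 0 <-> exists i, P n y i.
  have [L hL] := @rep_ex2 M _ _ _ (fun n y => ifp (exists i, P n y i) 0 1)
    (ltac:(rewrite /P; repE hE)).
  exists L => n y; rewrite hL; have [h|h] := pselect (exists i, P n y i).
    by rewrite ifpT.
  by rewrite ifpF //; split=> [/eqP|] //; rewrite oner_eq0.
pose X n y := x ∙ (idx ∙ n ∙ y).
have X_in n y : L ∙ n ∙ y = 0 -> isR (X n y) /\ posR (E ∙ n ∙ X n y) /\ Y ∙ n ∙ X n y = y.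
  by move=> /hL/hidx [h1 h2]; have := hx (idx ∙ n ∙ y); rewrite h1 => -[].
have X_ex n z : isR z -> posR (E ∙ n ∙ z) -> exists y, L ∙ n ∙ y = 0 /\ eqR (X n y) z.
  move=> hz /(xE _ _ hz) [i [h1 h2]]; have [xr xin] := hx i; rewrite h1 in xin.
  have hy : L ∙ n ∙ (Y ∙ n ∙ (x ∙ i)) = 0 by apply/hL; exists i.
  have [Xr [Xin XY]] := X_in _ _ hy.
  exists (Y ∙ n ∙ (x ∙ i)); split => //; apply: (eqR_trans _ xr) => //.
  by apply: (hY n).2.2.
have [||par hpar] := @choice_NN M (fun n y y' => L ∙ (n + 1) ∙ y = 0 ->
    L ∙ n ∙ y' = 0 /\ posR (R ∙ X n y' ∙ X (n + 1) y)).
- by rewrite /X; repE hE.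
- move=> n y; have [h|h] := pselect (L ∙ (n + 1) ∙ y = 0); last by exists 0.
  have [Xr [Xin _]] := X_in _ _ h; have [z [zr [zin hR]]] := hpred n _ Xr Xin.
  have [y' [h1 h2]] := X_ex _ _ zr zin; exists y' => _; split=> //.
  have [Xr' _] := X_in _ _ h1.
  apply: posR_eqR hR _; try exact: Rreal.
  by apply: Rext => //; [apply: eqR_sym | apply: eqR_refl].
have [|||f hf] := @koenig M hE L k par.
- by move=> n y /X_in [h1 [h2 <-]]; apply: (hY n).2.1.
- move=> n; have [z [zr zin]] := hne n; have [y [h _]] := X_ex _ _ zr zin.
  by exists y.
- by move=> n y /hpar [].
have [X' hX'] := @rep_ex1 M _ _ (fun n => X n (f ∙ n)) (ltac:(rewrite /X; rep)).
exists X' => n; have [h1 h2] := hf n; have [h3 _] := hf (n + 1).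
have [r1 [r2 _]] := X_in _ _ h1; rewrite !hX'; split=> //; split=> //.
by have [_] := hpar _ _ h3; rewrite h2.
Qed.

(** * The implications between the principles *)

Section Implications.
Variable M : rmodel.
Implicit Types (a b c n m i j : dom M N) (x y z : dom M T1).

(** With a constantly true relation, [Korg2R] acts as a choice from the singletons, whose finiteness
    is witnessed by the constant 0. The test Y x = n is numerical, so the singletons are definable
    before E2 is available. The line is not cut down to [0,1] because [cocode0_of_korg] applies this
    to a set containing all natural numbers. *)
Lemma enum_of_strong (A : dom M (T1 ⇒ T1)) : Korg2R M -> setR A -> strongR A -> enumR A.
Proof.
move=> hK [Ar Ax] [Y [Yx [Yi Ys]]].
have [E hE] : exists E : dom M (N ⇒ T1 ⇒ T1), forall n x k,
    E ∙ n ∙ x ∙ k = ifp (Y ∙ x = n) (A ∙ x ∙ k) (nrat 0 0 0).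
  by apply: rep_ex3; rewrite /nrat /npair; rep.
have ET n x : Y ∙ x = n -> E ∙ n ∙ x = A ∙ x.
  by move=> h; apply: (@rm_ext M) => k; rewrite hE ifpT.
have EF n x : Y ∙ x <> n -> E ∙ n ∙ x = mpi ∙ nrat 0 0 0.
  by move=> h; apply: (@rm_ext M) => k; rewrite hE ifpF // piE.
have Ein n x : posR (E ∙ n ∙ x) -> Y ∙ x = n /\ posR (A ∙ x).
  have [h|h] := pselect (Y ∙ x = n); first by rewrite ET.
  by rewrite EF // => /posR_zero.
have [R hR] : exists R : dom M (T1 ⇒ T1 ⇒ T1), forall x y, R ∙ x ∙ y = mpi ∙ nrat 1 0 0.
  by apply: rep_ex2; rep.
have one_real := isR_const (1 : dom M N) 0 0.
have [||||x hx] := hK E R.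
- split.
    move=> n; split=> [x xr|x xr y yr e]; have [h|h] := pselect (Y ∙ x = n).
    + by rewrite ET //; apply: Ar.
    + by rewrite EF //; apply: isR_const.
    + by rewrite !ET // -?(Yx x _ y) //; apply: Ax.
    + by rewrite !EF // -?(Yx x _ y) //; apply/eqR_refl/isR_const.
  exists (mpi ∙ 0), (mpi ∙ (mpi ∙ 0)) => n; rewrite !piE.
  split; first by move=> *; rewrite !piE.
  split; first by move=> *; rewrite piE; apply: nlt_succ.
  by move=> x xr y yr /Ein [h1 h2] /Ein [h3 h4] _; apply: Yi => //; rewrite h1.
- by move=> n; have [x [xr [xin h]]] := Ys n; exists x; rewrite ET.
- by split=> *; rewrite !hR //; apply: eqR_refl.
- move=> n x xr _; have [y [yr [yin h]]] := Ys n; exists y.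
  by rewrite ET // hR; do 2 split=> //; apply: posR_one.
exists x; split=> [n|y yr].
  by have [xr [/Ein [_ h] _]] := hx n.
split=> [yin|[n e]].
  exists (Y ∙ y); have [xr [/Ein [h1 h2] _]] := hx (Y ∙ y).
  exact: Yi.
have [xr [/Ein [_ h] _]] := hx n.
by apply: posR_eqR h (Ax _ xr _ yr e); apply: Ar.
Qed.

Lemma nparity a b : a + a + 1 <> b + b.
Proof.
move/(congr1 (@nq M)); rewrite !nqD nq1.
have [/nlt_nle/nq_le|[->|/nlt_nle/nq_le]] := nlt_total a b; rewrite ?nqD ?nq1; lra.
Qed.

Lemma ndouble_inj a b : a + a = b + b -> a = b.
Proof.
move/(congr1 (@nq M)); rewrite !nqD.
by have [/nq_lt|[//|/nq_lt]] := nlt_total a b => h1 h2; exfalso; lra.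
Qed.

Definition nreal n : dom M T1 := mpi ∙ nrat n 0 0.

Lemma nreal_inj n m : eqR (nreal n) (nreal m) -> n = m.
Proof.
move/eqRE => /(_ (isR_const _ _ _) (isR_const _ _ _) (1 + 1)).
rewrite !app_const !nq0 !subr0 add0r !divr1 eeS ee1 ler_norml => h.
by have [/nlt_nle/nq_le|[//|/nlt_nle/nq_le]] := nlt_total n m; rewrite nqD nq1 => h'; exfalso; lra.
Qed.

(** Adding the natural numbers provides the sequence of distinct elements that [CBNR] demands, even
    when [A] is finite. *)
Lemma cocode0_of_korg : Korg2R M -> CBNR M -> cocode0R M.
Proof.
move=> hK hCB A hset _ [a0 [a0r a0in]] [Y [Yx Yi]]; have [Ar Ax] := hset.
have hE : hasE2 M.
  apply: (E2_of_set (A := A) (Y := Y) (a := a0)) => //.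
  - by move=> *; apply: Ax.
  - by move=> *; apply: Yi.
  - by move=> *; apply: Yx.
pose inB x n := eqR x (nreal n).
have nr n : isR (nreal n) by apply: isR_const.
have inB_ext x y n : isR x -> isR y -> eqR x y -> inB x n -> inB y n.
  by move=> xr yr e; apply: eqR_trans => //; apply: eqR_sym.
have inB_uniq x n m : isR x -> inB x n -> inB x m -> n = m.
  by move=> xr h1 h2; apply: nreal_inj; apply: eqR_trans h2 => //; apply: eqR_sym.
have [B hB] : exists B : dom M (T1 ⇒ T1), forall x k,
    B ∙ x ∙ k = ifp (exists n, inB x n) (nrat 1 0 0) (A ∙ x ∙ k).
  by apply: rep_ex2; rewrite /inB /nreal /nrat /npair; repE hE.
have BT x : (exists n, inB x n) -> B ∙ x = mpi ∙ nrat 1 0 0.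
  by move=> h; apply: (@rm_ext M) => k; rewrite hB ifpT // piE.
have BF x : ~ (exists n, inB x n) -> B ∙ x = A ∙ x.
  by move=> h; apply: (@rm_ext M) => k; rewrite hB ifpF.
have BE x : posR (B ∙ x) <-> (exists n, inB x n) \/ posR (A ∙ x).
  have [h|h] := pselect (exists n, inB x n).
    by rewrite BT //; split=> _; [left | apply: posR_one].
  by rewrite BF //; split=> [|[]] //; right.
have exB x y : isR x -> isR y -> eqR x y -> (exists n, inB x n) -> exists n, inB y n.
  by move=> xr yr e [n hn]; exists n; apply: inB_ext e hn.
have Apos x y : isR x -> isR y -> eqR x y -> posR (A ∙ x) -> posR (A ∙ y).
  by move=> xr yr e h; apply: posR_eqR h (Ax _ xr _ yr e); apply: Ar.
have Br x : isR x -> isR (B ∙ x).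
  move=> xr; have [h|h] := pselect (exists n, inB x n).
    by rewrite BT //; apply: isR_const.
  by rewrite BF //; apply: Ar.
have Bset : setR B.
  split=> // x xr y yr e; have [h|h] := pselect (exists n, inB x n).
    by rewrite !BT //; [apply/eqR_refl/isR_const | apply: exB e h].
  rewrite !BF //; first exact: Ax.
  by move=> h'; apply: h; apply: exB h' => //; apply: eqR_sym.
have [idx hidx] : exists idx : dom M (T1 ⇒ N), forall x, (exists n, inB x n) -> inB x (idx ∙ x).
  apply: (@choice_T1 M (fun x n => (exists n, inB x n) -> inB x n)).
    by rewrite /inB /nreal /nrat /npair; repE hE.
  move=> x; have [[n h]|h] := pselect (exists n, inB x n); first by exists n.
  by exists 0.
(* Odd labels for the elements of [A] and even ones for the natural numbers outside [A] keep the
   label injective; all other reals get 0, since a label must be defined and extensional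
   everywhere. *)
have [Z hZ] : exists Z : dom M (T1 ⇒ N), forall x, Z ∙ x =
    ifp (posR (A ∙ x)) (Y ∙ x + Y ∙ x + 1) (ifp (exists n, inB x n) (idx ∙ x + idx ∙ x) 0).
  by apply: rep_ex1; rewrite /inB /nreal /nrat /npair; repE hE.
have [x [xin xE]] : enumR B.
  apply: enum_of_strong => //; apply: hCB => //.
    exists Z; split.
      move=> x xr y yr e; rewrite !hZ; have [h|h] := pselect (posR (A ∙ x)).
        by rewrite !ifpT ?(Yx _ xr _ yr e) //; apply: Apos e h.
      have h' : ~ posR (A ∙ y) by move=> h'; apply: h; apply: Apos h' => //; apply: eqR_sym.
      rewrite !(ifpF _ _ h, ifpF _ _ h').
      have [k|k] := pselect (exists n, inB x n).
        have k' := exB _ _ xr yr e k; rewrite !ifpT //.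
        by rewrite (inB_uniq y _ _ yr (inB_ext _ _ _ xr yr e (hidx _ k)) (hidx _ k')).
      rewrite !ifpF // => k'; apply: k; apply: exB k' => //; exact: eqR_sym.
    move=> x xr y yr /BE hx /BE hy; rewrite !hZ.
    have [h|h] := pselect (posR (A ∙ x)); have [h'|h'] := pselect (posR (A ∙ y)).
    + rewrite !ifpT // => /ncancel/ndouble_inj; exact: Yi.
    + case: hy => // hy; rewrite ifpT // ifpF // ifpT // => /nparity [].
    + case: hx => // hx; rewrite ifpF // ifpT // ifpT // => /esym/nparity [].
    + case: hx => // hx; case: hy => // hy; rewrite ifpF // ifpT // ifpF // ifpT //.
      move/ndouble_inj => e; apply: (eqR_trans _ (nr (idx ∙ x))) => //; first exact: hidx.
      by rewrite e; apply/eqR_sym/hidx.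
  have [b hb] := @rep_ex1 M _ _ nreal (ltac:(rewrite /nreal /nrat /npair; rep)).
  exists b; split=> [n|n m nm e]; last by apply: nm; apply: nreal_inj; rewrite -!hb.
  rewrite hb; split=> //; apply/BE; left; exists n; exact: eqR_refl.
(* Entries of the enumeration that fall outside [A] are replaced by the known element [a0]. *)
have [w hw] : exists w : dom M (N ⇒ T1), forall n k,
    w ∙ n ∙ k = ifp (posR (A ∙ (x ∙ n))) (x ∙ n ∙ k) (a0 ∙ k).
  by apply: rep_ex2; repE hE.
have wT n : posR (A ∙ (x ∙ n)) -> w ∙ n = x ∙ n.
  by move=> h; apply: (@rm_ext M) => k; rewrite hw ifpT.
have w_in n : isR (w ∙ n) /\ posR (A ∙ (w ∙ n)).
  have [xr _] := xin n; have [h|h] := pselect (posR (A ∙ (x ∙ n))); first by rewrite wT.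
  suff -> : w ∙ n = a0 by [].
  by apply: (@rm_ext M) => k; rewrite hw ifpF.
exists w; split=> // y yr; split=> [yin|[n e]]; last first.
  by have [wr win] := w_in n; apply: Apos e win.
have [n e] := (xE y yr).1 ((BE y).2 (or_intror yin)).
have [xr _] := xin n; exists n; rewrite wT //.
by apply: Apos yin => //; apply: eqR_sym.
Qed.

(** The new label of y is the number of first occurrences before the first occurrence of y in an
    enumeration. Every number is reached because the given distinct reals force first occurrences
    beyond every index. *)
Lemma CBN_of_cocode0 : cocode0R M -> CBNR M.
Proof.
move=> hC A hset [Y [Yx Yi]] [x [xin x_inj]]; have [Ar Ax] := hset.
have hE : hasE2 M.
  have [xr x_in] := xin 0.
  apply: (E2_of_set (A := A) (Y := Y) (a := x ∙ 0)) => //.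
  - by move=> *; apply: Ax.
  - by move=> *; apply: Yi.
  - by move=> *; apply: Yx.
(* The coding is used for a constant sequence of sets, only to pass from a subset of the line to the
   interval [0,1]. *)
have [||| I [w [wI wE]]] := @enum_union M hE (mpi ∙ A) (mpi ∙ Y) hC.
- by move=> n; rewrite piE.
- by move=> n; rewrite !piE; split=> // y yr z zr _ _; apply: Yx.
- by exists 0; rewrite piE; exists (x ∙ 0).
have {wI} win i : isR (w ∙ i) /\ posR (A ∙ (w ∙ i)) by have := wI i; rewrite piE.
have {I}wE y : isR y -> posR (A ∙ y) -> exists i, eqR (w ∙ i) y.
  by move=> yr yin; have [|i [_ h]] := wE 0 y yr; [rewrite piE | exists i].
have wr i := (win i).1.
pose is_least y i := eqR (w ∙ i) y /\ forall j, mlt j i -> ~ eqR (w ∙ j) y.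
have [rk hrk] : exists rk : dom M (T1 ⇒ N), forall y, (exists i, eqR (w ∙ i) y) -> is_least y (rk ∙ y).
  apply: (@choice_T1 M (fun y i => (exists i, eqR (w ∙ i) y) -> is_least y i)).
    by rewrite /is_least; repE hE.
  move=> y; have [h|h] := pselect (exists i, eqR (w ∙ i) y); last by exists 0.
  have [|i hi] := least hE (P := fun i => eqR (w ∙ i) y) _ h; first by repE hE.
  by exists i.
have least_uniq y i j : is_least y i -> is_least y j -> i = j.
  move=> [h1 h2] [h3 h4]; have [h|[//|h]] := nlt_total i j.
    by case: (h4 _ h).
  by case: (h2 _ h).
have least_ext y z i : isR y -> isR z -> eqR y z -> is_least y i -> is_least z i.
  move=> yr zr e [h1 h2]; split; first exact: eqR_trans h1 e.
  by move=> j /h2 h h3; apply: h; apply: eqR_trans h3 (eqR_sym e).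
(* The zeros of [F] are the indices of first occurrences, and [cnt ∙ j] counts those below j. *)
have [F hF] : exists F : dom M (N ⇒ N), forall j, F ∙ j = 0 <-> is_least (w ∙ j) j.
  have [F hF] := @rep_ex1 M _ _ (fun j => ifp (is_least (w ∙ j) j) 0 1)
    (ltac:(rewrite /is_least; repE hE)).
  exists F => j; rewrite hF; have [h|h] := pselect (is_least (w ∙ j) j).
    by rewrite ifpT.
  by rewrite ifpF //; split=> [/eqP|] //; rewrite oner_eq0.
have [||C [[cnt hcnt] C0 CS]] := @rep_rec M [] (fun _ => 0)
  (fun _ j c => ifp (F ∙ j = 0) (c + 1) c); try by rep.
have {}hcnt j : cnt ∙ j = C tt j by apply: (hcnt (j, tt)).
have {C0}cnt0 : cnt ∙ 0 = 0 by rewrite hcnt C0.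
have {CS hcnt C}cntS j : cnt ∙ (j + 1) = ifp (F ∙ j = 0) (cnt ∙ j + 1) (cnt ∙ j).
  by rewrite !hcnt CS.
have cnt_le j c : mle (cnt ∙ j) (cnt ∙ (j + c)).
  apply: (@dec_ind M (fun c => mle (cnt ∙ j) (cnt ∙ (j + c)))); first by rep.
    by rewrite addr0; apply: nlt_irr.
  move=> {}c h; rewrite addrA cntS; have [k|k] := pselect (F ∙ (j + c) = 0).
    by rewrite ifpT //; apply: nle_trans h _; apply: nle_add.
  by rewrite ifpF.
have cnt_lt i j : F ∙ i = 0 -> mlt i j -> mlt (cnt ∙ i) (cnt ∙ j).
  move=> hi /nlt_ex [c ->]; apply/nlt_nle.
  by have := cnt_le (i + 1) c; rewrite cntS ifpT // -!addrA (addrC 1).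
have cnt_flat J c : (forall i, mle J i -> mlt i (J + c) -> F ∙ i <> 0) -> cnt ∙ (J + c) = cnt ∙ J.
  apply: (@dec_ind M (fun c => (forall i, mle J i -> mlt i (J + c) -> F ∙ i <> 0) ->
    cnt ∙ (J + c) = cnt ∙ J)); first by repE hE.
    by rewrite addr0.
  move=> {}c IH h; rewrite addrA cntS ifpF.
    apply: IH => i h1 h2; apply: h => //; rewrite addrA.
    exact: nlt_trans h2 (nlt_succ _).
  by apply: h; [apply: nle_add | rewrite addrA; apply: nlt_succ].
pose g n := rk ∙ (x ∙ n).
have g_least n : is_least (x ∙ n) (g n).
  by have [xr x_in] := xin n; apply/hrk/wE.
have g_inj n m : g n = g m -> n = m.
  move=> e; apply: contrapT => /x_inj; apply.
  have [h1 _] := g_least n; have [h2 _] := g_least m; rewrite -e in h2.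
  by apply: (eqR_trans _ (wr (g n))) => //; [apply: (xin n).1|apply: (xin m).1|apply: eqR_sym].
(* An internal pigeonhole principle: passing from J to J + 1 admits at most one further n, as [g] is
   injective. *)
have g_unbounded J : exists m, forall n, mlt (g n) J -> mlt n m.
  apply: (@dec_ind M (fun J => exists m, forall n, mlt (g n) J -> mlt n m)).
  - by rewrite /g; repE hE.
  - by exists 0 => n /nlt0.
  move=> {}J [m hm]; have [[n0 h0]|h0] := pselect (exists n, g n = J); last first.
    by exists m => n /nltS [/hm|h] //; case: h0; exists n.
  exists (m + n0 + 1) => n /nltS [/hm h|h].
    by move/nq_lt: h => h; apply/nq_lt; rewrite !nqD nq1; have := nq_ge0 n0; lra.
  rewrite (g_inj n n0 (etrans h (esym h0))).
  by rewrite (addrC m); apply: nlt_addS.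
have F_least y : isR y -> posR (A ∙ y) -> F ∙ (rk ∙ y) = 0.
  move=> yr yin; have h := hrk _ (wE _ yr yin); apply/hF.
  by apply: least_ext h => //; apply: eqR_sym; case: (hrk _ (wE _ yr yin)).
(* The position [g m] is a first occurrence that is not below J; up to the least such position the
   counter does not change. *)
have next J : exists j, F ∙ j = 0 /\ cnt ∙ j = cnt ∙ J.
  have [m hm] := g_unbounded J.
  have [||j [[h1 h2] h3]] := least hE (P := fun j => mle J j /\ F ∙ j = 0); first by rep.
    exists (g m); split; first by move=> /hm/nlt_irr.
    by have [xr x_in] := xin m; apply: F_least.
  exists j; split=> //; have [c E] := nle_ex h1; rewrite E; apply: cnt_flat => i k1 k2 k3.
  by apply: (h3 i); rewrite ?E.
have cnt_surj : forall n, exists j, F ∙ j = 0 /\ cnt ∙ j = n.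
  apply: dec_ind; first by repE hE.
    by have [j [h1 h2]] := next 0; exists j; rewrite h2.
  move=> n [j [h1 h2]]; have [i [h3 h4]] := next (j + 1).
  by exists i; rewrite h4 cntS ifpT // h2.
have [Z hZ] : exists Z : dom M (T1 ⇒ N), forall y, Z ∙ y = ifp (posR (A ∙ y)) (cnt ∙ (rk ∙ y)) 0.
  by apply: rep_ex1; repE hE.
have Apos y z : isR y -> isR z -> eqR y z -> posR (A ∙ y) -> posR (A ∙ z).
  by move=> yr zr e h; apply: posR_eqR h (Ax _ yr _ zr e); apply: Ar.
exists Z; split=> [y yr z zr e|]; last split=> [y yr z zr yin zin|n].
- rewrite !hZ; have [h|h] := pselect (posR (A ∙ y)).
    have h' := Apos _ _ yr zr e h; rewrite !ifpT //.
    have k := hrk _ (wE _ zr h'); have k' := hrk _ (wE _ yr h).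
    by rewrite (least_uniq z _ _ (least_ext _ _ _ yr zr e k') k).
  rewrite !ifpF // => h'; apply: h; apply: Apos h' => //; exact: eqR_sym.
- rewrite !hZ !ifpT // => e; have [k _] := hrk _ (wE _ yr yin); have [k' _] := hrk _ (wE _ zr zin).
  suff E : rk ∙ y = rk ∙ z.
    by rewrite -E in k'; apply: (eqR_trans _ (wr (rk ∙ y))) => //; apply: eqR_sym.
  have [h|[//|h]] := nlt_total (rk ∙ y) (rk ∙ z).
    by have := cnt_lt _ _ (F_least _ yr yin) h; rewrite e => /nlt_irr.
  by have := cnt_lt _ _ (F_least _ zr zin) h; rewrite e => /nlt_irr.
- have [j [h1 h2]] := cnt_surj n; have [jr jin] := win j; exists (w ∙ j); split=> //.
  split=> //; rewrite hZ ifpT // -h2; congr (_ ∙ _).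
  by apply: least_uniq (hrk _ (wE _ jr jin)) _; apply/hF.
Qed.
End Implications.

Theorem theorem3p26 :
  RCAw_proves (Imp Korg2 cocode1)
  /\ RCAw_proves (Iff cocode0 (And Korg2 CBN)).
Proof.
split; apply: completeness => M Mext MM; pose R := RModel Mext MM => e.
  move=> /(sat_Korg2 (M := R)) hK; apply/(sat_cocode1 (M := R)).
  by move=> A hset _ _; apply: enum_of_strong.
split=> [/(sat_cocode0 (M := R)) hC|].
  split; first by apply/(sat_Korg2 (M := R))/korg_of_cocode0.
  by apply/(sat_CBN (M := R))/CBN_of_cocode0.
move=> [/(sat_Korg2 (M := R)) hK /(sat_CBN (M := R)) hCB].
by apply/(sat_cocode0 (M := R))/cocode0_of_korg.
Qed.
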